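(* Let $n,N,M\ge 1$ be integers with $M\ge N$. Let $A_0,A_1,\ldots,A_n\in M_N(\mathbb C)$ be Hermitian with $A_i\succeq 0$ for $i=1,\ldots,n$. Let $G_1,\ldots,G_n$ be independent $M\times M$ GUE matrices and put $$H_M=A_0\otimes I_M+\frac1{\sqrt M}\sum_{i=1}^n A_i\otimes G_i .$$ Then $$\mathbb E\|H_M\|_{\mathrm{op}}\le \rho_*+9\sqrt{\frac{nN}{M}}\,\Bigl\|\sum_{i=1}^n A_i^2\Bigr\|_{\mathrm{op}}^{1/2}.$$
   Context: GUE normalization: $G_i$ is a random Hermitian $M\times M$ matrix with independent centered Gaussian entries on and above the diagonal; diagonal entries are real standard Gaussians $N(0,1)$, and the real and imaginary parts of the off-diagonal entries are independent $N(0,1/2)$. Here $\|\cdot\|_{\mathrm{op}}$ is the operator norm, $Z\succ0$ (resp. $Z\prec 0$) means Hermitian positive (resp. negative) definite, $\succeq 0$ means Hermitian positive semidefinite, and $\lambda_{\max},\lambda_{\min}$ denote the largest and smallest eigenvalues. Define $$\rho_+=\inf_{Z\succ0}\lambda_{\max}\Bigl(A_0+Z+\sum_{i=1}^n A_iZ^{-1}A_i\Bigr),\qquad \rho_-=\sup_{Z\prec0}\lambda_{\min}\Bigl(A_0+Z+\sum_{i=1}^n A_iZ^{-1}A_i\Bigr),$$ with $Z$ ranging over $M_N(\mathbb C)$, and $\rho_*=\max\{\rho_+,-\rho_-\}$. *)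

(* Defs.v *)
From HB Require Import structures.
From mathcomp Require Import all_boot all_order all_algebra.
From mathcomp Require Import complex mxtens.
From mathcomp Require Import all_classical all_reals all_analysis.

Set Implicit Arguments.
Unset Strict Implicit.
Unset Printing Implicit Defensive.

Import Order.TTheory GRing.Theory Num.Theory.

Local Open Scope classical_set_scope.
Local Open Scope ring_scope.
Local Open Scope sesquilinear_scope.

Section Matrices.
Context {R : realType}.
Local Notation C := R[i].

(* In the order of R[i], [0 < z] and [0 <= z] entail that z is real. *)
Definition posdefmx m (Z : 'M[C]_m) : Prop :=
  Z \is hermsymmx /\
  forall v : 'cV[C]_m, v != 0 -> 0 < (v ^t* *m Z *m v) 0 0.

Definition negdefmx m (Z : 'M[C]_m) : Prop :=
  Z \is hermsymmx /\
  forall v : 'cV[C]_m, v != 0 -> (v ^t* *m Z *m v) 0 0 < 0.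

Definition possemidefmx m (Z : 'M[C]_m) : Prop :=
  Z \is hermsymmx /\
  forall v : 'cV[C]_m, 0 <= (v ^t* *m Z *m v) 0 0.

Definition l2norm m (v : 'cV[C]_m) : R :=
  Num.sqrt (\sum_(i < m) ComplexField.Normc.normc (v i 0) ^+ 2).

Definition opnorm m (X : 'M[C]_m) : R :=
  sup [set l2norm (X *m v) | v in [set v : 'cV[C]_m | l2norm v <= 1]].

(* For Hermitian X of positive size the set of eigenvalues is finite, nonempty
   and real, so that the sup and the inf are a maximum and a minimum. *)
Definition lambda_max m (X : 'M[C]_m) : R :=
  sup [set x : R | eigenvalue X (real_complex R x)].

Definition lambda_min m (X : 'M[C]_m) : R :=
  inf [set x : R | eigenvalue X (real_complex R x)].

Section Rho.
Variables (n N : nat) (A0 : 'M[C]_N) (A : 'I_n -> 'M[C]_N).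

Definition rho_map (Z : 'M[C]_N) : 'M[C]_N :=
  A0 + Z + \sum_(i < n) A i *m invmx Z *m A i.

Definition rho_plus : R :=
  inf [set lambda_max (rho_map Z) | Z in [set Z | posdefmx Z]].

Definition rho_minus : R :=
  sup [set lambda_min (rho_map Z) | Z in [set Z | negdefmx Z]].

Definition rho_star : R := Num.max rho_plus (- rho_minus).

End Rho.

Definition H_mx n N M (A0 : 'M[C]_N) (A : 'I_n -> 'M[C]_N)
    (G : 'I_n -> 'M[C]_M) : 'M[C]_(N * M) :=
  tensmx A0 1%:M +
  real_complex R (Num.sqrt M%:R)^-1 *: \sum_(k < n) tensmx (A k) (G k).

End Matrices.

Section Probability.
Context {R : realType} {d : measure_display} {T : measurableType d}.
Variable P : probability T R.

(* Mutual independence of a finite family of classes of events; it is meant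
   for sigma-algebras. *)
Definition mutually_independent (I : finType) (F : I -> set (set T)) : Prop :=
  forall (J : {set I}) (E : I -> set T),
    (forall i, i \in J -> F i (E i)) ->
    P (\bigcap_(i in [set` J]) E i) = (\prod_(i in J) P (E i))%E.

Definition sigma_rv (X : T -> R) : set (set T) :=
  [set X @^-1` B | B in measurable].

Definition sigma_mx m (G : T -> 'M[R[i]]_m) : set (set T) :=
  <<s \bigcup_(ij in [set: 'I_m * 'I_m])
        (sigma_rv (fun w => complex.Re (G w ij.1 ij.2)) `|`
         sigma_rv (fun w => complex.Im (G w ij.1 ij.2))) >>.

(* The m ^ 2 real coordinates of a Hermitian matrix: the diagonal and the real
   parts above the diagonal sit at the positions i <= j, and the imaginary part
   of the entry (j, i) above the diagonal sits at the position i > j. *)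
Definition herm_coord m (X : 'M[R[i]]_m) (ij : 'I_m * 'I_m) : R :=
  if (ij.1 <= ij.2)%N then complex.Re (X ij.1 ij.2)
  else complex.Im (X ij.2 ij.1).

(* [normal_prob] takes the standard deviation, so sqrt (1/2) is variance 1/2. *)
Definition is_GUE m (G : T -> 'M[R[i]]_m) : Prop :=
  [/\ forall w, G w \is hermsymmx,
      forall ij, measurable_fun [set: T] (fun w => herm_coord (G w) ij),
      mutually_independent
        (fun ij : 'I_m * 'I_m => sigma_rv (fun w => herm_coord (G w) ij)) &
      forall (ij : 'I_m * 'I_m) (B : set R), measurable B ->
        P ((fun w => herm_coord (G w) ij) @^-1` B) =
        normal_prob 0 (if ij.1 == ij.2 then 1 else Num.sqrt (2^-1)) B].

End Probability.

(* Main.v *)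
(** Comparison with independent Ginibre blocks. Write a unit vector as an
   N x M matrix X and let S^* S = X X^*. Since every A_i is positive
   semidefinite, the increments of the Gaussian process
   M^{-1/2} sum_i Tr(X^* A_i X G_i) are dominated by those of
   2 M^{-1/2} sum_i Re Tr(Gamma_i^* S A_i X), with Gamma_i independent M x N
   complex Ginibre matrices, one independent family for each sign of the
   quadratic form, so by Sudakov-Fernique (proved by a Lindeberg replacement for
   the log-sum-exp function) the expected maximum over a finite net does not
   decrease. In the new process the Gamma_i enter through a single linear map,
   which after viewing it as a real M x 4nN Gaussian matrix is a contraction up
   to a factor tau whose mean is at most 1 + (2 + 2 sqrt(nN) + e) / sqrt M
   (Sudakov-Fernique again, in the form of Chevet's inequality). Completing the
   square with Z and Z^{-1}, for any Z > 0, bounds the new process at X by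
   lambda_max (A_0 + Z + sum_i A_i Z^{-1} A_i) plus 2 (tau - 1) sigma, where
   sigma^2 is the norm of sum_i A_i^2; the negative sign uses - Z and rho_-. *)
Require Import Defs.
From mathcomp Require Import all_boot all_order all_algebra.
From mathcomp Require Import complex mxtens.
From mathcomp Require Import all_classical all_reals all_analysis measurable_realfun.
From mathcomp Require Import ring lra.
Import Order.TTheory GRing.Theory Num.Theory.
Import numFieldNormedType.Exports.

Set Implicit Arguments.
Unset Strict Implicit.
Unset Printing Implicit Defensive.

Local Open Scope classical_set_scope.
Local Open Scope ring_scope.

(** * Integrals against normal laws *)

Section NormalIntegrals.
Context {R : realType}.
Local Notation leb := (@lebesgue_measure R).
Implicit Types (m s : R).

(** Gaussian vectors do not appear as measures on a product space. A vector is a list of directions,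
    and its expectation is the iterate [gmeans] of one-dimensional averages [gmean], acting on
    functions that are Lipschitz for the l1 norm. This class is integrable and stable under
    averaging, so Fubini becomes commutation and the stability of normal laws becomes composition of
    operators; [gaussian_law] links them to [P]. The replacement argument is then elementary: a
    Gaussian step is cut into many small ones, exchanged one at a time, without integration by
    parts. Positivity of the A_i enters through A_i = E^* E: the compression X^* A_i X is a Gram
    matrix, and the two covariances compare by 2 <U, V> <= |U|^2 + |V|^2. The variational formulas
    call for a contraction, which a Gaussian matrix is only approximately; hence [tau] is kept at
    least sqrt M pointwise, and the excess is charged to [sigma] instead of multiplying the Z^{-1}
    term. The error of each net is made explicit: one is absorbed in the constant 9, the other is
    removed by a limit. *)

Lemma ge0_integral_normal_prob m s (f : measurableTypeR R -> \bar R) :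
  measurable_fun setT f -> (forall x, 0 <= f x)%E ->
  (\int[normal_prob m s]_x f x = \int[leb]_x (f x * (normal_pdf m s x)%:E))%E.
Proof.
move=> mf f0; have dom := normal_prob_dominates m s.
rewrite -(Radon_Nikodym_SigmaFinite.change_of_variables dom f0)//=.
apply: ae_eq_integral => //.
- apply: emeasurable_funM => //; apply: (measurable_int leb).
  exact: Radon_Nikodym_SigmaFinite.f_integrable.
- by apply: emeasurable_funM => //=; apply/measurable_EFinP; exact: measurable_normal_pdf.
- apply: ae_eqe_mul2l => /=.
  apply: integral_ae_eq => //=.
  + exact: Radon_Nikodym_SigmaFinite.f_integrable.
  + by apply/measurable_EFinP; exact: measurable_normal_pdf.
  + by move=> E E01 mE; rewrite -Radon_Nikodym_SigmaFinite.f_integral.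
Qed.

Lemma normal_pdf_affine m s x : 0 < s ->
  normal_pdf m s (m + s * x) * s = normal_pdf 0 1 x.
Proof.
move=> s0; rewrite !normal_pdfE ?oner_neq0 ?gt_eqF//.
rewrite /normal_peak /normal_fun expr1n mul1r subr0 addrAC subrr add0r.
rewrite -mulrnAr sqrtrM ?sqr_ge0// sqrtr_sqr gtr0_norm// invfM.
rewrite mulrC !mulrA divff ?gt_eqF// mul1r; congr (_ * expR _).
rewrite exprMn -mulNr -[s ^+ 2 *+ 2]mulr_natr; field.
by rewrite gt_eqF.
Qed.

Lemma integral_normal_affine m s (f : R -> R) : 0 < s ->
  continuous f -> (forall x, 0 <= f x) ->
  (\int[normal_prob m s]_x (f x)%:E =
   \int[normal_prob 0 1]_x (f (m + s * x))%:E)%E.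
Proof.
move=> s0 cf f0.
pose F (x : R^o) : R^o := m + s * x.
have dF x : is_derive (x : R^o) 1 F s.
  have : is_derive (x : R^o) 1 F (0 + s *: 1) by apply: is_deriveD.
  by rewrite add0r /GRing.scale /= mulr1.
have F'E : F^`()%classic = cst s.
  by apply/funext => x; rewrite derive1E; exact: derive_val.
have mf : measurable_fun setT (fun x => (f x)%:E).
  by apply/measurable_EFinP; exact: continuous_measurable_fun.
have mfF : measurable_fun setT (fun x => (f (m + s * x))%:E).
  apply/measurable_EFinP; apply: measurableT_comp.
    exact: continuous_measurable_fun.
  by apply: measurable_funD => //; exact: measurable_funM.
rewrite (ge0_integral_normal_prob _ _ mf); last by move=> x; rewrite lee_fin.
rewrite (ge0_integral_normal_prob _ _ mfF); last by move=> x; rewrite lee_fin.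
under eq_integral do rewrite -EFinM.
rewrite (@increasing_ge0_integration_by_substitutionT _ F)//.
- apply: eq_integral => x _; rewrite F'E !fctE /= -EFinM; congr EFin.
  by rewrite /F -mulrA normal_pdf_affine.
- by move=> x y xy; rewrite /F ltrD2l ltr_pM2l.
- by rewrite F'E => x; exact: cvg_cst.
- by rewrite F'E; exact: is_cvg_cst.
- by rewrite F'E; exact: is_cvg_cst.
- rewrite /F; under eq_fun do rewrite addrC mulrC.
  by apply: cvg_comp (@cvg_addrr_Ny _ m); apply/gt0_cvgMlNy => //; exact: cvg_id.
- rewrite /F; under eq_fun do rewrite addrC mulrC.
  by apply: cvg_comp (@cvg_addrr _ m); apply/gt0_cvgMly => //; exact: cvg_id.
- move=> x; apply: (@continuousM _ _ f (normal_pdf m s)); first exact: cf.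
  by apply: continuous_normal_pdf; rewrite gt_eqF.
- by move=> x; rewrite mulr_ge0// normal_pdf_ge0.
Qed.

End NormalIntegrals.

Section NormalIntegrals2.
Context {R : realType}.
Local Notation leb := (@lebesgue_measure R).
Implicit Types (a b c m s : R).

(** Bayes' rule for t ~ N(0, 1) and r ~ N(b t, a^2) given t: the right side factors the joint
    density as the marginal N(0, c^2) of r times the conditional law of t given r, found by
    completing the square in t. *)
Lemma normal_pdf_mul a b c r t : a != 0 -> c != 0 -> c ^+ 2 = a ^+ 2 + b ^+ 2 ->
  normal_pdf (b * t) a r * normal_pdf 0 1 t =
  normal_pdf 0 c r * normal_pdf (b * r / c ^+ 2) (a / c) t.
Proof.
move=> a0 c0 cE; rewrite !normal_pdfE ?oner_neq0 ?mulf_neq0 ?invr_neq0//.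
rewrite /normal_peak /normal_fun !subr0.
rewrite mulrACA -expRD -[RHS]mulrACA -expRD; congr (_ * expR _).
  have sqE (s : R) : Num.sqrt (s ^+ 2 * pi *+ 2) = `|s| * Num.sqrt (pi *+ 2).
    by rewrite -mulrnAr sqrtrM ?sqr_ge0// sqrtr_sqr.
  rewrite !sqE normr1 mul1r normrM normfV.
  rewrite -!invfM; congr (_^-1); field; by rewrite normr_eq0.
have b2 : b ^+ 2 = c ^+ 2 - a ^+ 2 by rewrite cE; ring.
rewrite !mulr2n expr_div_n expr1n.
suff H : (r - b * t) ^+ 2 / (a ^+ 2 + a ^+ 2) + t ^+ 2 / (1 + 1) =
   r ^+ 2 / (c ^+ 2 + c ^+ 2) + (t - b * r / c ^+ 2) ^+ 2 / (a ^+ 2 / c ^+ 2 + a ^+ 2 / c ^+ 2).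
  by rewrite !mulNr -opprD H opprD.
have -> : (r - b * t) ^+ 2 = r ^+ 2 - 2 * r * b * t + b ^+ 2 * t ^+ 2 by ring.
have -> : (t - b * r / c ^+ 2) ^+ 2 =
  t ^+ 2 - 2 * r * b * t / c ^+ 2 + b ^+ 2 * r ^+ 2 / c ^+ 4.
  by field; rewrite c0.
rewrite b2; field; rewrite c0 /=.
by rewrite -!mulr2n !mulrn_eq0 !sqrf_eq0 a0 c0.
Qed.

Lemma measurable_normal_pdf2 a b : a != 0 ->
  measurable_fun setT (fun z : R * R => normal_pdf (b * z.1) a z.2).
Proof.
move=> a0; under eq_fun do rewrite normal_pdfE//.
apply: measurable_funM => //; rewrite /normal_fun.
apply: measurableT_comp => //; apply: measurable_funM => //.
apply: measurable_funN; apply: measurable_funX; apply: measurable_funB => //.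
exact: measurable_funM.
Qed.

(** The value r = b t + a s is made the inner variable; after Tonelli the integral in t sees only
    the conditional density of t given r, whose total mass is one. *)
Lemma integral_normal_convolution a b c (f : R -> R) :
  0 < a -> 0 < c -> c ^+ 2 = a ^+ 2 + b ^+ 2 ->
  continuous f -> (forall x, 0 <= f x) ->
  (\int[normal_prob 0 1]_t \int[normal_prob 0 1]_s (f (b * t + a * s))%:E =
   \int[normal_prob 0 1]_t (f (c * t))%:E)%E.
Proof.
move=> a0 c0 cE cf f0.
have mf : measurable_fun setT (EFin \o f).
  by apply/measurable_EFinP; exact: continuous_measurable_fun.
pose h (z : R * R) := (f z.2 * normal_pdf (b * z.1) a z.2)%:E.
have mh : measurable_fun setT h.
  apply/measurable_EFinP; apply: measurable_funM.
    by apply: measurableT_comp => //; exact: continuous_measurable_fun.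
  by apply: measurable_normal_pdf2; rewrite gt_eqF.
have h0 z : (0 <= h z)%E by rewrite lee_fin mulr_ge0// normal_pdf_ge0.
transitivity (\int[normal_prob 0 1]_t \int[leb]_r h (t, r))%E.
  apply: eq_integral => t _.
  rewrite -(@integral_normal_affine _ (b * t) a)// ge0_integral_normal_prob//.
have mH : measurable_fun setT (fun t : R => \int[leb]_r h (t, r))%E.
  exact: (@measurable_fun_fubini_tonelli_F _ _ _ _ _ leb h).
rewrite (ge0_integral_normal_prob _ _ mH); last first.
  by move=> t; exact: integral_ge0.
transitivity (\int[leb]_t \int[leb]_r (h (t, r) * (normal_pdf 0 1 t)%:E))%E.
  apply: eq_integral => t _; rewrite ge0_integralZr//.
  - exact: measurableT_comp.
  - by rewrite lee_fin normal_pdf_ge0.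
pose k (z : R * R) := (h z * (normal_pdf 0 1 z.1)%:E)%E.
have mk : measurable_fun setT k.
  apply: emeasurable_funM => //; apply/measurable_EFinP.
  by apply: measurableT_comp => //; exact: measurable_normal_pdf.
have k0 z : (0 <= k z)%E by rewrite mule_ge0// lee_fin normal_pdf_ge0.
rewrite (@fubini_tonelli _ _ _ _ _ leb leb k mk k0) /k /=.
have -> : (\int[normal_prob 0 1]_t (f (c * t))%:E = \int[normal_prob 0 c]_t (f t)%:E)%E.
  by rewrite (@integral_normal_affine _ 0 c)//; apply: eq_integral => t _; rewrite add0r.
rewrite ge0_integral_normal_prob//; apply: eq_integral => r _.
transitivity (\int[leb]_t ((f r * normal_pdf 0 c r)%:E *
   (normal_pdf (b * r / c ^+ 2) (a / c) t)%:E))%E.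
  apply: eq_integral => t _; rewrite /h /= -!EFinM; congr EFin.
  rewrite -[LHS]mulrA -[RHS]mulrA; congr (_ * _).
  by apply: normal_pdf_mul; rewrite ?gt_eqF.
rewrite ge0_integralZl//.
- by rewrite integral_normal_pdf mule1 EFinM.
- by apply/measurable_EFinP; exact: measurable_normal_pdf.
- by move=> t _; rewrite lee_fin normal_pdf_ge0.
- by rewrite lee_fin mulr_ge0// normal_pdf_ge0.
Qed.

End NormalIntegrals2.

(** * Moments of the standard normal law *)

Section NormalMoments.
Context {R : realType}.
Local Notation leb := (@lebesgue_measure R).
Local Notation gamma := (@normal_prob R 0 1).

(** The integrand times the standard density is s times the density of N(0, s^2). It serves three
    times: s = 2 dominates polynomials, s slightly above 1 gives the second moment, and s = (1 + 2
    l)^{-1/2} gives the Laplace transform of t^2. *)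
Lemma integral_normal_exp_sqr (s : R) : 0 < s ->
  (\int[gamma]_t (expR ((1 - (s ^+ 2)^-1) / 2 * t ^+ 2))%:E = s%:E)%E.
Proof.
move=> s0; rewrite ge0_integral_normal_prob//; last first.
  apply/measurable_EFinP; apply: measurableT_comp => //.
  by apply: measurable_funM => //; exact: measurable_funX.
transitivity (\int[leb]_t (s%:E * (normal_pdf 0 s t)%:E))%E.
  apply: eq_integral => t _; rewrite -!EFinM; congr EFin.
  rewrite !normal_pdfE ?oner_neq0 ?gt_eqF// /normal_peak /normal_fun !subr0.
  have sqE (u : R) : Num.sqrt (u ^+ 2 * pi *+ 2) = `|u| * Num.sqrt (pi *+ 2).
    by rewrite -mulrnAr sqrtrM ?sqr_ge0// sqrtr_sqr.
  rewrite !sqE normr1 mul1r gtr0_norm// (invfM s (Num.sqrt _)) [RHS]mulrA [X in _ = X * _]mulrA.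
  rewrite divff ?gt_eqF// mul1r mulrCA -expRD; congr (_ * expR _).
  rewrite expr1n !mulr2n; field.
  by rewrite -mulr2n mulrn_eq0 sqrf_eq0 (gt_eqF s0).
rewrite ge0_integralZl//.
- by rewrite integral_normal_pdf mule1.
- by apply/measurable_EFinP; exact: measurable_normal_pdf.
- by move=> t _; rewrite lee_fin normal_pdf_ge0.
- by rewrite lee_fin ltW.
Qed.

Lemma integrable_normal_exp_sqr (s : R) : 0 < s ->
  gamma.-integrable setT (EFin \o (fun t => expR ((1 - (s ^+ 2)^-1) / 2 * t ^+ 2))).
Proof.
move=> s0; apply/integrableP; split.
  apply/measurable_EFinP; apply: measurableT_comp => //.
  by apply: measurable_funM => //; exact: measurable_funX.
under eq_integral do rewrite /= ger0_norm ?expR_ge0//.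
by rewrite integral_normal_exp_sqr// ltry.
Qed.

Lemma integrable_normal_quartic (f : R -> R) (C : R) : measurable_fun setT f ->
  (forall t, `|f t| <= C * (1 + t ^+ 4)) -> gamma.-integrable setT (EFin \o f).
Proof.
move=> mf fC; have C0 : 0 <= C by have := fC 0; rewrite expr0n/= addr0 mulr1; exact: le_trans.
(* With x = 3/8 t^2, the bound exp x >= 1 + x^2 / 2 gives 16 exp x >= 16 + 9/8 t^4, which dominates
   1 + t^4. *)
pose g (t : R) := (16 * C) * expR ((1 - (2 ^+ 2)^-1) / 2 * t ^+ 2).
have ig : gamma.-integrable setT (EFin \o g).
  have i2 := @integrable_normal_exp_sqr 2 (ltr0n _ 2).
  apply: eq_integrable (integrableZl measurableT (16 * C) i2) => //.
apply: le_integrable ig => //; first exact/measurable_EFinP.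
move=> t _; rewrite lee_fin (le_trans (fC t))// ger0_norm; last first.
  by rewrite mulr_ge0 ?expR_ge0// mulr_ge0.
rewrite /g mulrAC [leRHS]mulrC ler_wpM2l//.
have x0 : 0 <= (1 - (2 ^+ 2)^-1) / 2 * t ^+ 2 :> R.
  by rewrite mulr_ge0 ?sqr_ge0//; lra.
have := @expR_ge1Dxn R _ 1 x0; set y := expR _; move=> Hy.
have : 1 + t ^+ 4 <= 16 * (1 + ((1 - (2 ^+ 2)^-1) / 2 * t ^+ 2) ^+ 2 / 2`!%:R).
  rewrite (_ : 2`! = 2)%N// exprMn -exprM; have : 0 <= t ^+ 4 by rewrite exprn_even_ge0.
  set T := t ^+ _; rewrite /=; lra.
lra.
Qed.

Lemma Rintegral_normal_cst (c : R) : \int[gamma]_t c = c.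
Proof.
rewrite Rintegral_cst//; transitivity (c * 1); last exact: mulr1.
by congr (c * _); exact: (congr1 fine (probability_setT gamma)).
Qed.

(** For theta = (1 - s^{-2}) / 2, integrating 1 + theta t^2 <= exp (theta t^2) gives 1 + theta I <=
    s, that is I <= 2 s^2 / (s + 1), and s may approach 1 from above. *)
Lemma integral_normal_sqr_le1 : \int[gamma]_t (t ^+ 2) <= 1.
Proof.
apply/ler_addgt0Pl => e e0.
pose d := Num.min e 1; have d0 : 0 < d by rewrite lt_min e0/=.
have d1 : d <= 1 by rewrite ge_min lexx orbT.
have de : d <= e by rewrite ge_min lexx.
pose s := 1 + d / 3; have s0 : 0 < s by rewrite /s; lra.
pose th := (1 - (s ^+ 2)^-1) / 2.
have thE : th = (s - 1) * (s + 1) / (2 * s ^+ 2).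
  by rewrite /th; field; rewrite gt_eqF.
have th0 : 0 < th.
  by rewrite thE divr_gt0// ?mulr_gt0 ?exprn_gt0//; rewrite /s; lra.
have isq : gamma.-integrable setT (EFin \o (fun t : R => t ^+ 2)).
  apply: (@integrable_normal_quartic _ 1); first exact: measurable_funX.
  move=> t; rewrite ger0_norm ?sqr_ge0// mul1r.
  have -> : t ^+ 4 = (t ^+ 2) ^+ 2 by rewrite -exprM.
  by have := sqr_ge0 (t ^+ 2 - 1); have := sqr_ge0 t; nra.
have : 1 + th * \int[gamma]_t (t ^+ 2) <= s.
  have -> : s = \int[gamma]_t (expR (th * t ^+ 2)).
    by rewrite /Rintegral integral_normal_exp_sqr.
  have <- : \int[gamma]_t (1 + th * t ^+ 2) = 1 + th * \int[gamma]_t (t ^+ 2).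
    rewrite RintegralD//; last 2 first.
    - exact: finite_measure_integrable_cst.
    - apply: eq_integrable (integrableZl measurableT th isq) => //.
    by rewrite RintegralZl// Rintegral_normal_cst.
  apply: le_Rintegral => //.
  - apply: (@integrable_normal_quartic _ (1 + th)).
      by apply: measurable_funD => //; apply: measurable_funM => //; exact: measurable_funX.
    move=> t; rewrite ger0_norm; last by rewrite addr_ge0// mulr_ge0 ?sqr_ge0// ltW.
    have -> : t ^+ 4 = (t ^+ 2) ^+ 2 by rewrite -exprM.
    by have := sqr_ge0 (t ^+ 2 - 1); have := sqr_ge0 t; nra.
  - exact: integrable_normal_exp_sqr.
  - by move=> t _; exact: expR_ge1Dx.
set I := Rintegral _ _ _ => HI.
have : th * I <= s - 1 by lra.
rewrite mulrC -ler_pdivlMr// thE => /le_trans; apply.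
have -> : (s - 1) / ((s - 1) * (s + 1) / (2 * s ^+ 2)) = 2 * s ^+ 2 / (s + 1).
  have h1 : s - 1 != 0 by rewrite gt_eqF// /s; lra.
  have h2 : s + 1 != 0 by rewrite gt_eqF// /s; lra.
  by field; rewrite h1 h2 gt_eqF.
by rewrite ler_pdivrMr /s; nra.
Qed.

Lemma ge0_integral_normalN (f : R -> R) : measurable_fun setT f ->
  (forall x, 0 <= f x) ->
  (\int[gamma]_t ((f \o -%R) t)%:E = \int[gamma]_t (f t)%:E)%E.
Proof.
move=> mf f0.
have mfN : measurable_fun setT (f \o -%R).
  by apply: measurableT_comp => //; exact: measurable_funN.
have mE : measurable_fun setT (EFin \o f) by exact/measurable_EFinP.
have mEN : measurable_fun setT (EFin \o (f \o -%R)) by exact/measurable_EFinP.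
rewrite (ge0_integral_normal_prob _ _ mEN); last by move=> x; rewrite lee_fin; exact: f0.
rewrite (ge0_integral_normal_prob _ _ mE); last by move=> x; rewrite lee_fin.
pose g (t : R) := ((f t)%:E * (normal_pdf 0 1 t)%:E)%E.
have mg : measurable_fun setT g.
  by apply: emeasurable_funM => //; apply/measurable_EFinP; exact: measurable_normal_pdf.
transitivity (\int[leb]_t (g \o (-%R : R -> measurableTypeR R)) t)%E.
  apply: eq_integral => t _; rewrite /g; congr (_ * _%:E)%E.
  by rewrite !normal_pdfE ?oner_neq0// /normal_fun !subr0 sqrrN.
rewrite -[X in (\int[_]_(_ in X) _)%E](preimage_setT (-%R : R -> measurableTypeR R)).
rewrite -ge0_integral_pushforward//=; last first.
  by move=> t _; rewrite mule_ge0// lee_fin// normal_pdf_ge0.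
by apply: eq_measure_integral => A mA _; exact: lebesgue_measureN.
Qed.

Lemma integral_normal_id : \int[gamma]_t t = 0.
Proof.
have iid : gamma.-integrable setT (EFin \o (@id R)).
  apply: (@integrable_normal_quartic _ 1) => // t; rewrite mul1r.
  have -> : t ^+ 4 = (t ^+ 2) ^+ 2 by rewrite -exprM.
  rewrite -[t ^+ 2]real_normK ?num_real//; set y := `|t|; have : 0 <= y by exact: normr_ge0.
  by have := sqr_ge0 (y ^+ 2 - 1); have := sqr_ge0 (y - 1); nra.
rewrite /Rintegral integralE.
rewrite [X in (_ - X)%E](_ : _ = \int[gamma]_t ((fun t : R => t%:E)^\+ t))%E; last first.
  transitivity (\int[gamma]_t (((fun t => Num.max t 0) \o -%R) t)%:E)%E.
    by apply: eq_integral => t _; rewrite funenegE /= EFin_max.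
  transitivity (\int[gamma]_t (Num.max t 0)%:E)%E; last first.
    by apply: eq_integral => t _; rewrite funeposE EFin_max.
  apply: (@ge0_integral_normalN (fun t => Num.max t 0)).
    exact: measurable_maxr.
  by move=> x; rewrite le_max lexx orbT.
rewrite subee//.
exact: (integrable_pos_fin_num measurableT iid).
Qed.

End NormalMoments.

(** * Lipschitz functions and Gaussian averages *)

Section LipschitzFunctions.
Context {R : realType} {J : finType}.
Local Notation V := {ffun J -> R}.
Implicit Types (x y w : V) (F : V -> R).

Definition l1norm x : R := \sum_j `|x j|.

Lemma l1norm_ge0 x : 0 <= l1norm x.
Proof. exact: sumr_ge0. Qed.

Lemma ler_l1normD x y : l1norm (x + y) <= l1norm x + l1norm y.
Proof.
by rewrite -big_split/=; apply: ler_sum => j _; rewrite ffunE ler_normD.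
Qed.

Lemma l1normZ a x : l1norm (a *: x) = `|a| * l1norm x.
Proof. by rewrite mulr_sumr; apply: eq_bigr => j _; rewrite ffunE normrM. Qed.

Lemma l1normN x : l1norm (- x) = l1norm x.
Proof. by rewrite -scaleN1r l1normZ normrN1 mul1r. Qed.

Definition lip F := exists C : R, forall x y, `|F x - F y| <= C * l1norm (x - y).

Lemma lipP F : lip F ->
  exists2 C : R, 0 <= C & forall x y, `|F x - F y| <= C * l1norm (x - y).
Proof.
move=> [C FC]; exists `|C|; first exact: normr_ge0.
by move=> x y; rewrite (le_trans (FC x y))// ler_wpM2r ?l1norm_ge0// ler_norm.
Qed.

Lemma lip_cst (c : R) : lip (fun=> c).
Proof. by exists 0 => x y; rewrite subrr normr0 mul0r. Qed.

Lemma lipD F G : lip F -> lip G -> lip (fun x => F x + G x).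
Proof.
move=> [C FC] [D GD]; exists (C + D) => x y.
by rewrite opprD addrACA (le_trans (ler_normD _ _))// mulrDl lerD.
Qed.

Lemma lipZ a F : lip F -> lip (fun x => a * F x).
Proof.
move=> [C FC]; exists (`|a| * C) => x y.
by rewrite -mulrBr normrM -mulrA ler_wpM2l.
Qed.

Lemma lip_comp F (f : R -> R) : lip F ->
  (forall s t, `|f s - f t| <= `|s - t|) -> lip (fun x => f (F x)).
Proof. by move=> [C FC] f1; exists C => x y; exact: le_trans (f1 _ _) _. Qed.

Lemma lip_sum (I : Type) (s : seq I) (P : pred I) (F : I -> V -> R) :
  (forall i, lip (F i)) -> lip (fun x => \sum_(i <- s | P i) F i x).
Proof.
move=> lF; elim: s => [|i s IH].
  by under [X in lip X]funext => x do rewrite big_nil; exact: lip_cst.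
under [X in lip X]funext => x do rewrite big_cons.
by case: (P i) => //; exact: lipD.
Qed.

Lemma lip_max F G : lip F -> lip G -> lip (fun x => Num.max (F x) (G x)).
Proof.
move=> lF lG.
under [X in lip X]funext => x do rewrite maxr_absE.
have lB : lip (fun x => F x - G x).
  by under [X in lip X]funext => x do rewrite -mulN1r; apply: lipD => //; exact: lipZ.
have lA : lip (fun x => `|F x - G x|).
  by apply: (lip_comp (f := Num.norm)) => // s t; exact: ler_dist_dist.
under [X in lip X]funext => x do rewrite mulrC.
by apply: lipZ; apply: lipD => //; exact: lipD.
Qed.

(* McShane's formula: a Lipschitz function is the infimum of countably many
   cones with apexes on its graph. *)
Lemma lip_measurable d (T : measurableType d) F (phi : T -> V) : lip F ->
  (forall j, measurable_fun setT (fun t => phi t j)) ->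
  measurable_fun setT (F \o phi).
Proof.
move=> /lipP[C C0 FC] mphi.
pose q (k : nat) : V := if unpickle k is Some r then
  [ffun j => ratr ((r : {ffun J -> rat}) j)] else 0.
pose h (k : nat) (t : T) : R := F (q k) + C * l1norm (phi t - q k).
have hF k t : F (phi t) <= h k t.
  by rewrite /h -lerBlDl (le_trans (ler_norm _)).
have lbh t : has_lbound (range (h ^~ t)).
  by exists (F (phi t)) => _ [k _ <-].
rewrite (_ : F \o phi = fun t => infs (h ^~ t) 0%N); last first.
  apply/funext => t; rewrite /infs/=; apply/eqP; rewrite eq_le; apply/andP; split.
    apply: lb_le_inf; first by exists (h 0%N t); exists 0%N.
    by move=> _ [k _ <-].
  apply/ler_addgt0Pr => e e0.
  (* Chosen so that 2 C times the l1 distance stays below e; the added ones cover C = 0 and an empty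
     [J]. *)
  pose d1 : R := e / (2 * C + 1) / (#|J|%:R + 1).
  have p1 : 0 < 2 * C + 1 by rewrite ltr_wpDl// mulr_ge0.
  have p2 : 0 < #|J|%:R + 1 :> R by rewrite ltr_wpDl.
  have d10 : 0 < d1 by rewrite !divr_gt0.
  have rt j : exists r : rat, `|phi t j - ratr r| <= d1.
    have /rat_in_itvoo[r] : phi t j - d1 < phi t j + d1 by rewrite ltrD2l gtrN.
    rewrite in_itv/= => /andP[a b]; exists r; rewrite ler_distlC; apply/andP.
    by split; rewrite ltW// ?ltrBlDr// -ltrBlDr.
  have [r rP] := choice rt.
  pose k := pickle (finfun r).
  have qk : q k = [ffun j => ratr (r j)].
    by rewrite /q pickleK; apply/ffunP => j; rewrite !ffunE.
  have dl : l1norm (phi t - q k) <= e / (2 * C + 1).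
    apply: (@le_trans _ _ (\sum_(j : J) d1)).
      by apply: ler_sum => j _; rewrite qk !ffunE.
    rewrite sumr_const -[_ *+ #|_|]mulr_natr /d1 -[leLHS]mulrA.
    rewrite ler_piMr ?divr_ge0// ?ltW//.
    by rewrite ltr_pdivrMl// mulr1 ltrDl.
  apply: (@le_trans _ _ (h k t)); first (apply: ge_inf;
    [by exists (F (phi t)) => _ [m _ <-] | by exists k]).
  rewrite /h; have := FC (q k) (phi t); rewrite -(l1normN (_ - _)) opprB.
  move=> /(le_trans (ler_norm _)); rewrite lerBlDr => H.
  rewrite (le_trans (lerD H (lexx _)))// addrAC [leRHS]addrC lerD2r -mulr2n.
  rewrite -mulr_natl mulrA; apply: (@le_trans _ _ ((2 * C) * (e / (2 * C + 1)))).
    by rewrite ler_wpM2l// mulr_ge0.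
  by rewrite mulrCA ger_pMr// ler_pdivrMr// mul1r lerDl.
apply: measurable_fun_infs => // k; apply: measurable_funD => //.
apply: measurable_funM => //; rewrite /l1norm.
apply: measurable_sum => j; apply: measurableT_comp => //.
by under eq_fun do rewrite !ffunE; apply: measurable_funB.
Qed.

End LipschitzFunctions.

(** * Averages along Gaussian directions *)

Section GaussianMeans.
Context {R : realType} {J : finType}.
Local Notation V := {ffun J -> R}.
Local Notation gamma := (@normal_prob R 0 1).
Implicit Types (x y w : V) (F : V -> R) (ws : seq V).

Definition gmean w F x : R := \int[gamma]_t F (x + t *: w).

Lemma lip_shift w F x (s t : R) C : 0 <= C ->
  (forall x y, `|F x - F y| <= C * l1norm (x - y)) ->
  `|F (x + s *: w) - F (x + t *: w)| <= C * l1norm w * `|s - t|.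
Proof.
move=> C0 FC; rewrite (le_trans (FC _ _))//.
by rewrite opprD addrACA subrr add0r -scalerBl l1normZ -mulrA [l1norm w * _]mulrC.
Qed.

Lemma measurable_line w F x : lip F -> measurable_fun setT (fun t : R => F (x + t *: w)).
Proof.
move=> lF.
have mphi j : measurable_fun setT (fun t : R => (x + t *: w) j).
  under eq_fun do rewrite !ffunE.
  by apply: measurable_funD => //; exact: measurable_funM.
exact: (lip_measurable lF mphi).
Qed.

Lemma integrable_line w F x : lip F ->
  gamma.-integrable setT (EFin \o (fun t : R => F (x + t *: w))).
Proof.
move=> lF; have /lipP[C C0 FC] := lF.
apply: (@integrable_normal_quartic _ _ (`|F x| + C * l1norm w)).
  exact: measurable_line.
move=> t; have := lip_shift w x t 0 C0 FC; rewrite subr0 scale0r addr0 => H.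
have a0 : 0 <= C * l1norm w by rewrite mulr_ge0// l1norm_ge0.
have t4 : `|t| <= 1 + t ^+ 4.
  have -> : t ^+ 4 = (t ^+ 2) ^+ 2 by rewrite -exprM.
  rewrite -[t ^+ 2]real_normK ?num_real//; have : 0 <= `|t| by exact: normr_ge0.
  by set y := `|t|; have := sqr_ge0 (y ^+ 2 - 1); have := sqr_ge0 (y - 1); nra.
have t40 : 0 <= t ^+ 4 by rewrite exprn_even_ge0.
rewrite -[F _](subrK (F x)) (le_trans (ler_normD _ _))// addrC mulrDl lerD//.
  by rewrite ler_peMr// lerDl.
by rewrite (le_trans H)// ler_wpM2l.
Qed.
Hint Resolve integrable_line : core.

Lemma EFin_gmean w F x : lip F ->
  ((gmean w F x)%:E = \int[gamma]_t (F (x + t *: w))%:E)%E.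
Proof. by move=> lF; rewrite fineK// integrable_fin_num//; exact: integrable_line. Qed.

Lemma gmean_cst w (c : R) x : gmean w (fun=> c) x = c.
Proof. exact: Rintegral_normal_cst. Qed.

Lemma gmeanDZ w F G a x : lip F -> lip G ->
  gmean w (fun y => F y + a * G y) x = gmean w F x + a * gmean w G x.
Proof.
move=> lF lG; rewrite /gmean RintegralD//; last 2 first.
- exact: integrable_line.
- by apply: (integrable_line w x (lipZ a lG)).
by rewrite RintegralZl//; exact: integrable_line.
Qed.

Lemma gmean_le w F G x : lip F -> lip G -> (forall y, F y <= G y) ->
  gmean w F x <= gmean w G x.
Proof. by move=> lF lG FG; apply: le_Rintegral => //; exact: integrable_line. Qed.

Lemma gmean_lip w F : lip F -> lip (gmean w F).
Proof.
move=> lF; have /lipP[C C0 FC] := lF; exists C => x y.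
rewrite /gmean -RintegralB//; [|exact: integrable_line..].
have lB : gamma.-integrable setT
    (EFin \o (fun t : R => F (x + t *: w) - F (y + t *: w))).
  apply: eq_integrable (integrableB measurableT (integrable_line w x lF)
    (integrable_line w y lF)) => // t _.
rewrite (le_trans (le_normr_Rintegral _ lB))//.
rewrite -[leRHS]Rintegral_normal_cst le_Rintegral//.
- exact: integrable_norm.
- exact: finite_measure_integrable_cst.
- move=> t _; rewrite (le_trans (FC _ _))//.
  by rewrite opprD addrACA subrr addr0.
Qed.

Lemma gmean_ub w F x (h : R -> R) : lip F ->
  gamma.-integrable setT (EFin \o h) -> (forall t, F (x + t *: w) <= h t) ->
  gmean w F x <= \int[gamma]_t h t.
Proof. by move=> lF ih Fh; apply: le_Rintegral => //; exact: integrable_line. Qed.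

Lemma gmean_lb w F x (h : R -> R) : lip F ->
  gamma.-integrable setT (EFin \o h) -> (forall t, h t <= F (x + t *: w)) ->
  \int[gamma]_t h t <= gmean w F x.
Proof. by move=> lF ih Fh; apply: le_Rintegral => //; exact: integrable_line. Qed.

Lemma gmeanE w F x : gmean w F x = \int[gamma]_t F (x + t *: w).
Proof. by []. Qed.

Opaque gmean.

(** Tonelli and the convolution formula are available for nonnegative integrands. Both parts of a
    Lipschitz function are again Lipschitz, so the split carries these identities over to functions
    of any sign. *)
Definition pos_part F : V -> R := fun x => Num.max (F x) 0.

Lemma lip_pos_part F : lip F -> lip (pos_part F).
Proof. by move=> lF; apply: lip_max => //; exact: lip_cst. Qed.

Lemma pos_part_ge0 F x : 0 <= pos_part F x.
Proof. by rewrite le_max lexx orbT. Qed.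

Lemma lip_opp F : lip F -> lip (fun x => - F x).
Proof.
by move=> lF; under [X in lip X]funext => x do rewrite -mulN1r; exact: lipZ.
Qed.

Lemma gmean_pos_neg w F : lip F -> gmean w F =
  fun x => gmean w (pos_part F) x + (-1) * gmean w (pos_part (fun y => - F y)) x.
Proof.
move=> lF; apply/funext => x; rewrite -gmeanDZ; last 2 first.
- exact: lip_pos_part.
- exact/lip_pos_part/lip_opp.
congr (gmean w _ x); apply/funext => y.
by rewrite /pos_part /Num.max; case: ltP => ?; case: ltP => ?; lra.
Qed.

Lemma gmean2_pos_neg w w' F x : lip F -> gmean w (gmean w' F) x =
  gmean w (gmean w' (pos_part F)) x +
  (-1) * gmean w (gmean w' (pos_part (fun y => - F y))) x.
Proof.
move=> lF; rewrite [in LHS](gmean_pos_neg w' lF) gmeanDZ//.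
- exact/gmean_lip/lip_pos_part.
- exact/gmean_lip/lip_pos_part/lip_opp.
Qed.

Let ge0_gmeanC w w' F x : lip F -> (forall y, 0 <= F y) ->
  gmean w (gmean w' F) x = gmean w' (gmean w F) x.
Proof.
move=> lF F0; apply: EFin_inj.
apply: (etrans (EFin_gmean w x (gmean_lip w' lF))).
apply: (etrans _ (esym (EFin_gmean w' x (gmean_lip w lF)))).
pose h (z : R * R) : \bar R := (F (x + z.1 *: w + z.2 *: w'))%:E.
have mh : measurable_fun setT h.
  apply/measurable_EFinP.
  have mphi j : measurable_fun setT (fun z : R * R => (x + z.1 *: w + z.2 *: w') j).
    under eq_fun do rewrite !ffunE.
    by apply: measurable_funD; [apply: measurable_funD|] => //; exact: measurable_funM.
  exact: (lip_measurable lF mphi).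
have h0 z : (0 <= h z)%E by rewrite lee_fin.
transitivity (\int[gamma]_s \int[gamma]_t h (s, t))%E.
  by apply: eq_integral => s _; rewrite EFin_gmean.
rewrite (@fubini_tonelli _ _ _ _ _ gamma gamma h mh h0).
apply: eq_integral => t _; rewrite EFin_gmean//; apply: eq_integral => s _.
by rewrite /h/= addrAC.
Qed.

Lemma gmeanC w w' F x : lip F ->
  gmean w (gmean w' F) x = gmean w' (gmean w F) x.
Proof.
move=> lF; have lP := lip_pos_part lF; have lN := lip_pos_part (lip_opp lF).
rewrite (gmean2_pos_neg w w' x lF) (gmean2_pos_neg w' w x lF).
by rewrite (ge0_gmeanC w w' x lP (pos_part_ge0 F)) (ge0_gmeanC w w' x lN (pos_part_ge0 _)).
Qed.

Lemma continuous_line w F x : lip F -> continuous (fun t : R => F (x + t *: w)).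
Proof.
move=> /lipP[C C0 FC] t; apply/cvgrPdist_le => /= e e0.
have d0 : 0 < C * l1norm w + 1 by rewrite ltr_wpDl// mulr_ge0// l1norm_ge0.
near=> s; rewrite (le_trans (lip_shift w x t s C0 FC))//.
rewrite (@le_trans _ _ ((C * l1norm w + 1) * `|t - s|))//.
  by rewrite ler_wpM2r// lerDl.
rewrite mulrC -ler_pdivlMr//; near: s.
by apply: cvgr_dist_le; [exact: cvg_id|exact: divr_gt0].
Unshelve. all: by end_near. Qed.

Let ge0_gmean_convolution w a b c F x : 0 < a -> 0 < c -> c ^+ 2 = a ^+ 2 + b ^+ 2 ->
  lip F -> (forall y, 0 <= F y) ->
  gmean (b *: w) (gmean (a *: w) F) x = gmean (c *: w) F x.
Proof.
move=> a0 c0 cE lF F0; apply: EFin_inj.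
apply: (etrans (EFin_gmean (b *: w) x (gmean_lip (a *: w) lF))).
apply: (etrans _ (esym (EFin_gmean (c *: w) x lF))).
transitivity (\int[gamma]_t (F (x + (c * t) *: w))%:E)%E; last first.
  by apply: eq_integral => t _; rewrite scalerA mulrC.
rewrite -(@integral_normal_convolution _ a b c (fun t => F (x + t *: w)))//.
- apply: eq_integral => t _; rewrite EFin_gmean//; apply: eq_integral => s _.
  by rewrite scalerDl addrA !scalerA [t * b]mulrC [s * a]mulrC.
- exact: continuous_line.
Qed.

Lemma gmean_convolution w a b c F x : 0 < a -> 0 < c -> c ^+ 2 = a ^+ 2 + b ^+ 2 ->
  lip F -> gmean (b *: w) (gmean (a *: w) F) x = gmean (c *: w) F x.
Proof.
move=> a0 c0 cE lF.
have lP := lip_pos_part lF; have lN := lip_pos_part (lip_opp lF).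
rewrite (gmean2_pos_neg (b *: w) (a *: w) x lF) (gmean_pos_neg (c *: w) lF).
rewrite (ge0_gmean_convolution w x a0 c0 cE lP (pos_part_ge0 F)).
by rewrite (ge0_gmean_convolution w x a0 c0 cE lN (pos_part_ge0 _)).
Qed.

(* Expectation of [F (x + \sum_k g_k w_k)] for independent standard normal [g_k]. *)
Fixpoint gmeans ws F : V -> R :=
  if ws is w :: ws' then gmean w (gmeans ws' F) else F.

Lemma gmeans_lip ws F : lip F -> lip (gmeans ws F).
Proof. by move=> lF; elim: ws => //= w ws; exact: gmean_lip. Qed.

Lemma gmeans_le ws F G x : lip F -> lip G -> (forall y, F y <= G y) ->
  gmeans ws F x <= gmeans ws G x.
Proof.
move=> lF lG FG; elim: ws x => //= w ws IH x.
by apply: gmean_le => //; exact: gmeans_lip.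
Qed.

Lemma gmeansDZ ws F G a x : lip F -> lip G ->
  gmeans ws (fun y => F y + a * G y) x = gmeans ws F x + a * gmeans ws G x.
Proof.
move=> lF lG; elim: ws x => //= w ws IH x.
by rewrite (funext IH) gmeanDZ//; exact: gmeans_lip.
Qed.

Lemma gmeans_cst ws (c : R) x : gmeans ws (fun=> c) x = c.
Proof.
elim: ws x => //= w ws IH x.
have -> : gmeans ws (fun=> c) = (fun=> c) by apply/funext.
exact: gmean_cst.
Qed.

Lemma gmeansDc ws F (c : R) x : lip F ->
  gmeans ws (fun y => F y + c) x = gmeans ws F x + c.
Proof.
move=> lF; have := gmeansDZ ws 1 x lF (lip_cst c).
by rewrite gmeans_cst !mul1r.
Qed.

Lemma gmean_gmeansC w ws F x : lip F ->
  gmean w (gmeans ws F) x = gmeans ws (gmean w F) x.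
Proof.
move=> lF; elim: ws x => //= w' ws IH x.
by rewrite gmeanC ?(funext IH)//; exact: gmeans_lip.
Qed.

Lemma gmeansC us ws F x : lip F ->
  gmeans us (gmeans ws F) x = gmeans ws (gmeans us F) x.
Proof.
move=> lF; elim: us x => //= u us IH x.
by rewrite (funext IH) gmean_gmeansC//; exact: gmeans_lip.
Qed.

Lemma gmeans_convolution ws a b c F x : 0 < a -> 0 < c -> c ^+ 2 = a ^+ 2 + b ^+ 2 ->
  lip F -> gmeans [seq b *: w | w <- ws] (gmeans [seq a *: w | w <- ws] F) x =
           gmeans [seq c *: w | w <- ws] F x.
Proof.
move=> a0 c0 cE lF; elim: ws x => [|w ws IH] x; first by [].
rewrite /=.
have lA := gmeans_lip [seq a *: w | w <- ws] lF.
under [X in gmean _ X]funext => y do rewrite -gmean_gmeansC//.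
by rewrite (@gmean_convolution _ a _ c)//; [rewrite (funext IH)|exact: gmeans_lip].
Qed.

Lemma iter_gmeans_lip m ws F : lip F -> lip (iter m (gmeans ws) F).
Proof. by move=> lF; elim: m => //= m; exact: gmeans_lip. Qed.

(** Stability of normal laws. With a = 1 / sqrt (m + 1) it cuts one Gaussian step into m + 1
    independent small ones, the slices exchanged in the Lindeberg replacement. *)
Lemma iter_gmeans m ws F x (a : R) : 0 < a -> lip F ->
  iter m.+1 (gmeans [seq a *: w | w <- ws]) F x =
  gmeans [seq (Num.sqrt m.+1%:R * a) *: w | w <- ws] F x.
Proof.
move=> a0 lF; elim: m x => [|m IH] x; first by rewrite sqrtr1 mul1r.
rewrite iterS (funext IH); apply: gmeans_convolution => //.
- by rewrite mulr_gt0// sqrtr_gt0.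
- by rewrite mulr_gt0// sqrtr_gt0.
- by rewrite !exprMn !sqr_sqrtr// -[m.+2%:R]natr1 mulrDl mul1r.
Qed.

End GaussianMeans.

(** * The Sudakov-Fernique inequality *)

Section LogSumExp.
Context {R : realType} {I : finType}.
Variable i0 : I.
Local Notation V := {ffun I -> R}.
Implicit Types (x y w : V).

Definition sumexp x : R := \sum_a expR (x a).
Definition lse x : R := ln (sumexp x).
Definition gibbs x a : R := expR (x a) / sumexp x.
Definition gibbs_mean w x : R := \sum_a gibbs x a * w a.
(** The second derivative of [lse] in direction w, a variance under the Gibbs weights, in the form
    of a sum over pairs: it sees w only through its increments and with nonnegative weights, so that
    domination of increments passes to it directly. *)
Definition gibbs_var w x : R :=
  (\sum_a \sum_b gibbs x a * gibbs x b * (w a - w b) ^+ 2) / 2.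

Lemma sumexp_gt0 x : 0 < sumexp x.
Proof.
by rewrite /sumexp (bigD1 i0)//= ltr_pwDl ?expR_gt0// sumr_ge0.
Qed.

Lemma ler_coord_l1norm x a : `|x a| <= l1norm x.
Proof. by rewrite /l1norm (bigD1 a)//= lerDl sumr_ge0. Qed.

Lemma expR_coord_le x y a : expR (x a) <= expR (y a) * expR (l1norm (x - y)).
Proof.
rewrite -expRD ler_expR -lerBlDl.
by have := ler_coord_l1norm (x - y) a; rewrite !ffunE; apply: le_trans; exact: ler_norm.
Qed.

Lemma sumexp_le x y : sumexp x <= sumexp y * expR (l1norm (x - y)).
Proof. by rewrite mulr_suml; apply: ler_sum => a _; exact: expR_coord_le. Qed.

Lemma lse_lip : lip lse.
Proof.
exists 1.
have H x y : lse x - lse y <= l1norm (x - y).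
  rewrite lerBlDl -[X in _ + X]expRK -lnM ?posrE ?sumexp_gt0 ?expR_gt0//.
  by rewrite ler_ln ?posrE ?mulr_gt0 ?sumexp_gt0 ?expR_gt0// sumexp_le.
move=> x y; rewrite mul1r ler_norml H andbT lerNl opprB.
by rewrite -l1normN opprB; exact: H.
Qed.

Lemma gibbs_ge0 x a : 0 <= gibbs x a.
Proof. by rewrite divr_ge0 ?expR_ge0// ltW// sumexp_gt0. Qed.

Lemma gibbs_sum x : \sum_a gibbs x a = 1.
Proof. by rewrite -mulr_suml divff// gt_eqF// sumexp_gt0. Qed.

Lemma gibbs_le1 x a : gibbs x a <= 1.
Proof.
rewrite -(gibbs_sum x) (bigD1 a)//= lerDl sumr_ge0// => b _.
exact: gibbs_ge0.
Qed.

Lemma gibbs_le x y a : gibbs x a <= gibbs y a * expR (2 * l1norm (x - y)).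
Proof.
set e := expR _; have eE : e = expR (l1norm (x - y)) ^+ 2.
  by rewrite -expRM_natl.
have sx := sumexp_gt0 x; have sy := sumexp_gt0 y.
rewrite /gibbs ler_pdivrMr//.
have -> : expR (y a) / sumexp y * e * sumexp x = expR (y a) * e * sumexp x / sumexp y.
  by ring.
rewrite ler_pdivlMr//.
have H1 := expR_coord_le x y a.
have : sumexp y <= sumexp x * expR (l1norm (x - y)).
  by rewrite -l1normN opprB; exact: sumexp_le.
rewrite eE; move: H1; set d := expR (l1norm _); set u := expR (x a); set v := expR (y a).
move=> H1 H2; have v0 : 0 <= v by exact: expR_ge0.
have -> : v * d ^+ 2 * sumexp x = (v * d) * (sumexp x * d) by ring.
by apply: ler_pM => //; rewrite ?expR_ge0// ltW.
Qed.

Lemma gibbs_lip a : lip (gibbs^~ a).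
Proof.
exists 4.
have H x y : gibbs x a - gibbs y a <= 4 * l1norm (x - y).
  set d := l1norm _; have d0 : 0 <= d by exact: l1norm_ge0.
  (* For d <= 1/4, exp (2 d) <= 1 / (1 - 2 d) <= 1 + 4 d; for larger d the weights, being at most 1,
     already differ by less than 4 d. *)
  have [d4|d4] := leP (4 * d) 1; last first.
    by rewrite (le_trans _ (ltW d4))// lerBlDr (le_trans (gibbs_le1 _ _))// lerDl gibbs_ge0.
  have e4 : expR (2 * d) <= 1 + 4 * d.
    rewrite -[2 * d]opprK expRN -[leRHS]invrK lef_pV2 ?posrE ?expR_gt0 ?invr_gt0//; last lra.
    rewrite (le_trans _ (expR_ge1Dx _))// -[leLHS]mul1r ler_pdivrMr; last lra.
    nra.
  have := gibbs_le x y a; rewrite -/d => H.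
  have g1 := gibbs_le1 y a; have g0 := gibbs_ge0 y a.
  nra.
move=> x y; rewrite ler_norml H andbT lerNl opprB.
by rewrite -l1normN opprB; exact: H.
Qed.

(** Stands in for a bound on the third derivative of [lse]: it makes the second-order Taylor
    remainder uniform in the base point. *)
Lemma gibbs_var_lip w : lip (gibbs_var w).
Proof.
rewrite (_ : gibbs_var w = fun x => 2^-1 * \sum_a \sum_b
   (w a - w b) ^+ 2 * (gibbs x a * gibbs x b)); last first.
  apply/funext => x; rewrite mulrC; congr (_ * _).
  by apply: eq_bigr => a _; apply: eq_bigr => b _; rewrite mulrC.
apply: lipZ; apply: lip_sum => a; apply: lip_sum => b; apply: lipZ.
have /lipP[C C0 HC] := gibbs_lip a; have /lipP[D D0 HD] := gibbs_lip b.
exists (C + D) => x y.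
have -> : gibbs x a * gibbs x b - gibbs y a * gibbs y b =
  (gibbs x a - gibbs y a) * gibbs x b + gibbs y a * (gibbs x b - gibbs y b) by ring.
have n1 u v : `|gibbs u v| <= 1 by rewrite ger0_norm ?gibbs_ge0// gibbs_le1.
rewrite (le_trans (ler_normD _ _))// (normrM (_ - _)) (normrM (gibbs y a)) mulrDl lerD//.
- by apply: le_trans (HC x y); apply: ler_piMr.
- by apply: le_trans (HD x y); apply: ler_piMl.
Qed.

Lemma gibbs_varE w x : gibbs_var w x =
  \sum_a gibbs x a * w a ^+ 2 - gibbs_mean w x ^+ 2.
Proof.
rewrite /gibbs_var.
transitivity ((\sum_a \sum_b (gibbs x a * w a ^+ 2 * gibbs x b +
   (gibbs x a * (gibbs x b * w b ^+ 2) - 2 * (gibbs x a * w a) * (gibbs x b * w b)))) / 2).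
  by congr (_ / 2); apply: eq_bigr => a _; apply: eq_bigr => b _; ring.
under eq_bigr => a _ do rewrite big_split sumrB /= -!mulr_sumr gibbs_sum mulr1.
rewrite big_split sumrB /=. rewrite -mulr_suml gibbs_sum mul1r -mulr_suml -mulr_sumr.
by rewrite /gibbs_mean; field.
Qed.

Lemma is_derive_bigsum (K : Type) (s : seq K) (h : K -> R -> R) (dh : K -> R) (t : R) :
  (forall k, is_derive t 1 (h k) (dh k)) ->
  is_derive t 1 (fun u => \sum_(k <- s) h k u) (\sum_(k <- s) dh k).
Proof.
move=> H; elim: s => [|k s IH].
  rewrite big_nil; under eq_fun do rewrite big_nil.
  exact: is_derive_cst.
rewrite big_cons; under eq_fun do rewrite big_cons.
exact: is_deriveD.
Qed.

Lemma is_derive_line_exp (c p q t : R) :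
  is_derive t 1 (fun u => c * expR (p + u * q)) (c * (q * expR (p + t * q))).
Proof.
have H1 : is_derive t 1 (fun u : R => p + u * q) q.
  have : is_derive t 1 (cst p + (q \*: @id R)) (0 + q *: 1) by apply: is_deriveD.
  rewrite add0r /GRing.scale /= mulr1; congr (is_derive _ _ _ _).
  by apply/funext => u; rewrite /= !fctE [u * q]mulrC.
have H2 : is_derive t 1 (expR \o (fun u : R => p + u * q)) (expR (p + t * q) * q).
  exact: is_derive1_comp.
have : is_derive t 1 (c \*: (expR \o (fun u : R => p + u * q)))
  (c *: (expR (p + t * q) * q)) by exact: is_deriveZ.
by rewrite /GRing.scale /= [q * _]mulrC.
Qed.

Section Line.
Variables (w x : V).
(** Unnormalised Gibbs moments along a line. Differentiation raises k by one, so ln (S 0) has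
    derivative S 1 / S 0, the mean, and then S 2 / S 0 - (S 1 / S 0)^2, the variance. *)
Let S k (t : R) := \sum_a w a ^+ k * expR ((x + t *: w) a).

Let is_derive_S (k : nat) (t : R) : is_derive t 1 (S k) (S k.+1 t).
Proof.
have -> : S k = fun u => \sum_a w a ^+ k * expR (x a + u * w a).
  by apply/funext => u; apply: eq_bigr => a _; rewrite !ffunE.
have -> : S k.+1 t = \sum_a w a ^+ k * (w a * expR (x a + t * w a)).
  by apply: eq_bigr => a _; rewrite !ffunE exprSr mulrA.
by apply: is_derive_bigsum => a; exact: is_derive_line_exp.
Qed.

Let S0E t : S 0 t = sumexp (x + t *: w).
Proof. by apply: eq_bigr => a _; rewrite expr0 mul1r. Qed.

Let S0_gt0 t : 0 < S 0 t.
Proof. by rewrite S0E sumexp_gt0. Qed.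

Let meanE t : gibbs_mean w (x + t *: w) = S 1 t * (S 0 t)^-1.
Proof.
rewrite S0E mulr_suml; apply: eq_bigr => a _.
by rewrite expr1 mulrC mulrA.
Qed.

Let varE t : gibbs_var w (x + t *: w) = S 2 t * (S 0 t)^-1 - (S 1 t * (S 0 t)^-1) ^+ 2.
Proof.
rewrite gibbs_varE meanE; congr (_ - _).
rewrite S0E mulr_suml; apply: eq_bigr => a _.
by rewrite mulrC mulrA.
Qed.

Lemma is_derive_lse (t : R) :
  is_derive t 1 (fun u => lse (x + u *: w)) (gibbs_mean w (x + t *: w)).
Proof.
have -> : (fun u => lse (x + u *: w)) = @ln R \o S 0.
  by apply/funext => u; rewrite /= S0E.
rewrite meanE mulrC.
exact: (is_derive1_comp (is_derive1_ln (S0_gt0 t)) (is_derive_S 0 t)).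
Qed.

Lemma is_derive_gibbs_mean (t : R) :
  is_derive t 1 (fun u => gibbs_mean w (x + u *: w)) (gibbs_var w (x + t *: w)).
Proof.
have -> : (fun u => gibbs_mean w (x + u *: w)) = S 1 * (fun u => (S 0 u)^-1).
  by apply/funext => u; rewrite meanE.
have S0 := S0_gt0 t.
have H : is_derive t 1 (fun u => (S 0 u)^-1) (- (S 0 t) ^- 2 *: S 1 t).
  by apply: is_deriveV; [rewrite gt_eqF | exact: is_derive_S].
apply: (is_derive_eq (is_deriveM (is_derive_S 1 t) H)).
rewrite varE /GRing.scale /=.
by field; rewrite gt_eqF.
Qed.

End Line.

End LogSumExp.

Section Taylor.
Context {R : realType}.

(** The remainder and its derivative vanish at 0, and two uses of the mean value theorem bound it by
    t * t * (L t). The factor 1/6 of the integrated form is lost, which is harmless as only the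
    order in t matters. *)
Lemma taylor2_le (f f1 f2 : R -> R) (L : R) :
  (forall t : R, is_derive t 1 f (f1 t)) -> (forall t : R, is_derive t 1 f1 (f2 t)) ->
  (forall t, 0 <= t -> `|f2 t - f2 0| <= L * t) ->
  forall t, 0 <= t -> `|f t - (f 0 + t * f1 0 + t ^+ 2 / 2 * f2 0)| <= L * t ^+ 3.
Proof.
move=> df df1 fL t.
have cf g (dg : R -> R) (a b : R) : (forall t : R, is_derive t 1 g (dg t)) ->
    {within `[a, b], continuous g}.
  move=> dgE; apply: continuous_subspaceT => u.
  by apply: differentiable_continuous; apply/derivable1_diffP; have [] := dgE u.
rewrite le_eqVlt => /predU1P[<-|t0].
  by rewrite !expr0n/= !(mul0r, mulr0, addr0) subrr normr0.
pose r (u : R) := f u - (f 0 + u * f1 0 + u ^+ 2 / 2 * f2 0).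
pose r1 (u : R) := f1 u - (f1 0 + u * f2 0).
pose r2 (u : R) := f2 u - f2 0.
have dr1 (u : R) : is_derive u 1 r1 (r2 u).
  have : is_derive u 1 (f1 - (cst (f1 0) + (f2 0 \*: @id R))) (f2 u - (0 + f2 0 *: 1)).
    by apply: is_deriveB; apply: is_deriveD.
  rewrite add0r /GRing.scale /= mulr1; congr (is_derive _ _ _ _).
  by apply/funext => v; rewrite /r1 !fctE/= [v * _]mulrC.
have dr (u : R) : is_derive u 1 r (r1 u).
  have : is_derive u 1 (f - (cst (f 0) + (f1 0 \*: @id R) + ((f2 0 / 2) \*: (@id R ^+ 2))))
     (f1 u - (0 + f1 0 *: 1 + (f2 0 / 2) *: ((2%:R * u ^+ 1) *: 1))).
    by apply: is_deriveB; apply: is_deriveD.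
  rewrite add0r /GRing.scale /= !mulr1 => H.
  have -> : r1 u = f1 u - (f1 0 + f2 0 / 2 * (2 * u ^+ 1)).
    by rewrite /r1; field.
  congr (is_derive _ _ _ _): H.
  apply/funext => v; rewrite /r.
  transitivity (f v - (f 0 + f1 0 * v + (f2 0 / 2) * (v * v))); first by [].
  by rewrite expr2; field.
have r10 : r1 0 = 0 by rewrite /r1 !(mul0r, addr0) subrr.
have r0 : r 0 = 0 by rewrite /r expr0n/= !(mul0r, addr0) subrr.
have [c] := MVT t0 (fun u _ => dr u) (cf _ _ 0 t dr).
rewrite in_itv/= => /andP[c0 ct]; rewrite r0 !subr0 => rE.
have [e] := MVT c0 (fun u _ => dr1 u) (cf _ _ 0 c dr1).
rewrite in_itv/= => /andP[e0 ec]; rewrite r10 !subr0 => r1E.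
rewrite -/(r t) rE r1E !normrM (ger0_norm (ltW c0)) (ger0_norm (ltW t0)).
have H := fL e (ltW e0); rewrite -/(r2 e) in H.
have L0 : 0 <= L by have := le_trans (normr_ge0 _) H; rewrite pmulr_lge0.
have -> : L * t ^+ 3 = L * t * t * t by ring.
rewrite ler_wpM2r ?(ltW t0)//.
apply: ler_pM => //; [exact: ltW | | exact: ltW].
by apply: le_trans H _; rewrite ler_wpM2l// ltW// (lt_trans ec).
Qed.

End Taylor.

(** * Second-order expansion of one small Gaussian step *)

Section Lindeberg.
Context {R : realType}.
Local Notation gamma := (@normal_prob R 0 1).

Lemma integrable_normal_cubic (a b c d : R) : gamma.-integrable setT
  (EFin \o (fun t : R => a + b * t + c * t ^+ 2 + d * `|t| ^+ 3)).
Proof.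
apply: (@integrable_normal_quartic _ _ (`|a| + `|b| + `|c| + `|d|)).
  apply: measurable_funD; last first.
    by apply: measurable_funM => //; apply: measurable_funX;
      exact: normr_measurable.
  apply: measurable_funD; last by apply: measurable_funM => //; exact: measurable_funX.
  by apply: measurable_funD => //; exact: measurable_funM.
move=> t; have -> : t ^+ 4 = `|t| ^+ 4 by rewrite -normrX ger0_norm// exprn_even_ge0.
rewrite (le_trans (ler_normD _ _))// (le_trans (lerD (ler_normD _ _) (lexx _)))//.
rewrite (le_trans (lerD (lerD (ler_normD _ _) (lexx _)) (lexx _)))//.
rewrite (normrM b) (normrM c) (normrM d) !normrX normr_id !mulrDl; set y := `|t|.
have y0 : 0 <= y by exact: normr_ge0.
have e4 : y ^+ 4 = (y ^+ 2) ^+ 2 by rewrite -exprM.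
have h1 := sqr_ge0 (y ^+ 2 - 1); have h2 := sqr_ge0 (y - 1); have h3 := sqr_ge0 (y ^+ 2 - y).
have h5 := sqr_ge0 y.
have e3 : y ^+ 3 = y * y ^+ 2 by rewrite -exprS.
have k0 : 0 <= y ^+ 4 by rewrite e4 sqr_ge0.
do !apply: lerD.
- by rewrite ler_peMr// lerDl.
- by rewrite ler_wpM2l//; nra.
- by rewrite ler_wpM2l//; nra.
- by rewrite ler_wpM2l//; nra.
Qed.

(** Kept as an unevaluated number: in the comparison it multiplies the variance terms of both sides
    alike, so nonnegativity is enough there, and the estimate of Gaussian norms uses only that it is
    at most 1. *)
Definition kappa2 : R := \int[gamma]_t (t ^+ 2).
Definition kappa3 : R := \int[gamma]_t (`|t| ^+ 3).

Lemma Rintegral_normal_cubic (a b c d : R) :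
  \int[gamma]_t (a + b * t + c * t ^+ 2 + d * `|t| ^+ 3) = a + c * kappa2 + d * kappa3.
Proof.
have iid : gamma.-integrable setT (EFin \o (@id R)).
  apply: eq_integrable (integrable_normal_cubic 0 1 0 0) => // t _.
  by rewrite /= add0r mul1r !mul0r !addr0.
have isq : gamma.-integrable setT (EFin \o (fun t : R => t ^+ 2)).
  apply: eq_integrable (integrable_normal_cubic 0 0 1 0) => // t _.
  by rewrite /= add0r mul1r !mul0r !addr0 add0r.
have icu : gamma.-integrable setT (EFin \o (fun t : R => `|t| ^+ 3)).
  apply: eq_integrable (integrable_normal_cubic 0 0 0 1) => // t _.
  by rewrite /= add0r mul1r !mul0r !add0r.
have intZ (f : R -> R) (k : R) : gamma.-integrable setT (EFin \o f) ->
    gamma.-integrable setT (EFin \o (fun t => k * f t)).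
  by move=> fi; apply: eq_integrable (integrableZl measurableT k fi).
have ic : gamma.-integrable setT (EFin \o (fun _ : R => a)).
  exact: finite_measure_integrable_cst.
have intD (f g : R -> R) : gamma.-integrable setT (EFin \o f) ->
    gamma.-integrable setT (EFin \o g) ->
    gamma.-integrable setT (EFin \o (fun t => f t + g t)).
  by move=> fi gi; apply: eq_integrable (integrableD measurableT fi gi).
have i1 := intD _ _ ic (intZ _ b iid); have i2 := intD _ _ i1 (intZ _ c isq).
rewrite (RintegralD measurableT i2 (intZ _ d icu)).
rewrite (RintegralD measurableT i1 (intZ _ c isq)) (RintegralD measurableT ic (intZ _ b iid)).
by rewrite !RintegralZl// integral_normal_id mulr0 addr0 Rintegral_normal_cst.
Qed.

Lemma kappa2_ge0 : 0 <= kappa2.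
Proof. by apply: Rintegral_ge0 => t _; exact: sqr_ge0. Qed.

Lemma kappa3_ge0 : 0 <= kappa3.
Proof. by apply: Rintegral_ge0 => t _; exact: exprn_ge0. Qed.


Section OneStep.
Context {I : finType}.
Variable i0 : I.
Local Notation V := {ffun I -> R}.
Implicit Types (x w : V) (us vs ws : seq V).

Let gibbs_varN w x : gibbs_var (- w) x = gibbs_var w x.
Proof.
congr (_ / _); apply: eq_bigr => a _; apply: eq_bigr => b _.
by rewrite !ffunE -opprD sqrrN.
Qed.

Let gibbs_meanN w x : gibbs_mean (- w) x = - gibbs_mean w x.
Proof. by rewrite -sumrN; apply: eq_bigr => a _; rewrite ffunE mulrN. Qed.

Lemma lse_taylor w : exists2 L : R, 0 <= L & forall x u,
  `|lse (x + u *: w) - (lse x + u * gibbs_mean w x + u ^+ 2 / 2 * gibbs_var w x)|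
    <= L * `|u| ^+ 3.
Proof.
have /lipP[C C0 GC] := gibbs_var_lip i0 w.
have L0 : 0 <= C * l1norm w by rewrite mulr_ge0// l1norm_ge0.
exists (C * l1norm w) => // x u.
have H (v : V) t : (forall y, gibbs_var v y = gibbs_var w y) -> l1norm v = l1norm w ->
    0 <= t ->
    `|lse (x + t *: v) - (lse x + t * gibbs_mean v x + t ^+ 2 / 2 * gibbs_var v x)|
      <= C * l1norm w * t ^+ 3.
  move=> vw nvw t0.
  have := @taylor2_le R (fun t => lse (x + t *: v)) (fun t => gibbs_mean v (x + t *: v))
    (fun t => gibbs_var v (x + t *: v)) (C * l1norm w) (is_derive_lse i0 v x)
    (is_derive_gibbs_mean i0 v x).
  rewrite scale0r addr0; apply => // z z0.
  rewrite !vw (le_trans (GC _ _))// addrAC subrr add0r l1normZ nvw ger0_norm//.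
  by rewrite -mulrA [z * _]mulrC.
(* For u < 0 the direction is reversed, which changes the sign of the mean and leaves the variance
   fixed. *)
have [u0|u0] := leP 0 u.
  by rewrite (ger0_norm u0); exact: H.
have := H (- w) (- u) (gibbs_varN w) (l1normN w).
rewrite gibbs_meanN gibbs_varN scalerN scaleNr opprK mulrNN sqrrN oppr_ge0.
by rewrite (ltr0_norm u0); apply; exact: ltW.
Qed.

(** The linear Taylor term integrates to 0, the quadratic one leaves the variance, and the remainder
    is controlled by the third absolute moment. The constant does not depend on the base point, so
    the estimate can be iterated. *)
Lemma gmean_lse w : exists2 C : R, 0 <= C & forall s x, 0 <= s ->
  `|gmean (s *: w) lse x - (lse x + s ^+ 2 * (kappa2 / 2 * gibbs_var w x))| <= C * s ^+ 3.
Proof.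
have [L L0 HL] := lse_taylor w; have lF := @lse_lip R I i0.
exists (L * kappa3); first by rewrite mulr_ge0// kappa3_ge0.
move=> s x s0; set F0 := lse x; set m := gibbs_mean w x; set G := gibbs_var w x.
have Hst t : `|lse (x + t *: (s *: w)) - (F0 + (s * m) * t + (s ^+ 2 / 2 * G) * t ^+ 2)|
    <= (L * s ^+ 3) * `|t| ^+ 3.
  have := HL x (t * s); rewrite -/F0 -/m -/G -scalerA => H.
  have E : `|t * s| ^+ 3 = `|t| ^+ 3 * s ^+ 3 by rewrite normrM (ger0_norm s0) exprMn.
  rewrite {}E in H.
  have -> : L * s ^+ 3 * `|t| ^+ 3 = L * (`|t| ^+ 3 * s ^+ 3) by ring.
  apply: le_trans H; rewrite le_eqVlt; apply/orP; left.
  by apply/eqP; congr (`| _ - _ |); ring.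
rewrite ler_norml; apply/andP; split.
- rewrite lerBrDr; apply: (le_trans _ (@gmean_lb _ _ (s *: w) lse x
     (fun t => F0 + (s * m) * t + (s ^+ 2 / 2 * G) * t ^+ 2 + (- (L * s ^+ 3)) * `|t| ^+ 3)
     lF (integrable_normal_cubic _ _ _ _) _)).
    by rewrite Rintegral_normal_cubic le_eqVlt; apply/orP; left; apply/eqP; field.
  by move=> t; have := Hst t; rewrite ler_norml => /andP[+ _]; rewrite mulNr; lra.
- rewrite lerBlDr; apply: (le_trans (@gmean_ub _ _ (s *: w) lse x
     (fun t => F0 + (s * m) * t + (s ^+ 2 / 2 * G) * t ^+ 2 + (L * s ^+ 3) * `|t| ^+ 3)
     lF (integrable_normal_cubic _ _ _ _) _)).
    by move=> t; have := Hst t; rewrite ler_norml => /andP[_ +]; lra.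
  by rewrite Rintegral_normal_cubic le_eqVlt; apply/orP; left; apply/eqP; field.
Qed.

(** By |t| <= 1 + t^2 the second moment suffices. First order in s is enough, since this error will
    be multiplied by s^2. *)
Lemma gmean_near w (H : V -> R) : lip H ->
  exists2 C : R, 0 <= C & forall s x, 0 <= s -> `|gmean (s *: w) H x - H x| <= C * s.
Proof.
move=> lH; have /lipP[C C0 HC] := lH.
have c0 : 0 <= C * l1norm w by rewrite mulr_ge0// l1norm_ge0.
exists (C * l1norm w * (1 + kappa2)).
  by rewrite mulr_ge0// addr_ge0// kappa2_ge0.
move=> s x s0; set c := C * l1norm w * s.
have c1 : 0 <= c by rewrite mulr_ge0.
have Hst t : `|H (x + t *: (s *: w)) - H x| <= c + c * t ^+ 2.
  have := lip_shift (s *: w) x t 0 C0 HC; rewrite scale0r addr0 subr0 l1normZ (ger0_norm s0).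
  move=> /le_trans; apply; rewrite mulrA [C * s]mulrC -[s * C * _]mulrA [s * _]mulrC -/c.
  have -> : t ^+ 2 = `|t| ^+ 2 by rewrite real_normK ?num_real.
  by have := sqr_ge0 (`|t| - 1); have := normr_ge0 t; nra.
rewrite ler_norml; apply/andP; split.
- rewrite lerBrDr; apply: (le_trans _ (@gmean_lb _ _ (s *: w) H x
     (fun t => (H x - c) + 0 * t + (- c) * t ^+ 2 + 0 * `|t| ^+ 3)
     lH (integrable_normal_cubic _ _ _ _) _)).
    by rewrite Rintegral_normal_cubic /c le_eqVlt; apply/orP; left; apply/eqP; ring.
  by move=> t; have := Hst t; rewrite ler_norml => /andP[+ _]; rewrite mulNr !mul0r; lra.
- rewrite lerBlDr; apply: (le_trans (@gmean_ub _ _ (s *: w) H x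
     (fun t => (H x + c) + 0 * t + c * t ^+ 2 + 0 * `|t| ^+ 3)
     lH (integrable_normal_cubic _ _ _ _) _)).
    by move=> t; have := Hst t; rewrite ler_norml => /andP[_ +]; rewrite !mul0r; lra.
  by rewrite Rintegral_normal_cubic /c le_eqVlt; apply/orP; left; apply/eqP; ring.
Qed.

Definition gibbs_vars ws x : R := \sum_(w <- ws) gibbs_var w x.

Lemma gibbs_vars_lip ws : lip (gibbs_vars ws).
Proof. by apply: lip_sum => w; exact: gibbs_var_lip. Qed.

(** The outermost step w adds its own variance to that of the other directions, and displaces the
    latter by O(s); this displacement carries a factor s^2 and joins the cubic error. *)
Lemma gmeans_lse ws : exists2 C : R, 0 <= C & forall s x, 0 <= s <= 1 ->
  `|gmeans [seq s *: w | w <- ws] lse x - (lse x + s ^+ 2 * (kappa2 / 2 * gibbs_vars ws x))|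
    <= C * s ^+ 3.
Proof.
have lF := @lse_lip R I i0.
elim: ws => [|w ws [C C0 IH]].
  exists 0 => // s x _; rewrite /= /gibbs_vars big_nil !mulr0 addr0 subrr normr0.
  by rewrite mul0r.
have [D D0 HD] := gmean_lse w.
have lG := gibbs_vars_lip ws.
have [E E0 HE] := gmean_near w lG.
have k0 := kappa2_ge0.
exists (C + D + kappa2 / 2 * E).
  by rewrite !addr_ge0// mulr_ge0// divr_ge0.
move=> s x s01; have /andP[s0 s1] := s01; rewrite /gibbs_vars big_cons -/(gibbs_vars ws x) /=.
set a := s ^+ 2 * (kappa2 / 2).
have a0 : 0 <= a by rewrite mulr_ge0 ?sqr_ge0// divr_ge0.
have lA := gmeans_lip [seq s *: w | w <- ws] lF.
have lB : lip (fun y => lse y + a * gibbs_vars ws y) by apply: lipD => //; exact: lipZ.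
have ub : gmean (s *: w) (gmeans [seq s *: w | w <- ws] lse) x <=
    gmean (s *: w) lse x + a * gmean (s *: w) (gibbs_vars ws) x + C * s ^+ 3.
  rewrite -gmeanDZ//; have := gmeansDc [:: s *: w] (C * s ^+ 3) x lB => /= <-.
  apply: gmean_le => //; first by apply: lipD => //; exact: lip_cst.
  by move=> y; have := IH s y s01; rewrite ler_norml => /andP[_]; rewrite lerBlDr addrC mulrA.
have lb : gmean (s *: w) lse x + a * gmean (s *: w) (gibbs_vars ws) x - C * s ^+ 3 <=
    gmean (s *: w) (gmeans [seq s *: w | w <- ws] lse) x.
  rewrite -gmeanDZ//; have := gmeansDc [:: s *: w] (- (C * s ^+ 3)) x lB => /= <-.
  apply: gmean_le => //; first by apply: lipD => //; exact: lip_cst.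
  by move=> y; have := IH s y s01; rewrite ler_norml => /andP[+ _]; rewrite lerBrDr addrC mulrA.
have := HD s x s0; have := HE s x s0; rewrite !ler_norml => /andP[e1 e2] /andP[d1 d2].
have aE : a * (E * s) = kappa2 / 2 * E * s ^+ 3 by rewrite /a; ring.
have e1' := ler_wpM2l a0 e1; have e2' := ler_wpM2l a0 e2.
rewrite mulrN in e1'; rewrite aE in e1' e2'; rewrite !mulrBr in e1' e2'.
have aD u : s ^+ 2 * (kappa2 / 2 * u) = a * u by rewrite /a mulrA.
rewrite aD in d1; rewrite aD in d2.
rewrite aD mulrDr mulrDl mulrDl; apply/andP; split; lra.
Qed.

End OneStep.

End Lindeberg.

(** * Lindeberg replacement and the soft maximum *)

Section Comparison.
Context {R : realType} {I : finType}.
Variable i0 : I.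
Local Notation V := {ffun I -> R}.
Implicit Types (x w : V) (us vs ws : seq V).

(** The innermost slice [us] is exchanged for [vs] at cost c, then commuted to the outside, and the
    remaining slices are treated in the same way. Averaging preserves constants, so the costs simply
    add up. *)
Lemma iter_gmeans_le m us vs (F : V -> R) (c : R) x : lip F ->
  (forall y, gmeans us F y <= gmeans vs F y + c) ->
  iter m (gmeans us) F x <= iter m (gmeans vs) F x + m%:R * c.
Proof.
move=> lF H.
have itD k (G : V -> R) (d : R) y : lip G ->
    iter k (gmeans us) (fun z => G z + d) y = iter k (gmeans us) G y + d.
  move=> lG; elim: k y => //= k IH y.
  by rewrite (funext IH) gmeansDc//; exact: iter_gmeans_lip.
have it_le k (G K : V -> R) y : lip G -> lip K -> (forall z, G z <= K z) ->
    iter k (gmeans us) G y <= iter k (gmeans us) K y.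
  move=> lG lK GK; elim: k y => //= k IH y.
  by apply: gmeans_le => //; exact: iter_gmeans_lip.
have itC k y : iter k (gmeans us) (gmeans vs F) y = gmeans vs (iter k (gmeans us) F) y.
  elim: k y => [//|k IH] y; rewrite /= (funext IH).
  by apply: gmeansC; exact: iter_gmeans_lip.
have lvF := gmeans_lip vs lF.
elim: m x => [|m IH] x; first by rewrite mul0r addr0.
rewrite iterSr (@le_trans _ _ (iter m (gmeans us) (fun z => gmeans vs F z + c) x))//.
  apply: it_le => //; first exact: gmeans_lip.
  by apply: lipD => //; exact: lip_cst.
rewrite itD// itC iterS -natr1 mulrDl mul1r addrA lerD2r.
rewrite -gmeansDc; last exact: iter_gmeans_lip.
apply: gmeans_le => //; first exact: iter_gmeans_lip.
by apply: lipD; [exact: iter_gmeans_lip|exact: lip_cst].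
Qed.

Lemma gibbs_vars_le us vs x :
  (forall a b, \sum_(u <- us) (u a - u b) ^+ 2 <= \sum_(v <- vs) (v a - v b) ^+ 2) ->
  gibbs_vars us x <= gibbs_vars vs x.
Proof.
move=> H.
have E ws : gibbs_vars ws x =
    (\sum_a \sum_b gibbs x a * gibbs x b * (\sum_(w <- ws) (w a - w b) ^+ 2)) / 2.
  rewrite /gibbs_vars -mulr_suml; congr (_ / _).
  rewrite exchange_big; apply: eq_bigr => a _.
  rewrite exchange_big; apply: eq_bigr => b _.
  by rewrite mulr_sumr.
rewrite !E ler_wpM2r// ler_sum// => a _; rewrite ler_sum// => b _.
by rewrite ler_wpM2l// mulr_ge0// gibbs_ge0.
Qed.

(** With q = sqrt (m + 1), the directions scaled by 1 / q and iterated m + 1 times recover the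
    original average. The second-order terms are ordered by [gibbs_vars_le] and one slice loses at
    most (C + D) q^{-3}, so the total loss (C + D) / q vanishes as m grows. *)
Lemma gmeans_lse_le us vs x :
  (forall a b, \sum_(u <- us) (u a - u b) ^+ 2 <= \sum_(v <- vs) (v a - v b) ^+ 2) ->
  gmeans us lse x <= gmeans vs lse x.
Proof.
move=> H; have lF := @lse_lip R I i0.
have [C C0 HC] := gmeans_lse i0 us; have [D D0 HD] := gmeans_lse i0 vs.
have step m : gmeans us lse x <= gmeans vs lse x + (C + D) / Num.sqrt m.+1%:R.
  set q := Num.sqrt m.+1%:R.
  have q0 : 0 < q by rewrite sqrtr_gt0.
  have q2 : q ^+ 2 = m.+1%:R by rewrite sqr_sqrtr.
  have s0 : 0 < q^-1 by rewrite invr_gt0.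
  have s01 : 0 <= q^-1 <= 1.
    rewrite ltW//= invf_le1// -[leLHS]sqrtr1 ler_sqrt//.
    by rewrite (ler_nat R 1).
  have loc y : gmeans [seq q^-1 *: w | w <- us] lse y <=
      gmeans [seq q^-1 *: w | w <- vs] lse y + (C + D) * q^-1 ^+ 3.
    have := HC _ y s01; have := HD _ y s01.
    rewrite !ler_norml => /andP[d1 _] /andP[_ c2].
    have : q^-1 ^+ 2 * (kappa2 / 2 * gibbs_vars us y) <=
        q^-1 ^+ 2 * (kappa2 / 2 * gibbs_vars vs y).
      by rewrite ler_wpM2l ?sqr_ge0// ler_wpM2l ?divr_ge0 ?kappa2_ge0// gibbs_vars_le.
    by rewrite mulrDl; lra.
  have := iter_gmeans_le m.+1 x lF loc.
  rewrite !iter_gmeans// -/q divff ?gt_eqF//.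
  have id1 ws : [seq 1 *: w | w <- ws] = ws.
    by rewrite -[RHS]map_id; apply: eq_map => w; rewrite scale1r.
  rewrite !id1 -q2.
  have -> : q ^+ 2 * ((C + D) * q^-1 ^+ 3) = (C + D) / q.
    by field; rewrite gt_eqF.
  by [].
apply/ler_addgt0Pr => e e0.
have c0 : 0 <= (C + D) / e by rewrite divr_ge0 ?addr_ge0// ltW.
pose m := Num.truncn (((C + D) / e) ^+ 2).
apply: (le_trans (step m)); rewrite lerD2l ler_pdivrMr ?sqrtr_gt0//.
rewrite mulrC -ler_pdivrMr// -[leLHS]ger0_norm// -sqrtr_sqr ler_sqrt//.
by rewrite ltW// truncnS_gt.
Qed.

Definition fmax x : R := \big[Num.max/x i0]_a x a.

Lemma fmax_ge x a : x a <= fmax x.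
Proof. exact: le_bigmax. Qed.

Lemma fmax_le x c : (forall a, x a <= c) -> fmax x <= c.
Proof. by move=> H; apply: bigmax_le => // a _. Qed.

Lemma fmax_eq x : exists a, fmax x = x a.
Proof.
rewrite /fmax; elim/big_ind: _ => [|u v [a ->] [b ->]|a _].
- by exists i0.
- by rewrite /Num.max; case: ifP => _; [exists b|exists a].
- by exists a.
Qed.

Lemma fmax_lip : lip fmax.
Proof.
exists 1.
have H x y : fmax x - fmax y <= l1norm (x - y).
  rewrite lerBlDl; apply: fmax_le => a.
  rewrite -lerBlDl (le_trans (lerB (lexx _) (fmax_ge y a)))//.
  have := ler_coord_l1norm (x - y) a; rewrite !ffunE.
  by apply: le_trans; exact: ler_norm.
move=> x y; rewrite mul1r ler_norml H andbT lerNl opprB.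
by rewrite -l1normN opprB; exact: H.
Qed.

Lemma lse_fmax (b : R) x : 0 < b ->
  b * fmax x <= lse (b *: x) <= b * fmax x + ln #|I|%:R.
Proof.
move=> b0; apply/andP; split.
  have [a ->] := fmax_eq x; rewrite -[leLHS]expRK ler_ln ?posrE ?expR_gt0 ?(sumexp_gt0 i0)//.
  rewrite /sumexp (bigD1 a)//= ffunE /GRing.scale /= lerDl.
  by apply: sumr_ge0 => c _; exact: expR_ge0.
have I0 : 0 < #|I|%:R :> R by rewrite ltr0n; apply/card_gt0P; exists i0.
rewrite -[X in X + _]expRK -lnM ?posrE ?expR_gt0//.
rewrite ler_ln ?posrE ?mulr_gt0 ?expR_gt0 ?(sumexp_gt0 i0)//.
apply: (@le_trans _ _ (\sum_(a : I) expR (b * fmax x))).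
  apply: ler_sum => a _; rewrite ler_expR ffunE /GRing.scale /= ler_wpM2l ?(ltW b0)//.
  exact: fmax_ge.
by rewrite sumr_const mulr_natr.
Qed.

End Comparison.

Section LinearMaps.
Context {R : realType} {I K : finType}.

Lemma gmeans_affine (L L0 : {ffun K -> R} -> {ffun I -> R}) ws
    (F : {ffun I -> R} -> R) x :
  (forall y w t, L (y + t *: w) = L y + t *: L0 w) ->
  gmeans ws (F \o L) x = gmeans [seq L0 w | w <- ws] F (L x).
Proof.
move=> HL; elim: ws x => [//|w ws IH] x.
rewrite [RHS]/= [LHS]/= !gmeanE; apply: eq_Rintegral => t _.
by rewrite IH HL.
Qed.

End LinearMaps.

Section SudakovFernique.
Context {R : realType} {I : finType}.
Variable i0 : I.
Local Notation V := {ffun I -> R}.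

(** The function lse (b *: x) / b exceeds the maximum by at most ln #|I| / b. Scaling by b
    multiplies both sums of squared increments by b^2, hence keeps their order, and the chosen b
    brings the error below e. *)
Theorem sudakov_fernique (us vs : seq V) (x : V) :
  (forall a b, \sum_(u <- us) (u a - u b) ^+ 2 <= \sum_(v <- vs) (v a - v b) ^+ 2) ->
  gmeans us (fmax i0) x <= gmeans vs (fmax i0) x.
Proof.
move=> H; apply/ler_addgt0Pr => e e0.
have lM := @fmax_lip R I i0; have lF := @lse_lip R I i0.
pose c := ln (#|I|%:R : R); pose b := (`|c| + 1) / e.
have b0 : 0 < b by rewrite divr_gt0// ltr_wpDl.
have lFb : lip (fun y : V => lse (b *: y)).
  have /lipP[C C0 HC] := lF; exists (C * b) => y z.
  by rewrite (le_trans (HC _ _))// -scalerBr l1normZ ger0_norm ?(ltW b0)// mulrA.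
have lin (y w : V) t : b *: (y + t *: w) = b *: y + t *: (b *: w).
  by rewrite scalerDr !scalerA mulrC.
have E ws : gmeans ws (fun y : V => lse (b *: y)) x =
    gmeans [seq b *: w | w <- ws] lse (b *: x) := @gmeans_affine _ _ _ _ _ ws lse x lin.
have lZ : lip (fun y : V => 0 + b * fmax i0 y) by apply: lipD; [exact: lip_cst|exact: lipZ].
have bE ws : gmeans ws (fun y : V => 0 + b * fmax i0 y) x = b * gmeans ws (fmax i0) x.
  by rewrite (gmeansDZ ws b x (lip_cst 0) lM) gmeans_cst add0r.
have ub : b * gmeans us (fmax i0) x <= b * gmeans vs (fmax i0) x + c.
  rewrite -!bE -gmeansDc//.
  apply: (@le_trans _ _ (gmeans us (fun y : V => lse (b *: y)) x)).
    by apply: gmeans_le => // y; rewrite add0r; have /andP[] := lse_fmax i0 y b0.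
  apply: (@le_trans _ _ (gmeans vs (fun y : V => lse (b *: y)) x)).
    rewrite !E; apply: gmeans_lse_le => // a a'.
    rewrite !big_map.
    have Z (ws : seq V) : \sum_(w <- ws) ((b *: w) a - (b *: w) a') ^+ 2 =
        b ^+ 2 * \sum_(w <- ws) (w a - w a') ^+ 2 :> R.
      by rewrite mulr_sumr; apply: eq_bigr => w _; rewrite !ffunE /GRing.scale /= -mulrBr exprMn.
    by rewrite !Z ler_wpM2l ?sqr_ge0.
  apply: gmeans_le => //; first by apply: lipD => //; exact: lip_cst.
  by move=> y; rewrite add0r; have /andP[] := lse_fmax i0 y b0.
have be : b * e = `|c| + 1 by rewrite divfK// gt_eqF.
rewrite -(ler_pM2l b0) mulrDr be (le_trans ub)// lerD2l.
by rewrite (le_trans (ler_norm _))// lerDl.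
Qed.

End SudakovFernique.

(** * Laws of Gaussian vectors *)

Lemma Rintegral_sum d (T : measurableType d) (R : realType)
    (mu : {measure set T -> \bar R}) (D : set T) (I : Type) (s : seq I) (f : I -> T -> R) :
  measurable D -> (forall i, mu.-integrable D (EFin \o f i)) ->
  \int[mu]_(x in D) (\sum_(i <- s) f i x) = \sum_(i <- s) \int[mu]_(x in D) f i x.
Proof.
move=> mD fi.
have fs r : mu.-integrable D (EFin \o (fun x => \sum_(i <- r) f i x)).
  elim: r => [|i r IH].
    apply: eq_integrable (integrable0 mu D) => // x _.
    by rewrite /= big_nil.
  apply: eq_integrable (integrableD mD (fi i) IH) => // x _.
  by rewrite /= big_cons.
elim: s => [|i s IH].
  rewrite big_nil; under eq_Rintegral do rewrite big_nil.
  by rewrite Rintegral_cst// mul0r.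
rewrite big_cons -IH -RintegralD//.
by apply: eq_Rintegral => x _; rewrite big_cons.
Qed.

Section NormalLine.
Context {R : realType} {I : finType}.
Local Notation V := {ffun I -> R}.
Implicit Types (x u : V) (F : V -> R).

Lemma integrable_normal_norm (s : R) : 0 < s ->
  (normal_prob 0 s).-integrable setT (EFin \o (fun t : R => t)).
Proof.
move=> s0; apply/integrableP; split; first exact/measurable_EFinP.
have -> : (\int[normal_prob 0 s]_x `|(EFin \o id) x| =
    \int[normal_prob 0 s]_x ((fun t : R => `|t|) x)%:E)%E by apply: eq_integral.
rewrite integral_normal_affine//; last exact: norm_continuous.
have : (normal_prob 0 1).-integrable setT (EFin \o (fun t : R => 0 + s * t + 0 * t ^+ 2 + 0 * `|t| ^+ 3)).
  exact: integrable_normal_cubic.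
move=> /integrableP[_]; apply: le_lt_trans; rewrite le_eqVlt; apply/orP; left; apply/eqP.
by apply: eq_integral => t _; rewrite /= !mul0r !addr0.
Qed.

Lemma integrable_normal_line (s : R) u F x : 0 < s -> lip F ->
  (normal_prob 0 s).-integrable setT (EFin \o (fun t : R => F (x + t *: u))).
Proof.
move=> s0 lF; have /lipP[C C0 FC] := lF.
have ic : (normal_prob 0 s).-integrable setT (EFin \o (fun _ : R => `|F x|)).
  exact: finite_measure_integrable_cst.
have il := integrableZl measurableT (C * l1norm u)
  (integrable_norm (integrable_normal_norm s0)).
apply: le_integrable (integrableD measurableT ic il) => //.
  by apply/measurable_EFinP; exact: measurable_line.
move=> t _; rewrite lee_fin /=.
rewrite (ger0_norm (x := _ + _)); last first.
  by rewrite addr_ge0// mulr_ge0// mulr_ge0// l1norm_ge0.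
have := lip_shift u x t 0 C0 FC; rewrite subr0 scale0r addr0 => H.
by rewrite -lerBlDl (le_trans (lerB_dist _ _)).
Qed.

Lemma Rintegral_normal_line (s : R) u F x : 0 < s -> lip F ->
  \int[normal_prob 0 s]_t F (x + t *: u) = gmean (s *: u) F x.
Proof.
move=> s0.
have pos G : lip G -> (forall y, 0 <= G y) ->
    \int[normal_prob 0 s]_t G (x + t *: u) = gmean (s *: u) G x.
  move=> lG G0; rewrite gmeanE; apply: (congr1 fine).
  have cG := @continuous_line _ _ u G x lG.
  apply: (etrans (@integral_normal_affine R 0 s (fun t => G (x + t *: u)) s0 cG _)) => //.
  by apply: eq_integral => t _; rewrite add0r scalerA mulrC.
move=> lF; rewrite gmean_pos_neg// -!pos//; last 4 first.
- exact/lip_pos_part/lip_opp.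
- by move=> y; exact: pos_part_ge0.
- exact: lip_pos_part.
- by move=> y; exact: pos_part_ge0.
rewrite mulN1r -RintegralB//; last 2 first.
- exact/integrable_normal_line/lip_pos_part.
- exact/integrable_normal_line/lip_pos_part/lip_opp.
apply: eq_Rintegral => t _.
by rewrite /pos_part /Num.max; case: ltP => ?; case: ltP => ?; lra.
Qed.

Import HBSimple.

Lemma normal_simple_approx (s e : R) : 0 < s -> 0 < e ->
  exists f : R -> R, [/\ measurable_fun setT f, finite_set (range f),
    (normal_prob 0 s).-integrable setT (EFin \o f) &
    \int[normal_prob 0 s]_t `|t - f t| <= e].
Proof.
move=> s0 e0; have iid := integrable_normal_norm s0.
have [g_ [ig _ cg]] := approximation_sfun_integrable measurableT iid.
move/fine_fcvg/cvg_ballP/(_ e e0) : cg => -[] n _ Nb; exists (g_ n); split.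
- by have /integrableP[/measurable_EFinP] := ig n.
- exact: (fimfunP (g_ n)).
- exact: ig.
have := Nb n (leqnn n); rewrite /ball/= sub0r normrN => /ltW.
by apply: le_trans; rewrite -[leLHS]ger0_norm//; exact: Rintegral_ge0.
Qed.

End NormalLine.

Section GaussianLaw.
Context d {T : measurableType d} {R : realType} (P : probability T R).
Context {I J : finType}.
Local Notation V := {ffun I -> R}.
Variables (g : J -> T -> R) (sigma : J -> R) (u : J -> V).
Hypothesis sigma_gt0 : forall j, 0 < sigma j.
Hypothesis mg : forall j, measurable_fun setT (g j).
Hypothesis g_law : forall B : J -> set R, (forall j, measurable (B j)) ->
  P [set w | forall j, B j (g j w)] = (\prod_j normal_prob 0 (sigma j) (B j))%E.

Let cyl (B : J -> set R) := [set w | forall j, B j (g j w)].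

Let measurable_cyl B : (forall j, measurable (B j)) -> measurable (cyl B).
Proof.
move=> mB; rewrite (_ : cyl B = \bigcap_(j in setT) (g j @^-1` B j)); last first.
  by apply/seteqP; split => w /= H j => [_|]; exact: H.
apply: fin_bigcap_measurable => // j _; rewrite -[X in measurable X]setTI.
exact: mg.
Qed.

Lemma marginal_law j (B : set R) : measurable B ->
  P (g j @^-1` B) = normal_prob 0 (sigma j) B.
Proof.
move=> mB; pose Bj i : set R := if i == j then B else setT.
rewrite (_ : _ @^-1` B = [set w | forall i, Bj i (g i w)]); last first.
  apply/seteqP; split => w /= H => [i|]; first by rewrite /Bj; case: eqP => // ->.
  by have := H j; rewrite /Bj eqxx.
rewrite g_law; last by move=> i; rewrite /Bj; case: ifP.
rewrite (bigD1 j)//= big1 ?mule1; first by rewrite /Bj eqxx.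
move=> i ij; rewrite /Bj (negbTE ij); exact: (probability_setT (normal_prob 0 (sigma i))).
Qed.

Lemma ge0_integral_marginal j (f : R -> R) : measurable_fun setT f ->
  (forall t, 0 <= f t) ->
  (\int[P]_w (f (g j w))%:E = \int[normal_prob 0 (sigma j)]_t (f t)%:E)%E.
Proof.
move=> mf f0.
have mE : measurable_fun setT (EFin \o f) by exact/measurable_EFinP.
pose gj : T -> measurableTypeR R := g j.
have mgj : measurable_fun setT gj by exact: mg.
pose fE : measurableTypeR R -> \bar R := EFin \o f.
transitivity (\int[P]_w (fE \o gj) w)%E; first by [].
rewrite -[X in (\int[_]_(_ in X) _)%E](preimage_setT gj).
rewrite -ge0_integral_pushforward//=; last by move=> t _; rewrite lee_fin.
by apply: eq_measure_integral => A mA _; exact: marginal_law.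
Qed.

Lemma integrable_marginal j (f : R -> R) : measurable_fun setT f ->
  (normal_prob 0 (sigma j)).-integrable setT (EFin \o f) ->
  P.-integrable setT (EFin \o (f \o g j)).
Proof.
move=> mf /integrableP[_ fi]; apply/integrableP; split.
  by apply/measurable_EFinP; exact: measurableT_comp.
have nf : measurable_fun setT (fun t => `|f t|) by exact: measurableT_comp.
by rewrite (@ge0_integral_marginal j (fun t => `|f t|)).
Qed.


Let Z (js : seq J) (w : T) : V := \sum_(j <- js) g j w *: u j.

Let integrable_abs_g j : P.-integrable setT (EFin \o (fun w => `|g j w|)).
Proof.
apply: (@integrable_marginal j (fun t => `|t|)) => //.
exact: integrable_norm (integrable_normal_norm (sigma_gt0 j)).
Qed.

Let l1norm_sum (js : seq J) w : l1norm (Z js w) <= \sum_(j <- js) `|g j w| * l1norm (u j).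
Proof.
rewrite /Z; elim: js => [|j js IH].
  by rewrite !big_nil /l1norm big1// => i _; rewrite ffunE normr0.
by rewrite !big_cons (le_trans (ler_l1normD _ _))// l1normZ lerD.
Qed.

Lemma integrable_gaussian_vector (D : set T) (F : V -> R) (h : T -> R) (x v : V) js :
  measurable D -> lip F -> measurable_fun setT h -> P.-integrable setT (EFin \o h) ->
  P.-integrable D (EFin \o (fun w => F (x + h w *: v + Z js w))).
Proof.
move=> mD lF mh ih; have /lipP[C C0 FC] := lF.
apply: integrableS (subsetT D) _ => //.
have mphi a : measurable_fun setT (fun w => (x + h w *: v + Z js w) a).
  under eq_fun do rewrite !ffunE.
  apply: measurable_funD; first by apply: measurable_funD => //; exact: measurable_funM.
  rewrite /Z; elim: js => [|j js IH].
    by under eq_fun do rewrite big_nil ffunE; exact: measurable_cst.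
  under eq_fun do rewrite big_cons !ffunE; apply: measurable_funD => //.
  exact: measurable_funM.
have ic : P.-integrable setT (EFin \o (fun _ : T => `|F x|)).
  exact: finite_measure_integrable_cst.
have isum : P.-integrable setT (EFin \o (fun w => \sum_(j <- js) `|g j w| * l1norm (u j))).
  elim: js {mphi} => [|j js IH].
    apply: eq_integrable (integrable0 P setT) => // w _.
    by rewrite /= big_nil.
  apply: eq_integrable (integrableD measurableT
    (integrableZl measurableT (l1norm (u j)) (integrable_abs_g j)) IH) => // w _.
  by rewrite /= big_cons EFinD mulrC EFinM.
have ih2 := integrableZl measurableT (l1norm v) (integrable_norm ih).
have iall := integrableD measurableT ic
   (integrableZl measurableT C (integrableD measurableT ih2 isum)).
apply: le_integrable iall => //.
  by apply/measurable_EFinP; exact: (lip_measurable lF mphi).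
move=> w _; rewrite lee_fin /=.
set S := \sum_(j <- js) _; have S0 : 0 <= S.
  by apply: sumr_ge0 => j _; rewrite mulr_ge0// l1norm_ge0.
rewrite (ger0_norm (x := _ + _)); last first.
  by rewrite !(addr_ge0, mulr_ge0)// l1norm_ge0.
rewrite -lerBlDl (le_trans (lerB_dist _ _))// (le_trans (FC _ _))// ler_wpM2l//.
rewrite -(addrA x) [x + _]addrC addrK (le_trans (ler_l1normD _ _))//.
by rewrite lerD ?l1norm_sum// l1normZ mulrC.
Qed.

Let cyl_update B j0 (A : set R) : (forall j, measurable (B j)) -> measurable A ->
  B j0 = setT ->
  P (cyl (fun j => if j == j0 then A else B j)) =
  (normal_prob 0 (sigma j0) A * P (cyl B))%E.
Proof.
move=> mB mA Bj0.
rewrite /cyl (g_law (B := fun j => if j == j0 then A else B j)); last by move=> j /=; case: (j == j0).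
rewrite (g_law mB).
rewrite (bigD1 j0)//= eqxx [in RHS](bigD1 j0)//= Bj0.
rewrite [normal_prob 0 (sigma j0) setT](probability_setT (normal_prob 0 (sigma j0))) mul1e.
by congr (_ * _)%E; apply: eq_bigr => j /negbTE ->.
Qed.

(** Cylinders, constrained only outside [js], make the induction possible. The coordinate j0 is
    replaced by a simple function f of it; each level set of f cuts out another cylinder, where the
    induction hypothesis applies with a fixed displacement and [g_law] splits off the weight of the
    level. By the Lipschitz bounds, the L1 error of f controls the error of both integrals. *)
Lemma gaussian_law_cyl js B (F : V -> R) x : uniq js -> (forall j, measurable (B j)) ->
  {in js, forall j, B j = setT} -> lip F ->
  \int[P]_(w in cyl B) F (x + Z js w) =
  gmeans [seq sigma j *: u j | j <- js] F x * fine (P (cyl B)).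
Proof.
elim: js B x => [|j0 js IH] B x /=.
  move=> _ mB _ lF.
  under eq_Rintegral do rewrite /Z big_nil addr0.
  by rewrite Rintegral_cst//; exact: measurable_cyl.
move=> /andP[j0js ujs] mB BT lF.
have Bj0 : B j0 = setT by apply: BT; rewrite mem_head.
have BTjs : {in js, forall j, B j = setT} by move=> j jjs; apply: BT; rewrite in_cons jjs orbT.
set Phi := gmeans _ F; have lPhi : lip Phi by exact: gmeans_lip.
have mcB := measurable_cyl mB.
pose nu := normal_prob 0 (sigma j0); pose pB := fine (P (cyl B)).
have pB0 : 0 <= pB by exact: fine_ge0.
have pB1 : pB <= 1.
  by rewrite -[1]/(fine 1%E) fine_le ?fin_num_measure// probability_le1.
have [C C0 FC] := lipP lF; have [D D0 PhiD] := lipP lPhi.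
rewrite -(Rintegral_normal_line (u j0) x (sigma_gt0 j0) lPhi).
apply/eqP; rewrite -subr_eq0 -normr_le0; apply/ler_addgt0Pl => e e0; rewrite addr0.
(* Normalises the L1 accuracy e / c so that the errors with constants C and D add up to at most e;
   the added 1 avoids division by 0. *)
pose c := (C + D) * l1norm (u j0) + 1.
have c0 : 0 < c by rewrite ltr_wpDl// mulr_ge0 ?addr_ge0// l1norm_ge0.
have [f [mf ff intf fe]] := normal_simple_approx (sigma_gt0 j0) (divr_gt0 e0 c0).
set I1 := Rintegral P _ _; set I2 := Rintegral nu _ _.
have /finite_seqP[X0 fX0] := ff; pose X := undup X0.
have XE t (k : R -> R) : k (f t) = \sum_(r <- X) \1_(f @^-1` [set r]) t * k r.
  have tX : f t \in X.
    by rewrite mem_undup; suff : [set` X0] (f t) by []; rewrite -fX0; exists t.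
  rewrite (bigD1_seq (f t))//= ?undup_uniq// big1 ?addr0; last first.
    move=> r rt; rewrite indicE memNset ?mul0r//= => /eqP.
    by rewrite eq_sym (negbTE rt).
  by rewrite indicE mem_set// mul1r.
have mfr r : measurable (f @^-1` [set r]) by rewrite -[X in measurable X]setTI; exact: mf.
have stepE : \int[P]_(w in cyl B) F (x + f (g j0 w) *: u j0 + Z js w) =
    (\int[nu]_t Phi (x + f t *: u j0)) * pB.
  under eq_Rintegral do rewrite (XE _ (fun r => F (x + r *: u j0 + Z js _))).
  under [in RHS]eq_Rintegral do rewrite (XE _ (fun r => Phi (x + r *: u j0))).
  have iF r (E : set T) : measurable E ->
      P.-integrable E (EFin \o (fun w => F (x + r *: u j0 + Z js w))).
    move=> mE; apply: (integrable_gaussian_vector (h := fun=> r)) => //.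
    exact: finite_measure_integrable_cst.
  have mgr r : measurable (g j0 @^-1` (f @^-1` [set r])).
    by rewrite -[X in measurable X]setTI; exact: mg.
  have EI r w : \1_(f @^-1` [set r]) (g j0 w) * F (x + r *: u j0 + Z js w) =
      ((fun w => F (x + r *: u j0 + Z js w)) \_ (g j0 @^-1` (f @^-1` [set r]))) w.
    rewrite patchE indicE; case: ifPn => /=.
      by rewrite !inE /= => wr; rewrite mem_set// mul1r.
    by rewrite !notin_setE /= => wr; rewrite memNset// mul0r.
  have iG r : P.-integrable (cyl B) (EFin \o (fun w =>
      \1_(f @^-1` [set r]) (g j0 w) * F (x + r *: u j0 + Z js w))).
    under [X in EFin \o X]funext => w do rewrite EI.
    rewrite -restrict_EFin; apply/integrable_restrict => //.
    by apply: iF; exact: measurableI.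
  have iPhi r : nu.-integrable setT (EFin \o (fun t =>
      \1_(f @^-1` [set r]) t * Phi (x + r *: u j0))).
    apply: eq_integrable (integrableZr measurableT (Phi (x + r *: u j0))
      (integrable_indic nu (mfr r))) => //.
  rewrite (Rintegral_sum X mcB iG) (Rintegral_sum X measurableT iPhi).
  rewrite mulr_suml; apply: eq_bigr => r _.
  under eq_Rintegral do rewrite EI.
  rewrite -Rintegral_mkcondr.
  have ii := integrable_indic nu (mfr r).
  rewrite (RintegralZr _ measurableT ii).
  pose B' j := if j == j0 then f @^-1` [set r] else B j.
  have -> : cyl B `&` g j0 @^-1` (f @^-1` [set r]) = cyl B'.
    apply/seteqP; split => w /=.
      by move=> [Bw fw] j; rewrite /B'; case: eqP => [->|_ ].
    move=> B'w; split => [j|]; last by have := B'w j0; rewrite /B' eqxx.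
    by have := B'w j; rewrite /B'; case: eqP => // -> _; rewrite Bj0.
  rewrite IH//; last 2 first.
  - by move=> j; rewrite /B'; case: ifP.
  - move=> j jjs; rewrite /B'; case: eqP => [jj0|_]; last exact: BTjs.
    by rewrite jj0 (negbTE j0js) in jjs.
  rewrite cyl_update// fineM ?fin_num_measure// -/pB -/Phi.
  transitivity (fine (nu (f @^-1` [set r])) * Phi (x + r *: u j0) * pB); first by rewrite mulrA [Phi _ * _]mulrC.
    congr (_ * _ * _).
    by rewrite /Rintegral (integral_indic nu measurableT (mfr r)) setIT.
  exact: mfr.
have mid : measurable_fun setT (fun t : R => t) by [].
have mdf : measurable_fun setT (fun t : R => `|t - f t|).
  by apply: measurableT_comp => //; exact: measurable_funB.
have idf : nu.-integrable setT (EFin \o (fun t : R => `|t - f t|)).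
  by apply: integrable_norm (integrableB measurableT (integrable_normal_norm (sigma_gt0 j0)) intf).
have idfP : P.-integrable setT (EFin \o (fun w => `|g j0 w - f (g j0 w)|)).
  exact: (integrable_marginal mdf idf).
have idfE : \int[P]_w `|g j0 w - f (g j0 w)| = \int[nu]_t `|t - f t|.
  exact: (congr1 fine (ge0_integral_marginal j0 mdf (fun t => normr_ge0 _))).
have mfg : measurable_fun setT (fun w => f (g j0 w)) by exact: measurableT_comp.
have ig0 : P.-integrable setT (EFin \o g j0).
  exact: (integrable_marginal mid (integrable_normal_norm (sigma_gt0 j0))).
have ifg : P.-integrable setT (EFin \o (fun w => f (g j0 w))).
  exact: (integrable_marginal mf intf).
have C1 : `|I1 - \int[P]_(w in cyl B) F (x + f (g j0 w) *: u j0 + Z js w)| <=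
    C * l1norm (u j0) * (e / c).
  have -> : I1 = \int[P]_(w in cyl B) F (x + g j0 w *: u j0 + Z js w).
    by apply: eq_Rintegral => w _; rewrite /Z big_cons addrA.
  have i1 := integrable_gaussian_vector x (u j0) js mcB lF (mg j0) ig0.
  have i2 := integrable_gaussian_vector x (u j0) js mcB lF mfg ifg.
  rewrite -RintegralB//; have iB := integrableB mcB i1 i2.
  rewrite (le_trans (le_normr_Rintegral mcB iB))//.
  have iZ := integrableZl measurableT (C * l1norm (u j0)) idfP.
  apply: (@le_trans _ _ (\int[P]_(w in cyl B) (C * l1norm (u j0) * `|g j0 w - f (g j0 w)|))).
    apply: le_Rintegral => //; first exact: (integrable_norm iB).
      exact: integrableS iZ.
    move=> w _; rewrite (le_trans (FC _ _))// opprD addrACA subrr addr0 opprD addrACA subrr add0r.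
    by rewrite -scalerBl l1normZ mulrAC -mulrA.
  rewrite RintegralZl//; last exact: integrableS idfP.
  rewrite ler_wpM2l ?mulr_ge0 ?l1norm_ge0// (le_trans _ fe)// -idfE.
  rewrite /Rintegral fine_le//.
  - by apply: integrable_fin_num => //; exact: integrableS idfP.
  - exact: integrable_fin_num.
  - apply: ge0_subset_integral => //.
    by apply/measurable_EFinP; exact: (measurableT_comp mdf (mg j0)).
have C2 : `|I2 - \int[nu]_t Phi (x + f t *: u j0)| <= D * l1norm (u j0) * (e / c).
  have i1 : nu.-integrable setT (EFin \o (fun t => Phi (x + t *: u j0))).
    exact: integrable_normal_line.
  have mPhi : measurable_fun setT (fun t => Phi (x + f t *: u j0)).
    exact: (measurableT_comp (measurable_line (u j0) x lPhi) mf).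
  have iZ := integrableZl measurableT (D * l1norm (u j0)) idf.
  have dB t : `|Phi (x + t *: u j0) - Phi (x + f t *: u j0)| <= D * l1norm (u j0) * `|t - f t|.
    exact: lip_shift.
  have iB : nu.-integrable setT (EFin \o (fun t => Phi (x + t *: u j0) - Phi (x + f t *: u j0))).
    apply: le_integrable iZ => //.
      apply/measurable_EFinP; apply: measurable_funB => //.
      exact: measurable_line.
    move=> t _; rewrite lee_fin (le_trans (dB t))//=.
    by rewrite [leRHS]ger0_norm// mulr_ge0// mulr_ge0// l1norm_ge0.
  have i2 : nu.-integrable setT (EFin \o (fun t => Phi (x + f t *: u j0))).
    apply: eq_integrable (integrableB measurableT i1 iB) => // t _.
    by rewrite /= -EFinB opprB addrC subrK.
  rewrite -RintegralB// (le_trans (le_normr_Rintegral measurableT iB))//.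
  apply: (@le_trans _ _ (\int[nu]_t (D * l1norm (u j0) * `|t - f t|))).
    apply: le_Rintegral => //; exact: (integrable_norm iB).
  by rewrite RintegralZl// ler_wpM2l// mulr_ge0// l1norm_ge0.
rewrite stepE in C1; set I3 := Rintegral nu _ _ in C1 C2.
have -> : I1 - I2 * pB = (I1 - I3 * pB) + (I3 - I2) * pB by ring.
rewrite (le_trans (ler_normD _ _))// normrM (ger0_norm pB0) (distrC I3).
have C2' : `|I2 - I3| * pB <= D * l1norm (u j0) * (e / c).
  by apply: le_trans C2; rewrite ler_piMr.
rewrite (le_trans (lerD C1 C2'))// -!mulrDl mulrCA ger_pMr// ler_pdivrMr// mul1r.
by rewrite /c lerDl.
Qed.

Theorem gaussian_law (F : V -> R) x : lip F ->
  \int[P]_w F (x + \sum_j g j w *: u j) =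
  gmeans [seq sigma j *: u j | j <- index_enum J] F x.
Proof.
move=> lF; have := @gaussian_law_cyl (index_enum J) (fun=> setT) F x
  (index_enum_uniq J) (fun=> measurableT) (fun _ _ => erefl) lF.
have -> : cyl (fun=> setT) = setT by apply/seteqP; split.
by rewrite probability_setT mulr1.
Qed.

Lemma integrable_gaussian_law (F : V -> R) x : lip F ->
  P.-integrable setT (EFin \o (fun w => F (x + \sum_j g j w *: u j))).
Proof.
move=> lF; have ic : P.-integrable setT (EFin \o (fun _ : T => 0 : R)).
  exact: finite_measure_integrable_cst.
apply: eq_integrable (@integrable_gaussian_vector setT F (fun=> 0) x 0 (index_enum J)
  measurableT lF (@measurable_cst _ _ _ _ setT (0 : R)) ic) => // w _.
by rewrite /= scale0r addr0.
Qed.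

End GaussianLaw.

(** * Operator norm of a real Gaussian matrix *)

(** One representative is taken in each nonempty cell of a grid of mesh e, so the net lies in [A]
    itself and can consist of unit vectors. The default 0 in [rep] concerns only empty cells, which
    are filtered out. *)
Lemma finite_net (R : realType) (K : finType) (A : set {ffun K -> R}) (B e : R) :
  0 < e -> (forall x, A x -> forall k, `|x k| <= B) ->
  exists s : seq {ffun K -> R}, (forall y, y \in s -> A y) /\
    forall x, A x -> exists2 y, y \in s & forall k, `|x k - y k| <= e.
Proof.
move=> e0 AB.
pose m := Num.truncn (2 * B / e).
pose cell (x : {ffun K -> R}) : {ffun K -> 'I_m.+1} :=
  [ffun k => inord (Num.truncn ((x k + B) / e))].
pose rep c : {ffun K -> R} := xget 0 [set x | A x /\ cell x = c].
pose s := [seq rep c | c <- enum {: {ffun K -> 'I_m.+1}} & `[< exists x, A x /\ cell x = c >]].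
have repP c x : A x -> cell x = c -> A (rep c) /\ cell (rep c) = c.
  by move=> Ax cx; exact: (@xgetPex _ 0 [set x | A x /\ cell x = c] (ex_intro _ x (conj Ax cx))).
exists s; split.
  move=> y /mapP[c]; rewrite mem_filter => /andP[/asboolP[x [Ax cx]] _] ->.
  by have [] := repP c x Ax cx.
move=> x Ax; exists (rep (cell x)).
  apply/mapP; exists (cell x) => //; rewrite mem_filter mem_enum andbT.
  by apply/asboolP; exists x.
move=> k; have [Ay cy] := repP _ x Ax erefl; set y := rep _ in Ay cy *.
have range z : A z -> 0 <= (z k + B) / e /\ (Num.truncn ((z k + B) / e) < m.+1)%N.
  move=> Az; have := AB z Az k; rewrite ler_norml => /andP[z1 z2].
  have z0 : 0 <= (z k + B) / e by rewrite divr_ge0 ?(ltW e0)//; lra.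
  split => //; rewrite ltnS; apply: le_truncn.
  by rewrite ler_pM2r ?invr_gt0//; lra.
have [x0 xm] := range x Ax; have [y0 ym] := range y Ay.
have : Num.truncn ((y k + B) / e) = Num.truncn ((x k + B) / e).
  have /ffunP/(_ k) := cy; rewrite !ffunE => /(congr1 val) /=.
  by rewrite !inordK.
move=> Ek; have := truncn_itv x0; have := truncn_itv y0; rewrite Ek.
set n := Num.truncn _; rewrite -natr1 => /andP[a1 a2] /andP[b1 b2].
rewrite ler_pdivlMr// in a1; rewrite ltr_pdivrMr// in a2.
rewrite ler_pdivlMr// in b1; rewrite ltr_pdivrMr// in b2.
by rewrite ler_norml; apply/andP; split; nra.
Qed.

Section EuclideanNorm.
Context {R : realType} {K : finType}.
Variable S : pred K.
Local Notation V := {ffun K -> R}.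
Implicit Types (x y : V) (c : R).

Definition sumsq x : R := \sum_(k | S k) x k ^+ 2.

Lemma sumsq_ge0 x : 0 <= sumsq x.
Proof. by apply: sumr_ge0 => k _; exact: sqr_ge0. Qed.

Lemma lip_sqrt_sumsq c : 0 <= c -> lip (fun x => Num.sqrt (c + sumsq x)).
Proof.
move=> c0; exists 1.
have H x y : Num.sqrt (c + sumsq x) - Num.sqrt (c + sumsq y) <= l1norm (x - y).
  set p := Num.sqrt _; set q := Num.sqrt _.
  have p0 : 0 <= p by exact: sqrtr_ge0.
  have q0 : 0 <= q by exact: sqrtr_ge0.
  have [pq0|pq] := leP (p + q) 0.
    by apply: le_trans (l1norm_ge0 _); lra.
  rewrite -(ler_pM2r pq) -subr_sqr !sqr_sqrtr ?addr_ge0 ?sumsq_ge0//.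
  rewrite opprD addrACA subrr add0r -sumrB.
  have bd (z : V) k : S k -> `|z k| <= Num.sqrt (c + sumsq z).
    move=> Sk; rewrite -sqrtr_sqr ler_sqrt; last by rewrite addr_ge0 ?sumsq_ge0.
    rewrite /sumsq (bigD1 k)//= addrCA lerDl addr_ge0// sumr_ge0// => l _.
    exact: sqr_ge0.
  apply: (@le_trans _ _ (\sum_(k | S k) `|x k - y k| * (p + q))).
    apply: ler_sum => k Sk; rewrite subr_sqr (le_trans (ler_norm _))// normrM.
    by rewrite ler_wpM2l// (le_trans (ler_normD _ _))// lerD// bd.
  rewrite -mulr_suml ler_wpM2r ?(ltW pq)// /l1norm.
  under [leRHS]eq_bigr do rewrite !ffunE.
  rewrite [leRHS](bigID S)/= lerDl sumr_ge0//.
move=> x y; rewrite mul1r ler_norml H andbT lerNl opprB.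
by rewrite -l1normN opprB; exact: H.
Qed.

Definition unitv (k : K) : V := [ffun l => (l == k)%:R].

Lemma sumsq_line x k (t : R) : sumsq (x + t *: unitv k) =
  sumsq x + (S k)%:R * (2 * x k * t + t ^+ 2).
Proof.
rewrite /sumsq; have [Sk|Sk] := boolP (S k); last first.
  rewrite mul0r addr0; apply: eq_bigr => l Sl; rewrite !ffunE.
  by case: eqP => [lk|_]; [rewrite -lk Sl in Sk|rewrite scaler0 addr0].
rewrite mul1r (bigD1 k)//= [in RHS](bigD1 k)//= !ffunE eqxx.
rewrite [X in _ + X](eq_bigr (fun l => x l ^+ 2)); last first.
  by move=> l /andP[_ /negbTE lk]; rewrite !ffunE lk scaler0 addr0.
by rewrite /GRing.scale /= mulr1; ring.
Qed.

(** Jensen's inequality, one coordinate at a time: sqrt y <= (y + b^2) / (2 b) with b = sqrt (q +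
    1), the tangent at the expected value of y when the variance is 1. The offset c carries the
    coordinates already averaged. *)
Lemma gmeans_sqrt_sumsq (s : seq K) c x : 0 <= c ->
  gmeans [seq unitv k | k <- s] (fun y => Num.sqrt (c + sumsq y)) x <=
  Num.sqrt (c + sumsq x + (count S s)%:R).
Proof.
move=> c0; elim: s x => [|k s IH] x; first by rewrite /= addr0.
rewrite [leLHS]/=.
have c1 : 0 <= c + (count S s)%:R by rewrite addr_ge0.
have l0 := lip_sqrt_sumsq c0; have l1 := lip_sqrt_sumsq c1.
apply: (@le_trans _ _ (gmean (unitv k) (fun y => Num.sqrt (c + (count S s)%:R + sumsq y)) x)).
  apply: gmean_le => //; first exact: gmeans_lip.
  by move=> y; rewrite addrAC; exact: IH.
have [Sk|Sk] := boolP (S k); last first.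
  rewrite (_ : count S (k :: s) = count S s); last by rewrite /= (negbTE Sk).
  rewrite gmeanE.
  under eq_Rintegral do rewrite sumsq_line (negbTE Sk) mul0r addr0.
  by rewrite Rintegral_normal_cst addrAC.
rewrite (_ : count S (k :: s) = (count S s).+1); last by rewrite /= Sk.
set q := c + (count S s)%:R + sumsq x.
have q0 : 0 <= q by rewrite addr_ge0// sumsq_ge0.
have -> : c + sumsq x + (count S s).+1%:R = q + 1.
  by rewrite /q -natr1; ring.
set b := Num.sqrt (q + 1).
have b0 : 0 < b by rewrite sqrtr_gt0 ltr_wpDl.
have b2 : b ^+ 2 = q + 1 by rewrite sqr_sqrtr// addr_ge0.
apply: (@le_trans _ _ (((q + b ^+ 2) / (2 * b)) + ((2 * b)^-1) * kappa2 + 0 * kappa3)).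
  rewrite -(Rintegral_normal_cubic ((q + b ^+ 2) / (2 * b)) (2 * x k / (2 * b)) ((2 * b)^-1) 0).
  apply: gmean_ub => //; first exact: integrable_normal_cubic.
  move=> t; rewrite sumsq_line Sk mul1r mul0r addr0.
  set y := _ + _; set z := Num.sqrt y.
  have y0 : 0 <= y.
    have E := sumsq_line x k t; rewrite Sk mul1r in E.
    by rewrite /y -E addr_ge0// sumsq_ge0.
  have z2 : z ^+ 2 = y by rewrite sqr_sqrtr.
  have -> : (q + b ^+ 2) / (2 * b) + 2 * x k / (2 * b) * t + (2 * b)^-1 * t ^+ 2 =
     (y + b ^+ 2) / (2 * b).
    by rewrite /y /q; field; rewrite gt_eqF.
  rewrite ler_pdivlMr ?mulr_gt0// -z2; have := sqr_ge0 (z - b); nra.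
rewrite mul0r addr0 [_^-1 * _]mulrC -mulrDl ler_pdivrMr ?mulr_gt0//.
by have := @integral_normal_sqr_le1 R; rewrite -/kappa2; nra.
Qed.

End EuclideanNorm.

(** * Lower deviations of the Gaussian norm *)

Section GaussianNorm.
Context {R : realType} {K : finType}.
Variable S : pred K.
Local Notation V := {ffun K -> R}.
Local Notation gamma := (@normal_prob R 0 1).
Implicit Types (x y : V) (l : R).

Lemma exp_sqr_lipschitz l (a b : R) : 0 <= l -> 0 <= a -> 0 <= b ->
  `|expR (- (l * a ^+ 2)) - expR (- (l * b ^+ 2))| <= (1 + 2 * l) * `|a - b|.
Proof.
move=> l0; wlog ab : a b / a <= b => [H|] a0 b0.
  have [ab|/ltW ba] := leP a b; first exact: H.
  by rewrite [leLHS]distrC [`|a - b|]distrC => *; exact: H.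
have ab2 : a ^+ 2 <= b ^+ 2 by rewrite ler_sqr.
rewrite [leLHS]ger0_norm; last by rewrite subr_ge0 ler_expR lerN2 ler_wpM2l.
rewrite distrC ger0_norm ?subr_ge0//.
set f := expR (- (l * a ^+ 2)).
have f0 : 0 <= f by exact: expR_ge0.
have f1 : f <= 1 by rewrite expR_le1 oppr_le0 mulr_ge0 ?sqr_ge0.
have [ba1|ba1] := leP (b - a) 1; last first.
  apply: (@le_trans _ _ 1); last by nra.
  by rewrite lerBlDr (le_trans f1)// lerDl expR_ge0.
have zf : l * a ^+ 2 * f <= 1.
  rewrite /f expRN ler_pdivrMr ?expR_gt0// mul1r.
  by rewrite (le_trans _ (expR_ge1Dx _))// lerDr.
have -> : expR (- (l * b ^+ 2)) = f * expR (- (l * (b ^+ 2 - a ^+ 2))).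
  by rewrite /f -expRD; congr expR; ring.
have E := expR_ge1Dx (- (l * (b ^+ 2 - a ^+ 2))).
have H1 : f * (1 - l * (b ^+ 2 - a ^+ 2)) <= f * expR (- (l * (b ^+ 2 - a ^+ 2))).
  by rewrite ler_wpM2l.
apply: (@le_trans _ _ (f * (l * (b ^+ 2 - a ^+ 2)))); first by nra.
have -> : f * (l * (b ^+ 2 - a ^+ 2)) = (f * l * (b + a)) * (b - a) by ring.
rewrite ler_wpM2r ?subr_ge0//.
have lf : l * f <= l by rewrite ler_piMr.
(* Since b <= a + 1, b + a <= 2 a + 1 <= a^2 + 2; then f l a^2 <= 1, an instance of z exp (- z) <=
   1, and f <= 1 give the slope 1 + 2 l. *)
have : f * l * (b + a) <= f * l * (a ^+ 2 + 2).
  by rewrite ler_wpM2l ?mulr_ge0//; have := sqr_ge0 (a - 1); nra.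
nra.
Qed.

Definition exp_sumsq l x : R := expR (- (l * sumsq S x)).

Lemma lip_exp_sumsq l : 0 <= l -> lip (exp_sumsq l).
Proof.
move=> l0; have /lipP[C C0 HC] := lip_sqrt_sumsq S (lexx (0 : R)).
exists ((1 + 2 * l) * C) => x y.
have E z : exp_sumsq l z = expR (- (l * Num.sqrt (0 + sumsq S z) ^+ 2)).
  by rewrite add0r sqr_sqrtr// sumsq_ge0.
rewrite !E (le_trans (exp_sqr_lipschitz l0 _ _))//.
by rewrite -mulrA ler_wpM2l// addr_ge0// mulr_ge0.
Qed.

(** The coordinates in [s] are distinct and start at 0, so the Laplace transform factorises, with
    one factor (1 + 2 l)^{-1/2} for each coordinate selected by [S]. *)
Lemma gmeans_exp_sumsq l (s : seq K) x : 0 <= l -> uniq s ->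
  (forall k, k \in s -> x k = 0) ->
  gmeans [seq unitv k | k <- s] (exp_sumsq l) x =
  (Num.sqrt (1 + 2 * l))^-1 ^+ count S s * exp_sumsq l x.
Proof.
move=> l0; elim: s x => [|k s IH] x; first by rewrite mul1r.
rewrite cons_uniq => /andP[ks us] xs.
set r := (Num.sqrt (1 + 2 * l))^-1.
have pl : 0 < 1 + 2 * l by rewrite ltr_wpDr// mulr_ge0.
have r0 : 0 < r by rewrite invr_gt0 sqrtr_gt0.
have r2 : (r ^+ 2)^-1 = 1 + 2 * l by rewrite exprVn invrK sqr_sqrtr// ltW.
have xk : x k = 0 by apply: xs; rewrite mem_head.
rewrite [LHS]/= gmeanE.
transitivity (\int[gamma]_t (r ^+ count S s * exp_sumsq l x *
    expR (- (l * ((S k)%:R * t ^+ 2))))).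
  apply: eq_Rintegral => t _; rewrite IH//; last first.
    move=> j js; rewrite !ffunE; have [jk|_] := eqVneq j k.
      by rewrite -jk js in ks.
    by rewrite scaler0 addr0 xs// in_cons js orbT.
  rewrite -mulrA; congr (_ * _); rewrite /exp_sumsq -expRD; congr expR.
  by rewrite sumsq_line xk; ring.
rewrite [count S (k :: s)]/=; case: (S k) => /=; last first.
  under eq_Rintegral do rewrite mul0r mulr0 oppr0 expR0 mulr1.
  exact: Rintegral_normal_cst.
under eq_Rintegral do rewrite mul1r.
have E t : expR (- (l * t ^+ 2)) = expR ((1 - (r ^+ 2)^-1) / 2 * t ^+ 2).
  by congr expR; rewrite r2; field.
under eq_Rintegral do rewrite E.
rewrite RintegralZl//; last exact: integrable_normal_exp_sqr.
have -> : \int[gamma]_t expR ((1 - (r ^+ 2)^-1) / 2 * t ^+ 2) = r.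
  by rewrite /Rintegral integral_normal_exp_sqr.
by rewrite exprD expr1; ring.
Qed.

Let M := #|S|.
Let rM : R := Num.sqrt M%:R.

(* [max (rM, |g|) = |g| + (rM - |g|)_+], and the lower deviation of [|g|] is
   bounded by an exponential moment of [- |g|^2]. *)
Lemma gmeans_max_norm : (0 < M)%N ->
  gmeans [seq unitv k | k <- index_enum K]
    (fun x => Num.max rM (Num.sqrt (0 + sumsq S x))) 0 <= rM + 2.
Proof.
move=> M0; have q0 : 0 < rM by rewrite sqrtr_gt0 ltr0n.
have q2 : rM ^+ 2 = M%:R by rewrite sqr_sqrtr.
pose l := (2 * rM)^-1; have l0 : 0 <= l by rewrite invr_ge0 mulr_ge0 ?ltW.
have cM : count S (index_enum K) = M by rewrite /M cardE size_filter; congr count.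
have lN := lip_sqrt_sumsq S (lexx (0 : R)).
(* With p the norm of x, c times the exponential is 2 exp (z - 1) for z = l (rM^2 - p^2). It is at
   least 2 z, and 2 z >= rM - p by the choice l = 1 / (2 rM). *)
pose c := 2 * expR (rM / 2 - 1).
have ptw x : Num.max rM (Num.sqrt (0 + sumsq S x)) <=
    Num.sqrt (0 + sumsq S x) + c * exp_sumsq l x.
  have e0 : 0 <= c * exp_sumsq l x by rewrite !mulr_ge0// expR_ge0.
  rewrite ge_max lerDl e0 andbT -lerBlDl.
  rewrite add0r; set p := Num.sqrt _; have p0 : 0 <= p by exact: sqrtr_ge0.
  have p2 : p ^+ 2 = sumsq S x by rewrite sqr_sqrtr ?sumsq_ge0.
  have [pq|qp] := leP rM p; first by apply: le_trans e0; rewrite subr_le0.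
  have H := expR_ge1Dx (l * (rM ^+ 2 - p ^+ 2) - 1).
  have cE : c * exp_sumsq l x = 2 * expR (l * (rM ^+ 2 - p ^+ 2) - 1).
    rewrite /c /exp_sumsq -mulrA -expRD; congr (_ * expR _).
    by rewrite -p2 /l; field; rewrite gt_eqF.
  rewrite cE; have lE : l * (rM ^+ 2 - p ^+ 2) = (rM - p) * (rM + p) / (2 * rM).
    by rewrite /l; ring.
  have : (rM - p) / 2 <= (rM - p) * (rM + p) / (2 * rM).
    rewrite ler_pdivlMr ?mulr_gt0//; have : 0 <= (rM - p) * p by rewrite mulr_ge0// subr_ge0 ltW.
    by lra.
  by rewrite -lE; lra.
apply: (@le_trans _ _ (gmeans [seq unitv k | k <- index_enum K]
    (fun x => Num.sqrt (0 + sumsq S x) + c * exp_sumsq l x) 0)).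
  apply: gmeans_le => //.
  - by apply: lip_max => //; exact: lip_cst.
  - by apply: lipD => //; apply: lipZ; exact: lip_exp_sumsq.
rewrite gmeansDZ//; last exact: lip_exp_sumsq.
have z0 : sumsq S 0 = 0 :> R.
  by apply: big1 => k _; rewrite ffunE expr0n.
apply: lerD.
  by have := gmeans_sqrt_sumsq S (index_enum K) 0 (lexx (0 : R)); rewrite z0 !add0r cM.
rewrite gmeans_exp_sumsq ?index_enum_uniq//; last by move=> k _; rewrite ffunE.
rewrite /exp_sumsq z0 mulr0 oppr0 expR0 mulr1 cM.
have pl : 0 < 1 + 2 * l by rewrite ltr_wpDr// mulr_ge0.
set r := (Num.sqrt (1 + 2 * l))^-1.
have r0 : 0 < r by rewrite invr_gt0 sqrtr_gt0.
have r2 : r ^+ 2 = 1 - (rM + 1)^-1.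
  rewrite exprVn sqr_sqrtr ?ltW// /l; field.
  by rewrite !gt_eqF// ?addr_gt0// ltr_wpDr// ltW.
have rle : r <= expR (- (2 * (rM + 1))^-1).
  rewrite -(@ler_pXn2r _ 2%N)// ?nnegrE ?expR_ge0 ?(ltW r0)//.
  rewrite r2 -expRM_natl (le_trans (expR_ge1Dx _))// ler_expR le_eqVlt.
  by apply/orP; left; apply/eqP; field; rewrite gt_eqF// addr_gt0.
(* This cancels the exponential in c and leaves exactly the additive 2. It rests on rM^2 / (rM + 1)
   >= rM - 2. *)
have : r ^+ M <= expR (1 - rM / 2).
  apply: (@le_trans _ _ (expR (- (2 * (rM + 1))^-1) ^+ M)).
    by rewrite lerXn2r// ?nnegrE ?expR_ge0 ?(ltW r0).
  rewrite -expRM_natl ler_expR -q2 mulrN lerNl opprB.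
  rewrite ler_pdivlMr ?mulr_gt0 ?addr_gt0//; nra.
move=> H; apply: (@le_trans _ _ (c * expR (1 - rM / 2))).
  by rewrite ler_wpM2l// mulr_ge0// expR_ge0.
rewrite /c -mulrA -expRD (_ : _ + _ = 0) ?expR0 ?mulr1//; by ring.
Qed.

End GaussianNorm.

Section LinearProcesses.
Context {R : realType} {I Q : finType}.
Implicit Types (c : I -> Q -> R) (W : {ffun Q -> R}).

Definition lin_process c W : {ffun I -> R} := [ffun i => \sum_q c i q * W q].

Definition std_basis : seq {ffun Q -> R} := [seq unitv q | q <- index_enum Q].

Lemma sum_unitv (c : Q -> R) q0 : \sum_q c q * unitv (R := R) q0 q = c q0.
Proof.
rewrite (bigD1 q0)//= ffunE eqxx mulr1 big1 ?addr0// => q /negbTE qq0.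
by rewrite ffunE qq0 mulr0.
Qed.

Lemma gmeans_lin_process c (F : {ffun I -> R} -> R) (x0 : {ffun I -> R}) :
  gmeans std_basis (fun W => F (x0 + lin_process c W)) 0 =
  gmeans [seq [ffun i => c i q] | q <- index_enum Q] F x0.
Proof.
have H (y w : {ffun Q -> R}) t : x0 + lin_process c (y + t *: w) =
    x0 + lin_process c y + t *: lin_process c w.
  rewrite -addrA; congr (_ + _); apply/ffunP => i; rewrite !ffunE.
  rewrite /GRing.scale /= mulr_sumr -big_split /=; apply: eq_bigr => q _.
  by rewrite !ffunE /GRing.scale /=; ring.
have := @gmeans_affine _ _ _ (fun W => x0 + lin_process c W) (lin_process c) std_basis F 0 H.
rewrite /comp => ->; rewrite -map_comp; congr (gmeans _ F _).
  by apply: eq_map => q /=; apply/ffunP => i; rewrite !ffunE sum_unitv.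
apply/ffunP => i; rewrite !ffunE big1 ?addr0// => q _.
by rewrite ffunE mulr0.
Qed.

Lemma lip_lin_process c (F : {ffun I -> R} -> R) x0 : lip F ->
  lip (fun W => F (x0 + lin_process c W)).
Proof.
move=> /lipP[C C0 HC]; exists (C * \sum_i \sum_q `|c i q|) => W W'.
rewrite (le_trans (HC _ _))// -mulrA ler_wpM2l//.
rewrite opprD addrACA subrr add0r mulr_suml; apply: ler_sum => i _.
rewrite !ffunE -sumrB (le_trans (ler_norm_sum _ _ _))// mulr_suml; apply: ler_sum => q _.
rewrite -mulrBr normrM ler_wpM2l//.
by have := ler_coord_l1norm (W - W') q; rewrite !ffunE.
Qed.

End LinearProcesses.

Arguments std_basis {R} Q.

Theorem sudakov_fernique_lin (R : realType) (I Q Q' : finType) (i0 : I)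
    (c : I -> Q -> R) (c' : I -> Q' -> R) (x0 : {ffun I -> R}) :
  (forall i j, \sum_q (c i q - c j q) ^+ 2 <= \sum_q (c' i q - c' j q) ^+ 2) ->
  gmeans (std_basis Q) (fun W => fmax i0 (x0 + lin_process c W)) 0 <=
  gmeans (std_basis Q') (fun W => fmax i0 (x0 + lin_process c' W)) 0.
Proof.
move=> H; rewrite (gmeans_lin_process c (fmax i0)) (gmeans_lin_process c' (fmax i0)).
apply: sudakov_fernique => i j; rewrite !big_map.
under eq_bigr do rewrite !ffunE.
by under [leRHS]eq_bigr do rewrite !ffunE.
Qed.

(** * Chevet's inequality *)

Section Chevet.
Context {R : realType} {A K : finType}.
Local Notation mat := {ffun A * K -> R}.
Local Notation V := {ffun A + K -> R}.
Implicit Types (W : mat) (x y : V).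

Let unit2 : set V := [set x | \sum_a x (inl a) ^+ 2 = 1 /\ \sum_k x (inr k) ^+ 2 = 1].

Let unit2_le1 x : unit2 x -> forall e, `|x e| <= 1.
Proof.
move=> [xa xk] e; rewrite -(@ler_pXn2r _ 2%N)// ?nnegrE// expr1n real_normK ?num_real//.
case: e => [a|k]; [rewrite -[leRHS]xa (bigD1 a)|rewrite -[leRHS]xk (bigD1 k)] => //=;
  by rewrite lerDl sumr_ge0// => *; exact: sqr_ge0.
Qed.

Let dot_le1 (B : finType) (x y : B -> R) : \sum_b x b ^+ 2 = 1 -> \sum_b y b ^+ 2 = 1 ->
  \sum_b x b * y b <= 1.
Proof.
move=> xx yy; have : 0 <= \sum_b (x b - y b) ^+ 2 by apply: sumr_ge0 => b _; exact: sqr_ge0.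
have -> : \sum_b (x b - y b) ^+ 2 = \sum_b x b ^+ 2 + \sum_b y b ^+ 2 - 2 * \sum_b x b * y b.
  by rewrite mulr_sumr -big_split -sumrB /=; apply: eq_bigr => b _; ring.
rewrite xx yy; lra.
Qed.

(** With u and v the inner products of the two pairs of unit vectors, the claim is 2 - 2 u v <= (2 -
    2 u) + (2 - 2 v), that is (1 - u) (1 - v) >= 0. *)
Let chevet_increment x y : unit2 x -> unit2 y ->
  \sum_(q : A * K) (x (inl q.1) * x (inr q.2) - y (inl q.1) * y (inr q.2)) ^+ 2 <=
  \sum_(e : A + K) (x e - y e) ^+ 2.
Proof.
move=> [xa xk] [ya yk]; rewrite big_sumType /=.
have sq (B : finType) (u v : B -> R) : \sum_b u b ^+ 2 = 1 -> \sum_b v b ^+ 2 = 1 ->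
    \sum_b (u b - v b) ^+ 2 = 2 - 2 * \sum_b u b * v b.
  move=> uu vv; transitivity (\sum_b u b ^+ 2 + \sum_b v b ^+ 2 - 2 * \sum_b u b * v b).
    by rewrite mulr_sumr -big_split -sumrB /=; apply: eq_bigr => b _; ring.
  by rewrite uu vv.
have prodE (u v : V) : \sum_(q : A * K) (u (inl q.1) * u (inr q.2)) * (v (inl q.1) * v (inr q.2)) =
    (\sum_a u (inl a) * v (inl a)) * (\sum_k u (inr k) * v (inr k)).
  rewrite -(pair_bigA _ (fun a k => (u (inl a) * u (inr k)) * (v (inl a) * v (inr k))))/=.
  rewrite mulr_suml; apply: eq_bigr => a _; rewrite mulr_sumr; apply: eq_bigr => k _.
  by ring.
have prod1 (u : V) : unit2 u -> \sum_(q : A * K) (u (inl q.1) * u (inr q.2)) ^+ 2 = 1.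
  move=> [ua uk]; under eq_bigr do rewrite expr2.
  by rewrite prodE; under eq_bigr do rewrite -expr2; rewrite ua mul1r;
    under eq_bigr do rewrite -expr2; rewrite uk.
rewrite (sq _ (fun q : A * K => x (inl q.1) * x (inr q.2))) ?prod1// prodE.
rewrite (sq _ (x \o inl) (y \o inl))// (sq _ (x \o inr) (y \o inr))//=.
have := dot_le1 xa ya; have := dot_le1 xk yk.
by set u := \sum_a _; set v := \sum_k _ => *; nra.
Qed.


Let count_inl : count (fun e : A + K => if e is inl _ then true else false) (index_enum (A + K)%type) = #|A|.
Proof.
rewrite -sum1_count big_sumType /= big_pred0_eq addn0 sum1_card.
by apply: eq_card.
Qed.

Let count_inr : count (fun e : A + K => if e is inr _ then true else false) (index_enum (A + K)%type) = #|K|.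
Proof.
rewrite -sum1_count big_sumType /= big_pred0_eq add0n sum1_card.
by apply: eq_card.
Qed.

(** The form <y, W v> on pairs of unit vectors is compared with <g, y> + <h, v> for independent
    Gaussian g and h. Only a finite net of pairs is used; the error 2 dl |W|_1 is added to [tau],
    which keeps the operator bound valid for every W and [tau] Lipschitz. The extra index [None]
    carries the constant sqrt #|A|, so [tau] never drops below it, at the price of the 2 in
    [gmeans_max_norm]. *)
Theorem chevet (e : R) : 0 < e -> (0 < #|A|)%N ->
  exists tau : mat -> R, [/\ lip tau, forall W, Num.sqrt #|A|%:R <= tau W,
    forall W (v : K -> R),
      \sum_a (\sum_k W (a, k) * v k) ^+ 2 <= tau W ^+ 2 * \sum_k v k ^+ 2 &
    gmeans (std_basis (A * K)%type) tau 0 <= Num.sqrt #|A|%:R + 2 + Num.sqrt #|K|%:R + e].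
Proof.
move=> e0 A0.
have ll : lip (@l1norm R (A * K)%type).
  exists 1.
  have H (x y : mat) : l1norm x - l1norm y <= l1norm (x - y).
    by rewrite lerBlDr (le_trans _ (ler_l1normD _ _))// subrK.
  move=> x y; rewrite mul1r ler_norml H andbT lerNl opprB.
  by rewrite -(l1normN (x - y)) opprB; exact: H.
pose m1 := gmeans (std_basis (A * K)%type) (@l1norm R _) 0.
(* Makes 2 dl times the mean l1 norm of W at most e. *)
pose dl := e / (2 * (`|m1| + 1)).
have n1 : 0 < 2 * (`|m1| + 1) by rewrite mulr_gt0// ltr_wpDl.
have dl0 : 0 < dl by rewrite divr_gt0.
have [s [sA sN]] := finite_net dl0 unit2_le1.
pose I := option 'I_(size s).
pose pt (p : 'I_(size s)) : V := s`_p.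
have ptA p : unit2 (pt p) by apply: sA; rewrite mem_nth.
pose rA : R := Num.sqrt #|A|%:R.
have rA0 : 0 <= rA by exact: sqrtr_ge0.
pose x0 : {ffun I -> R} := [ffun i => if i is None then rA else 0].
pose c (i : I) (q : A * K) : R := if i is Some p then pt p (inl q.1) * pt p (inr q.2) else 0.
pose c' (i : I) (u : A + K) : R := if i is Some p then pt p u else 0.
pose tau0 W := fmax None (x0 + lin_process c W).
pose tau W := tau0 W + (2 * dl) * l1norm W.
have lM := @fmax_lip R I None.
have ltau0 : lip tau0 by exact: lip_lin_process.
have tau0_ge W : rA <= tau0 W.
  have := fmax_ge None (x0 + lin_process c W) None.
  by rewrite !ffunE big1 ?addr0// => q _; rewrite mul0r.
have tau_ge W : tau0 W <= tau W.
  by rewrite lerDl mulr_ge0 ?l1norm_ge0// mulr_ge0// ltW.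
exists tau; split.
- by apply: lipD => //; exact: lipZ.
- by move=> W; exact: le_trans (tau0_ge W) (tau_ge W).
- move=> W v.
  pose nv := Num.sqrt (\sum_k v k ^+ 2).
  have v20 : 0 <= \sum_k v k ^+ 2 by apply: sumr_ge0 => k _; exact: sqr_ge0.
  have nv2 : nv ^+ 2 = \sum_k v k ^+ 2 by rewrite sqr_sqrtr.
  pose y a := \sum_k W (a, k) * v k.
  pose ny := Num.sqrt (\sum_a y a ^+ 2).
  have y20 : 0 <= \sum_a y a ^+ 2 by apply: sumr_ge0 => a _; exact: sqr_ge0.
  have ny2 : ny ^+ 2 = \sum_a y a ^+ 2 by rewrite sqr_sqrtr.
  rewrite -/(y _) -ny2 -nv2 -exprMn.
  have tW : 0 <= tau W by apply: le_trans (tau_ge W); exact: le_trans (tau0_ge W).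
  rewrite ler_sqr ?nnegrE ?mulr_ge0 ?sqrtr_ge0//.
  have [nv0|nvn0] := eqVneq nv 0.
    have vk k : v k = 0.
      have := nv2; rewrite nv0 expr0n /= => /esym/eqP.
      by rewrite psumr_eq0 => [/allP/(_ k (mem_index_enum k))/=|]; rewrite ?sqrf_eq0;
        [move/eqP|move=> *; exact: sqr_ge0].
    have -> : ny = 0.
      rewrite /ny big1 ?sqrtr0// => a _; rewrite /y big1 ?expr0n// => k _.
      by rewrite vk mulr0.
    by rewrite mulr_ge0// sqrtr_ge0.
  have nvp : 0 < nv by rewrite lt_def nvn0 sqrtr_ge0.
  have [ny0|nyn0] := eqVneq ny 0.
    by rewrite ny0 mulr_ge0// ltW.
  have nyp : 0 < ny by rewrite lt_def nyn0 sqrtr_ge0.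
  pose x : V := [ffun u => match u with inl a => y a / ny | inr k => v k / nv end].
  have xu : unit2 x.
    split.
      under eq_bigr do rewrite ffunE exprMn.
      by rewrite -mulr_suml -ny2 -exprMn divff// expr1n.
    under eq_bigr do rewrite ffunE exprMn.
    by rewrite -mulr_suml -nv2 -exprMn divff// expr1n.
  have [z zs xz] := sN x xu.
  have zi : (index z s < size s)%N by rewrite index_mem.
  have zE : pt (Ordinal zi) = z by rewrite /pt nth_index.
  have zu := sA z zs.
  have val : ny / nv = \sum_(q : A * K) (x (inl q.1) * x (inr q.2)) * W q.
    have -> : \sum_(q : A * K) (x (inl q.1) * x (inr q.2)) * W q =
        \sum_a \sum_k x (inl a) * x (inr k) * W (a, k).
      by rewrite pair_bigA; apply: eq_bigr => -[a k].
    have -> : ny / nv = \sum_a (y a / ny) * (y a / nv).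
      have -> : ny / nv = ny ^+ 2 / (ny * nv) by field; rewrite nyn0 nvn0.
      rewrite ny2 mulr_suml; apply: eq_bigr => a _; field; by rewrite nyn0 nvn0.
    apply: eq_bigr => a _; rewrite {2}/y mulr_suml mulr_sumr; apply: eq_bigr => k _.
    by rewrite !ffunE; ring.
  rewrite -ler_pdivrMr// val.
  apply: (@le_trans _ _ (\sum_(q : A * K) (z (inl q.1) * z (inr q.2)) * W q +
     (2 * dl) * l1norm W)).
    rewrite -lerBlDl -sumrB (le_trans (ler_norm _))// (le_trans (ler_norm_sum _ _ _))//.
    rewrite mulr_sumr; apply: ler_sum => q _; rewrite -mulrBl normrM ler_wpM2r//.
    have -> : x (inl q.1) * x (inr q.2) - z (inl q.1) * z (inr q.2) =
      (x (inl q.1) - z (inl q.1)) * x (inr q.2) + z (inl q.1) * (x (inr q.2) - z (inr q.2)).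
      by ring.
    rewrite (le_trans (ler_normD _ _))// (normrM (_ - _)) (normrM (z _)).
    have -> : 2 * dl = dl * 1 + 1 * dl by ring.
    by apply: lerD; apply: ler_pM => //; exact: unit2_le1.
  rewrite lerD2r.
  have := fmax_ge None (x0 + lin_process c W) (Some (Ordinal zi)).
  rewrite !ffunE add0r; apply: le_trans.
  by rewrite le_eqVlt; apply/orP; left; apply/eqP; apply: eq_bigr => q _; rewrite /c zE.
- rewrite (gmeansDZ _ _ _ ltau0 ll).
  apply: lerD; last first.
    apply: (@le_trans _ _ (2 * dl * (`|m1| + 1))).
      rewrite ler_wpM2l//; first by rewrite mulr_ge0// ltW.
      by rewrite (le_trans (ler_norm _))// lerDl.
    by rewrite /dl le_eqVlt; apply/orP; left; apply/eqP; field; rewrite gt_eqF// ltr_wpDl.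
  apply: (le_trans (@sudakov_fernique_lin R I _ _ None c c' x0 _)).
    move=> [p|] [q|]; rewrite /c /c' /=.
    - exact: chevet_increment.
    (* Against [None] an increment is a plain variance: 1 for a product of unit vectors, 2 for the
       comparison process. *)
    - have := chevet_increment (ptA p) (ptA p) => _.
      have [pa pk] := ptA p.
      under eq_bigr do rewrite subr0; under [leRHS]eq_bigr do rewrite subr0.
      rewrite big_sumType /= pa pk -(pair_bigA _ (fun a k => (pt p (inl a) * pt p (inr k)) ^+ 2))/=.
      under eq_bigr => a _ do (under eq_bigr do rewrite exprMn; rewrite -mulr_sumr pk mulr1).
      by rewrite pa lerDl.
    - have [pa pk] := ptA q.
      under eq_bigr do rewrite sub0r sqrrN; under [leRHS]eq_bigr do rewrite sub0r sqrrN.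
      rewrite big_sumType /= pa pk -(pair_bigA _ (fun a k => (pt q (inl a) * pt q (inr k)) ^+ 2))/=.
      under eq_bigr => a _ do (under eq_bigr do rewrite exprMn; rewrite -mulr_sumr pk mulr1).
      by rewrite pa lerDl.
    - by rewrite !big1// => *; rewrite subr0 expr0n.
  pose SA : pred (A + K)%type := fun u => if u is inl _ then true else false.
  pose SK : pred (A + K)%type := fun u => if u is inr _ then true else false.
  have lA : lip (fun x : V => Num.max rA (Num.sqrt (0 + sumsq SA x))).
    by apply: lip_max; [exact: lip_cst|exact: lip_sqrt_sumsq].
  have lK := lip_sqrt_sumsq SK (lexx (0 : R)).
  have lc' : lip (fun x : V => fmax None (x0 + lin_process c' x)) by exact: lip_lin_process.
  apply: (@le_trans _ _ (gmeans (std_basis (A + K)%type)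
    (fun x : V => Num.max rA (Num.sqrt (0 + sumsq SA x)) + 1 * Num.sqrt (0 + sumsq SK x)) 0)).
    apply: gmeans_le => //; first by apply: lipD => //; exact: lipZ.
    move=> x; apply: fmax_le => -[p|]; rewrite !ffunE /c'; last first.
      rewrite big1 ?addr0; last by move=> *; rewrite mul0r.
      by rewrite mul1r -[leLHS]addr0 lerD ?sqrtr_ge0// le_max lexx.
    rewrite add0r big_sumType /= mul1r; have [pa pk] := ptA p.
    have cs (B : finType) (a b : B -> R) : \sum_i a i ^+ 2 = 1 ->
        \sum_i a i * b i <= Num.sqrt (0 + \sum_i b i ^+ 2).
      move=> aa; rewrite add0r; have b0 : 0 <= \sum_i b i ^+ 2.
        by apply: sumr_ge0 => i _; exact: sqr_ge0.
      set q := Num.sqrt _; have q2 : q ^+ 2 = \sum_i b i ^+ 2 by rewrite sqr_sqrtr.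
      have q0 : 0 <= q by exact: sqrtr_ge0.
      have [qz|qn0] := eqVneq q 0.
        rewrite qz big1// => i _; suff -> : b i = 0 by rewrite mulr0.
        move: q2; rewrite qz expr0n /= => /esym/eqP.
        by rewrite psumr_eq0 => [/allP/(_ i (mem_index_enum i))/=|]; rewrite ?sqrf_eq0;
          [move/eqP|move=> *; exact: sqr_ge0].
      have : 0 <= \sum_i (q * a i - b i) ^+ 2 by apply: sumr_ge0 => i _; exact: sqr_ge0.
      have -> : \sum_i (q * a i - b i) ^+ 2 = q ^+ 2 * \sum_i a i ^+ 2 + \sum_i b i ^+ 2
          - 2 * q * \sum_i a i * b i.
        by rewrite !mulr_sumr -big_split -sumrB /=; apply: eq_bigr => i _; ring.
      have qp : 0 < q by rewrite lt_def qn0.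
      by rewrite aa -q2 => H; rewrite -(ler_pM2l qp); nra.
    have -> : sumsq SA x = \sum_a x (inl a) ^+ 2.
      by rewrite /sumsq big_sumType /= big_pred0_eq addr0.
    have -> : sumsq SK x = \sum_k x (inr k) ^+ 2.
      by rewrite /sumsq big_sumType /= big_pred0_eq add0r.
    apply: lerD; last exact: cs.
    by rewrite (le_trans (cs _ _ _ pa))// le_max lexx orbT.
  rewrite gmeansDZ// mul1r; apply: lerD.
    have := @gmeans_max_norm R _ SA; rewrite (_ : #|SA| = #|A|); first exact.
    by rewrite -count_inl cardE size_filter; congr count.
  have := gmeans_sqrt_sumsq SK (index_enum (A + K)%type) 0 (lexx (0 : R)).
  rewrite count_inr (_ : sumsq SK 0 = 0) ?add0r//.
  by apply: big1 => k _; rewrite ffunE expr0n.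
Qed.

End Chevet.

(** * The real inner product of complex matrices *)

Local Open Scope sesquilinear_scope.

Section RealInnerProduct.
Context {R : realType}.
Local Notation C := R[i].
Local Notation Re := complex.Re.
Local Notation Im := complex.Im.

Definition cdot (x y : C) : R := Re x * Re y + Im x * Im y.

Lemma Re_conjC (x : C) : Re (Num.conj x) = Re x. Proof. by case: x. Qed.
Lemma Im_conjC (x : C) : Im (Num.conj x) = - Im x. Proof. by case: x. Qed.
Lemma Re_add (x y : C) : Re (x + y) = Re x + Re y. Proof. by case: x; case: y. Qed.
Lemma Im_add (x y : C) : Im (x + y) = Im x + Im y. Proof. by case: x; case: y. Qed.
Lemma Re_mul (x y : C) : Re (x * y) = Re x * Re y - Im x * Im y.
Proof. by case: x; case: y. Qed.
Lemma Im_mul (x y : C) : Im (x * y) = Re x * Im y + Im x * Re y.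
Proof. by case: x => a b; case: y => c d /=; rewrite addrC. Qed.

Lemma cdotDl x y z : cdot (x + y) z = cdot x z + cdot y z.
Proof. by rewrite /cdot Re_add Im_add; ring. Qed.
Lemma cdotDr x y z : cdot x (y + z) = cdot x y + cdot x z.
Proof. by rewrite /cdot Re_add Im_add; ring. Qed.

Lemma cdot_suml (I : Type) (s : seq I) (P : pred I) (F : I -> C) y :
  cdot (\sum_(i <- s | P i) F i) y = \sum_(i <- s | P i) cdot (F i) y.
Proof.
elim/big_rec2: _ => [|i u v _ <-]; last by rewrite cdotDl.
by rewrite /cdot /= !mul0r addr0.
Qed.
Lemma cdot_sumr (I : Type) (s : seq I) (P : pred I) (F : I -> C) x :
  cdot x (\sum_(i <- s | P i) F i) = \sum_(i <- s | P i) cdot x (F i).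
Proof.
elim/big_rec2: _ => [|i u v _ <-]; last by rewrite cdotDr.
by rewrite /cdot /= !mulr0 addr0.
Qed.

Lemma cdotMl (a x y : C) : cdot (a * x) y = cdot x (Num.conj a * y).
Proof. by rewrite /cdot !(Re_mul, Im_mul) Re_conjC Im_conjC; ring. Qed.

(** This is Re Tr (U^* V), the Euclidean inner product of the real coordinates, suited to
    real-valued Gaussian processes. *)
Definition fdot m n (U V : 'M[C]_(m, n)) : R := \sum_i \sum_j cdot (U i j) (V i j).
Definition frob m n (U : 'M[C]_(m, n)) : R := fdot U U.

Section FDot.
Variables m n : nat.
Implicit Types (U V W : 'M[C]_(m, n)).

Lemma fdotC U V : fdot U V = fdot V U.
Proof. by apply: eq_bigr => i _; apply: eq_bigr => j _; rewrite /cdot; ring. Qed.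

Lemma fdotDl U V W : fdot (U + V) W = fdot U W + fdot V W.
Proof.
rewrite -big_split; apply: eq_bigr => i _; rewrite -big_split; apply: eq_bigr => j _.
by rewrite mxE cdotDl.
Qed.

Lemma fdotDr U V W : fdot U (V + W) = fdot U V + fdot U W.
Proof. by rewrite fdotC fdotDl !(fdotC _ U). Qed.

Lemma fdotZl (a : R) U V : fdot (a%:C%C *: U) V = a * fdot U V.
Proof.
rewrite mulr_sumr; apply: eq_bigr => i _; rewrite mulr_sumr; apply: eq_bigr => j _.
by rewrite mxE /cdot !(Re_mul, Im_mul) /=; ring.
Qed.

Lemma fdotZr (a : R) U V : fdot U (a%:C%C *: V) = a * fdot U V.
Proof. by rewrite fdotC fdotZl fdotC. Qed.

Lemma fdotNl U V : fdot (- U) V = - fdot U V.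
Proof.
rewrite -sumrN; apply: eq_bigr => i _; rewrite -sumrN; apply: eq_bigr => j _.
by rewrite mxE /cdot; case: (U i j) => a b /=; ring.
Qed.

Lemma fdotNr U V : fdot U (- V) = - fdot U V.
Proof. by rewrite fdotC fdotNl fdotC. Qed.

Lemma fdot0l V : fdot 0 V = 0.
Proof. by rewrite -[0]subr0 fdotDl fdotNl subrr. Qed.

Lemma fdot_suml (I : Type) (s : seq I) (P : pred I) (F : I -> 'M[C]_(m, n)) V :
  fdot (\sum_(i <- s | P i) F i) V = \sum_(i <- s | P i) fdot (F i) V.
Proof.
by elim/big_rec2: _ => [|i u v _ <-]; [rewrite fdot0l | rewrite fdotDl].
Qed.

Lemma fdot_sumr (I : Type) (s : seq I) (P : pred I) (F : I -> 'M[C]_(m, n)) V :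
  fdot V (\sum_(i <- s | P i) F i) = \sum_(i <- s | P i) fdot V (F i).
Proof. by rewrite fdotC fdot_suml; apply: eq_bigr => i _; rewrite fdotC. Qed.

Lemma frobE U : frob U = \sum_i \sum_j (Re (U i j) ^+ 2 + Im (U i j) ^+ 2).
Proof. by []. Qed.

Lemma frob_ge0 U : 0 <= frob U.
Proof.
by rewrite frobE; apply: sumr_ge0 => i _; apply: sumr_ge0 => j _; rewrite addr_ge0 ?sqr_ge0.
Qed.

Lemma frobD U V : frob (U + V) = frob U + frob V + 2 * fdot U V.
Proof. by rewrite /frob fdotDl !fdotDr (fdotC V U); ring. Qed.

Lemma frobN U : frob (- U) = frob U.
Proof. by rewrite /frob fdotNl fdotNr opprK. Qed.

Lemma frobB U V : frob (U - V) = frob U + frob V - 2 * fdot U V.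
Proof. by rewrite frobD frobN fdotNr mulrN. Qed.

Lemma frobZ (a : R) U : frob (a%:C%C *: U) = a ^+ 2 * frob U.
Proof. by rewrite /frob fdotZl fdotZr mulrA. Qed.

Lemma fdot_le U V : 2 * fdot U V <= frob U + frob V.
Proof. by have := frob_ge0 (U - V); rewrite frobB; lra. Qed.

Lemma frob_eq0 U : frob U = 0 -> U = 0.
Proof.
move=> /eqP; rewrite frobE psumr_eq0; last first.
  by move=> i _; apply: sumr_ge0 => j _; rewrite addr_ge0 ?sqr_ge0.
move=> /allP H; apply/matrixP => i j; rewrite mxE.
have := H i (mem_index_enum i); rewrite /= psumr_eq0; last first.
  by move=> k _; rewrite addr_ge0 ?sqr_ge0.
move=> /allP/(_ j (mem_index_enum j)) /=; rewrite paddr_eq0 ?sqr_ge0// !sqrf_eq0.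
by move=> /andP[/eqP a /eqP b]; apply/eqP; rewrite eq_complex a b !eqxx.
Qed.

Lemma fdot_CS U V : fdot U V <= Num.sqrt (frob U) * Num.sqrt (frob V).
Proof.
set p := Num.sqrt _; set q := Num.sqrt _.
have p2 : p ^+ 2 = frob U by rewrite sqr_sqrtr// frob_ge0.
have q2 : q ^+ 2 = frob V by rewrite sqr_sqrtr// frob_ge0.
have p0 : 0 <= p by exact: sqrtr_ge0.
have q0 : 0 <= q by exact: sqrtr_ge0.
have [pz|pn] := eqVneq p 0.
  have := frob_eq0; move: p2; rewrite pz expr0n /= => /esym p2 /(_ U p2) ->.
  by rewrite fdot0l mul0r.
have [qz|qn] := eqVneq q 0.
  have := frob_eq0; move: q2; rewrite qz expr0n /= => /esym q2 /(_ V q2) ->.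
  by rewrite fdotC fdot0l mulr0.
have pp : 0 < p by rewrite lt_def pn.
have qp : 0 < q by rewrite lt_def qn.
have := fdot_le (q%:C%C *: U) (p%:C%C *: V).
rewrite fdotZl fdotZr !frobZ -p2 -q2 => H.
have pq : 0 < p * q by rewrite mulr_gt0.
rewrite -(ler_pM2l pq); nra.
Qed.

End FDot.

Lemma fdot_mull m n p (A : 'M[C]_(m, n)) (U : 'M[C]_(n, p)) (V : 'M[C]_(m, p)) :
  fdot (A *m U) V = fdot U (A^t* *m V).
Proof.
rewrite /fdot.
transitivity (\sum_i \sum_j \sum_k cdot (U k j) (Num.conj (A i k) * V i j)).
  apply: eq_bigr => i _; apply: eq_bigr => j _; rewrite mxE cdot_suml.
  by apply: eq_bigr => k _; rewrite cdotMl.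
under [RHS]eq_bigr => k _ do under eq_bigr => j _ do rewrite mxE cdot_sumr.
rewrite exchange_big /=; under [RHS]eq_bigr => k _ do rewrite exchange_big /=.
rewrite [RHS]exchange_big /= exchange_big /=; apply: eq_bigr => i _.
rewrite exchange_big /=; apply: eq_bigr => k _; apply: eq_bigr => j _.
by rewrite !mxE.
Qed.

Lemma adjK m n (A : 'M[C]_(m, n)) : A ^t* ^t* = A.
Proof. exact: trmxCK. Qed.

Lemma adjM m n p (A : 'M[C]_(m, n)) (B : 'M[C]_(n, p)) : (A *m B) ^t* = B ^t* *m A ^t*.
Proof. by rewrite trmx_mul map_mxM. Qed.

Lemma adjD m n (A B : 'M[C]_(m, n)) : (A + B) ^t* = A ^t* + B ^t*.
Proof. by rewrite linearD /= map_mxD. Qed.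

Lemma fdot_adj m n (U V : 'M[C]_(m, n)) : fdot (U ^t*) (V ^t*) = fdot U V.
Proof.
rewrite /fdot exchange_big; apply: eq_bigr => i _; apply: eq_bigr => j _.
by rewrite !mxE /cdot !Re_conjC !Im_conjC mulrNN.
Qed.

Lemma frob_adj m n (U : 'M[C]_(m, n)) : frob (U ^t*) = frob U.
Proof. exact: fdot_adj. Qed.

Lemma fdot_mulr m n p (A : 'M[C]_(n, p)) (U : 'M[C]_(m, n)) (V : 'M[C]_(m, p)) :
  fdot (U *m A) V = fdot U (V *m A^t*).
Proof. by rewrite -fdot_adj adjM fdot_mull -[RHS]fdot_adj !adjM. Qed.


Lemma hermsymmxP m (A : 'M[C]_m) : reflect (A ^t* = A) (A \is hermsymmx).
Proof.
apply: (iffP (is_hermitianmxP _ _ _)); by rewrite expr0 scale1r => H; exact: esym.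
Qed.

(* With [A = E^* E], [Y = E X], [S^* S = X X^*] and [L = S E^*], the two
   processes to be compared have covariances [frob (Y Y'^* )] and
   [2 fdot (Y Y'^* ) (L^* L')]. *)
Section Increments.
Variables n m : nat.
Variables (Y Y' : 'M[C]_(n, m)) (L L' : 'M[C]_n).
Hypothesis LY : L ^t* *m L = Y *m Y ^t*.
Hypothesis LY' : L' ^t* *m L' = Y' *m Y' ^t*.

Lemma frob_gram (U : 'M[C]_(n, m)) : frob (U ^t* *m U) = frob (U *m U ^t*).
Proof. by rewrite /frob [LHS]fdot_mull [RHS]fdot_mulr !adjK mulmxA. Qed.

Lemma frob_comparison_process : frob (L *m Y) = frob (Y ^t* *m Y).
Proof. by rewrite frob_gram /frob [LHS]fdot_mull [RHS]fdot_mulr mulmxA LY adjK. Qed.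

End Increments.

(** With U = Y Y'^* and V = L^* L', expansion leaves 4 <U, V> <= 2 |U|^2 + |Y^* Y|^2 + |Y'^* Y'|^2.
    Here 2 <U, V> <= |U|^2 + |V|^2, and 2 |V|^2 = 2 <L L^*, L' L'^*> is bounded by the last two
    terms, the Gram matrices of L and Y having equal norms. *)
Lemma increment_le n m (Y Y' : 'M[C]_(n, m)) (L L' : 'M[C]_n) :
  L ^t* *m L = Y *m Y ^t* -> L' ^t* *m L' = Y' *m Y' ^t* ->
  frob (Y ^t* *m Y - Y' ^t* *m Y') <= 2 * frob (L *m Y - L' *m Y').
Proof.
move=> LY LY'; rewrite !frobB.
rewrite (frob_comparison_process LY) (frob_comparison_process LY').
have -> : fdot (Y ^t* *m Y) (Y' ^t* *m Y') = frob (Y *m Y' ^t*).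
  by rewrite /frob [LHS]fdot_mull [RHS]fdot_mulr !adjK mulmxA.
have -> : fdot (L *m Y) (L' *m Y') = fdot (Y *m Y' ^t*) (L ^t* *m L').
  by rewrite [LHS]fdot_mull [RHS]fdot_mulr adjK mulmxA.
have H1 := fdot_le (Y *m Y' ^t*) (L ^t* *m L').
have H2 : 2 * frob (L ^t* *m L') <= frob (Y ^t* *m Y) + frob (Y' ^t* *m Y').
  rewrite !frob_gram -LY -LY' !frob_gram.
  have -> : frob (L ^t* *m L') = fdot (L *m L ^t*) (L' *m L' ^t*).
    by rewrite fdotC /frob [LHS]fdot_mull [RHS]fdot_mulr !adjK mulmxA.
  exact: fdot_le.
lra.
Qed.

(** The case of opposite signs: their Ginibre families are independent, so the right side is a sum
    of variances without a cross term. *)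
Lemma increment_add_le n m (Y Y' : 'M[C]_(n, m)) (L L' : 'M[C]_n) :
  L ^t* *m L = Y *m Y ^t* -> L' ^t* *m L' = Y' *m Y' ^t* ->
  frob (Y ^t* *m Y + Y' ^t* *m Y') <= 2 * (frob (L *m Y) + frob (L' *m Y')).
Proof.
move=> LY LY'; rewrite (frob_comparison_process LY) (frob_comparison_process LY') frobD.
by have := fdot_le (Y ^t* *m Y) (Y' ^t* *m Y'); lra.
Qed.

End RealInnerProduct.

(** * Hermitian matrices and the operator norm *)

Section Spectral.
Context {R : realType}.
Local Notation C := R[i].
Local Notation Re := complex.Re.
Local Notation Im := complex.Im.

Lemma Re_sum (I : Type) (s : seq I) (P : pred I) (F : I -> C) :
  Re (\sum_(i <- s | P i) F i) = \sum_(i <- s | P i) Re (F i).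
Proof. by elim/big_rec2: _ => [//|i u v _ <-]; rewrite Re_add. Qed.

Lemma Im_sum (I : Type) (s : seq I) (P : pred I) (F : I -> C) :
  Im (\sum_(i <- s | P i) F i) = \sum_(i <- s | P i) Im (F i).
Proof. by elim/big_rec2: _ => [//|i u v _ <-]; rewrite Im_add. Qed.

Lemma hermitian_spectral m (B : 'M[C]_m) : B \is hermsymmx ->
  exists P (d : 'I_m -> R), [/\ P *m P ^t* = 1%:M, P ^t* *m P = 1%:M,
    B = P ^t* *m diag_mx (\row_i (d i)%:C%C) *m P & forall i, eigenvalue B (d i)%:C%C].
Proof.
move=> hB; pose P := spectralmx B; pose sp := spectral_diag B.
have uP := spectral_unitarymx B; have /unitarymxP PP := uP.
have P'P : P ^t* *m P = 1%:M by rewrite -invmx_unitary// mulVmx// unitarymx_unit.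
have BE : B = P ^t* *m diag_mx sp *m P.
  by have /orthomx_spectralP := hermitian_normalmx hB; rewrite invmx_unitary.
exists P, (fun i => Re (sp 0 i)).
have spE : (\row_i (Re (sp 0 i))%:C%C) = sp.
  apply/rowP => i; rewrite mxE; apply: RRe_real.
  exact: (mxOverP (hermitian_spectral_diag_real hB)).
split => //; first by rewrite spE.
move=> i; have -> : (Re (sp 0 i))%:C%C = sp 0 i by have /rowP/(_ i) := spE; rewrite mxE.
apply/eigenvalueP; exists (row i P).
  rewrite BE !mulmxA -row_mul PP row1.
  rewrite -rowE row_diag_mx -scalemxAl -rowE.
  by [].
apply/eqP => /(congr1 (fun v => v *m P ^t*)); rewrite mul0mx -row_mul PP row1.
by move=> /rowP/(_ i); rewrite !mxE !eqxx => /eqP; rewrite oner_eq0.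
Qed.

(** The factor 2 comes from bounding real and imaginary parts separately. The lemma serves only to
    bound the sets of eigenvalues and of image norms, so that their [sup] and [inf] are
    meaningful. *)
Lemma frob_mul m n p (A : 'M[C]_(m, n)) (B : 'M[C]_(n, p)) :
  frob (A *m B) <= 2 * (frob A * frob B).
Proof.
have cs (I : finType) (a b : I -> R) :
    (\sum_i a i * b i) ^+ 2 <= (\sum_i a i ^+ 2) * (\sum_i b i ^+ 2).
  set x := \sum_i _; set y := \sum_i a i ^+ 2; set z := \sum_i b i ^+ 2.
  have y0 : 0 <= y by apply: sumr_ge0 => i _; exact: sqr_ge0.
  have z0 : 0 <= z by apply: sumr_ge0 => i _; exact: sqr_ge0.
  have : 0 <= \sum_i (y * b i - x * a i) ^+ 2 by apply: sumr_ge0 => i _; exact: sqr_ge0.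
  have -> : \sum_i (y * b i - x * a i) ^+ 2 = y ^+ 2 * z + x ^+ 2 * y - 2 * y * x * x.
    rewrite [in RHS]/x [in RHS]/y [in RHS]/z -/x -/y -/z.
    rewrite (mulr_sumr _ _ _ (y ^+ 2)) (mulr_sumr _ _ _ (x ^+ 2)) (mulr_sumr _ _ _ (2 * y * x)).
    by rewrite -big_split -sumrB /=; apply: eq_bigr => i _; ring.
  have [yz|yn] := eqVneq y 0.
    move=> _; rewrite yz mul0r /x big1 ?expr0n// => i _.
    have /eqP : y = 0 by []; rewrite psumr_eq0; last by move=> *; exact: sqr_ge0.
    by move=> /allP/(_ i (mem_index_enum i))/=; rewrite sqrf_eq0 => /eqP ->; rewrite mul0r.
  have yp : 0 < y by rewrite lt_def yn.
  by move=> H; rewrite -(ler_pM2l yp); nra.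
have ent i j : Re ((A *m B) i j) ^+ 2 + Im ((A *m B) i j) ^+ 2 <=
    2 * ((\sum_k (Re (A i k) ^+ 2 + Im (A i k) ^+ 2)) *
         (\sum_k (Re (B k j) ^+ 2 + Im (B k j) ^+ 2))).
  pose a (s : 'I_n * bool) := if s.2 then Re (A i s.1) else Im (A i s.1).
  pose b (s : 'I_n * bool) := if s.2 then Re (B s.1 j) else - Im (B s.1 j).
  pose c (s : 'I_n * bool) := if s.2 then Im (B s.1 j) else Re (B s.1 j).
  have S (F : 'I_n * bool -> R) : \sum_s F s = \sum_k (F (k, true) + F (k, false)).
    transitivity (\sum_k \sum_e F (k, e)); first by rewrite pair_bigA; apply: eq_bigr => -[].
    by apply: eq_bigr => k _; rewrite big_bool.
  have aE : \sum_s a s ^+ 2 = \sum_k (Re (A i k) ^+ 2 + Im (A i k) ^+ 2) by rewrite S.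
  have bE : \sum_s b s ^+ 2 = \sum_k (Re (B k j) ^+ 2 + Im (B k j) ^+ 2).
    by rewrite S; apply: eq_bigr => k _; rewrite /b /= sqrrN.
  have cE : \sum_s c s ^+ 2 = \sum_k (Re (B k j) ^+ 2 + Im (B k j) ^+ 2).
    by rewrite S; apply: eq_bigr => k _; rewrite /c /= addrC.
  have ReE : Re ((A *m B) i j) = \sum_s a s * b s.
    rewrite S mxE Re_sum; apply: eq_bigr => k _.
    by rewrite Re_mul /a /b /= mulrN.
  have ImE : Im ((A *m B) i j) = \sum_s a s * c s.
    rewrite S mxE Im_sum; apply: eq_bigr => k _.
    by rewrite Im_mul /a /c /=.
  have H1 := cs _ a b; have H2 := cs _ a c.
  rewrite aE bE in H1; rewrite aE cE in H2; rewrite ReE ImE; lra.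
rewrite !frobE; apply: (@le_trans _ _ (\sum_i \sum_j
    2 * ((\sum_k (Re (A i k) ^+ 2 + Im (A i k) ^+ 2)) *
         (\sum_k (Re (B k j) ^+ 2 + Im (B k j) ^+ 2))))).
  by apply: ler_sum => i _; apply: ler_sum => j _; exact: ent.
rewrite le_eqVlt; apply/orP; left; apply/eqP.
rewrite mulr_suml mulr_sumr; apply: eq_bigr => i _.
by rewrite [in RHS]exchange_big !mulr_sumr.
Qed.

Lemma eigenvalue_bound m (B : 'M[C]_m) (x : R) : eigenvalue B x%:C%C ->
  `|x| <= 2 * frob B + 1.
Proof.
move=> /eigenvalueP[v vB v0].
have fv : 0 < frob v.
  by rewrite lt_def frob_ge0 andbT; apply: contra_neq v0 => /frob_eq0.
have := frob_mul v B; rewrite vB frobZ mulrCA mulrC => H.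
have xB : x ^+ 2 <= 2 * frob B by rewrite -(ler_pM2r fv); lra.
have : `|x| ^+ 2 <= 2 * frob B by rewrite real_normK ?num_real.
have := normr_ge0 x; have := sqr_ge0 (`|x| - 1); nra.
Qed.

Lemma lambda_max_ge m p (B : 'M[C]_m) (X : 'M[C]_(m, p)) : B \is hermsymmx ->
  lambda_min B * frob X <= fdot X (B *m X) <= lambda_max B * frob X.
Proof.
move=> hB; have [P [d [PP P'P BE ev]]] := hermitian_spectral hB.
have fP : frob (P *m X) = frob X.
  by rewrite /frob fdot_mull mulmxA P'P mul1mx.
have bd i : lambda_min B <= d i <= lambda_max B.
  apply/andP; split.
    apply: ge_inf; last exact: ev.
    exists (- (2 * frob B + 1)) => x /eigenvalue_bound.
    by rewrite ler_norml => /andP[].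
  apply: ub_le_sup; last exact: ev.
  exists (2 * frob B + 1) => x /eigenvalue_bound.
  by rewrite ler_norml => /andP[].
have E : fdot X (B *m X) =
    \sum_i \sum_j d i * (Re ((P *m X) i j) ^+ 2 + Im ((P *m X) i j) ^+ 2).
  rewrite {1}BE -!mulmxA -fdot_mull; apply: eq_bigr => i _; apply: eq_bigr => j _.
  by rewrite mul_diag_mx !mxE /cdot Re_mul Im_mul /=; ring.
rewrite -fP frobE !mulr_sumr E; apply/andP; split.
  apply: ler_sum => i _; rewrite mulr_sumr; apply: ler_sum => j _.
  by rewrite ler_wpM2r ?addr_ge0 ?sqr_ge0//; have /andP[] := bd i.
apply: ler_sum => i _; rewrite mulr_sumr; apply: ler_sum => j _.
by rewrite ler_wpM2r ?addr_ge0 ?sqr_ge0//; have /andP[] := bd i.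
Qed.

End Spectral.

(** * Square roots and the operator norm *)

Section OperatorNorm.
Context {R : realType}.
Local Notation C := R[i].
Local Notation Re := complex.Re.
Local Notation Im := complex.Im.

Lemma diag_real_adj m (d : 'I_m -> R) :
  (diag_mx (\row_i (d i)%:C%C)) ^t* = diag_mx (\row_i (d i)%:C%C).
Proof.
apply/matrixP => i j; rewrite !mxE eq_sym.
have [->|] := eqVneq i j; last by rewrite !mulr0n conjC0.
by rewrite !mulr1n; apply/CrealP; rewrite complex_real.
Qed.

Lemma diag_real_mul m (d e : 'I_m -> R) :
  diag_mx (\row_i (d i)%:C%C) *m diag_mx (\row_i (e i)%:C%C) =
  diag_mx (\row_i (d i * e i)%:C%C).
Proof.
rewrite mul_diag_mx; apply/matrixP => i j; rewrite !mxE.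
by case: eqVneq => _; rewrite ?mulr0n ?mulr0// !mulr1n rmorphM.
Qed.

Lemma diag_real_sandwich m (P B : 'M[C]_m) (d : 'I_m -> R) i :
  P *m P ^t* = 1%:M -> B = P ^t* *m diag_mx (\row_i (d i)%:C%C) *m P ->
  ((col i (P ^t*)) ^t* *m B *m col i (P ^t*)) 0 0 = (d i)%:C%C.
Proof.
move=> PP ->; rewrite colE adjM adjK.
rewrite -!mulmxA [P *m (P ^t* *m _)]mulmxA PP mul1mx [P *m (P ^t* *m _)]mulmxA PP mul1mx.
rewrite mul_diag_mx mxE (bigD1 i)//= big1 ?addr0; last first.
  by move=> j /negbTE ji; rewrite !mxE ji !mulr0.
by rewrite !mxE !eqxx /= conjC1 mul1r mulr1.
Qed.

Lemma col_mulmx m n p (A : 'M[C]_(m, n)) (B : 'M[C]_(n, p)) j :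
  col j (A *m B) = A *m col j B.
Proof. by rewrite !colE mulmxA. Qed.

Lemma psd_factor m (D : 'M[C]_m) : possemidefmx D -> exists S : 'M[C]_m, S ^t* *m S = D.
Proof.
move=> [hD psd]; have [P [d [PP P'P BE _]]] := hermitian_spectral hD.
have d0 i : 0 <= d i by rewrite -lecR -(diag_real_sandwich i PP BE); exact: psd.
exists (diag_mx (\row_i (Num.sqrt (d i))%:C%C) *m P).
rewrite adjM diag_real_adj -!mulmxA [diag_mx _ *m (_ *m _)]mulmxA diag_real_mul BE -!mulmxA.
congr (_ *m (diag_mx _ *m _)); apply/rowP => i; rewrite !mxE.
by rewrite -expr2 sqr_sqrtr.
Qed.

Lemma posdef_factor m (Z : 'M[C]_m) : posdefmx Z ->
  exists E F : 'M[C]_m, [/\ F *m E = 1%:M, E ^t* *m E = Z & invmx Z = F *m F ^t*].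
Proof.
move=> [hZ pd]; have [P [d [PP P'P BE _]]] := hermitian_spectral hZ.
have d0 i : 0 < d i.
  rewrite -ltcR -(diag_real_sandwich i PP BE); apply: pd; apply/eqP => c0.
  have : P *m col i (P ^t*) = 0 by rewrite c0 mulmx0.
  rewrite -col_mulmx PP => /colP/(_ i); rewrite !mxE eqxx => /eqP.
  by rewrite oner_eq0.
pose E := diag_mx (\row_i (Num.sqrt (d i))%:C%C) *m P.
pose F := P ^t* *m diag_mx (\row_i (Num.sqrt (d i))^-1%:C%C).
have FE : F *m E = 1%:M.
  rewrite /F /E -!mulmxA [diag_mx _ *m (_ *m _)]mulmxA diag_real_mul.
  have -> : diag_mx (\row_i ((Num.sqrt (d i))^-1 * Num.sqrt (d i))%:C%C) = 1%:M :> 'M[C]_m.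
    apply/matrixP => i j; rewrite !mxE mulVf//.
    by rewrite (gt_eqF _)// sqrtr_gt0.
  by rewrite mul1mx.
have EE : E ^t* *m E = Z.
  rewrite adjM diag_real_adj -!mulmxA [diag_mx _ *m (_ *m _)]mulmxA diag_real_mul BE -!mulmxA.
  congr (_ *m (diag_mx _ *m _)); apply/rowP => i; rewrite !mxE.
  by rewrite -expr2 sqr_sqrtr// ltW.
move: FE EE; clearbody E F => FE EE.
exists E, F; split => //.
have EF : E *m F = 1%:M by exact: mulmx1C.
have H : Z *m (F *m F ^t*) = 1%:M.
  by rewrite -EE -!mulmxA [E *m (F *m _)]mulmxA EF mul1mx -adjM FE trmx1 map_mx1.
have [uZ _] := mulmx1_unit H.
by rewrite -[RHS]mul1mx -(mulVmx uZ) -mulmxA H mulmx1.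
Qed.

Lemma l2norm_frob m (v : 'cV[C]_m) : l2norm v = Num.sqrt (frob v).
Proof.
rewrite /l2norm frobE; congr Num.sqrt; apply: eq_bigr => i _.
rewrite big_ord1; case: (v i 0) => a b /=.
by rewrite sqr_sqrtr// addr_ge0// sqr_ge0.
Qed.

Lemma l2norm_le1 m (v : 'cV[C]_m) : (l2norm v <= 1) = (frob v <= 1).
Proof. by rewrite l2norm_frob -{1}sqrtr1 ler_sqrt. Qed.

Lemma frob_mul_opnorm m (X : 'M[C]_m) (v : 'cV[C]_m) :
  frob v <= 1 -> Num.sqrt (frob (X *m v)) <= opnorm X.
Proof.
move=> v1; rewrite -l2norm_frob; apply: ub_le_sup; last by exists v; rewrite //= l2norm_le1.
exists (Num.sqrt (2 * frob X)) => _ [w /= w1 <-].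
rewrite l2norm_frob ler_sqrt ?mulr_ge0 ?frob_ge0//.
rewrite (le_trans (frob_mul _ _))// ler_wpM2l// ler_piMr ?frob_ge0//.
by rewrite -l2norm_le1.
Qed.

Lemma opnorm_ge0 m (X : 'M[C]_m) : 0 <= opnorm X.
Proof.
apply: le_trans (sqrtr_ge0 _) (@frob_mul_opnorm _ X 0 _).
by rewrite /frob fdot0l.
Qed.

Lemma opnorm_ge m (X : 'M[C]_m) (v : 'cV[C]_m) :
  Num.sqrt (frob (X *m v)) <= opnorm X * Num.sqrt (frob v).
Proof.
have [v0|v0] := eqVneq (frob v) 0.
  by rewrite (frob_eq0 v0) mulmx0 /frob fdot0l sqrtr0 mulr0.
have v1 : 0 < Num.sqrt (frob v) by rewrite sqrtr_gt0 lt_def v0 frob_ge0.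
rewrite -ler_pdivrMr//.
have := @frob_mul_opnorm _ X ((Num.sqrt (frob v))^-1%:C%C *: v).
rewrite -scalemxAr !frobZ exprVn sqr_sqrtr ?frob_ge0// mulVf// => /(_ (lexx _)).
by rewrite sqrtrM ?invr_ge0 ?frob_ge0// sqrtrV ?frob_ge0// mulrC.
Qed.

Lemma fdot_opnorm m (X : 'M[C]_m) (v w : 'cV[C]_m) :
  fdot w (X *m v) <= opnorm X * Num.sqrt (frob w) * Num.sqrt (frob v).
Proof.
rewrite (le_trans (fdot_CS _ _))// [opnorm X * _]mulrC -mulrA ler_wpM2l ?sqrtr_ge0//.
exact: opnorm_ge.
Qed.

Lemma fdot_opnorm_mx m p (B : 'M[C]_m) (X : 'M[C]_(m, p)) :
  fdot X (B *m X) <= opnorm B * frob X.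
Proof.
have colE (U V : 'M[C]_(m, p)) : fdot U V = \sum_j fdot (col j U) (col j V).
  rewrite /fdot exchange_big; apply: eq_bigr => j _; apply: eq_bigr => i _.
  by rewrite big_ord1 !mxE.
rewrite /frob !colE mulr_sumr; apply: ler_sum => j _.
rewrite col_mulmx (le_trans (fdot_opnorm _ _ _))//.
by rewrite -mulrA -expr2 sqr_sqrtr ?frob_ge0.
Qed.

(** Polarisation at v + w / s and v - w / s, with w = X v and s = |w|: for Hermitian X the two
    quadratic forms differ by 4 s, while the squared norms add up to 2 (|v|^2 + 1). *)
Lemma opnorm_herm_le m (X : 'M[C]_m) (c : R) : X \is hermsymmx -> 0 <= c ->
  (forall v : 'cV[C]_m, `|fdot v (X *m v)| <= c * frob v) -> opnorm X <= c.
Proof.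
move=> /hermsymmxP hX c0 H; apply: ge_sup.
  by exists 0, 0; rewrite /= ?mulmx0 l2norm_frob /frob fdot0l sqrtr0.
move=> _ [v /= v1 <-]; rewrite l2norm_le1 in v1; rewrite l2norm_frob.
set w := X *m v; set s := Num.sqrt (frob w).
have s2 : s ^+ 2 = frob w by rewrite sqr_sqrtr ?frob_ge0.
have [->//|s0] := eqVneq s 0.
have sp : 0 < s by rewrite lt_def s0 sqrtr_ge0.
have Hp := H (v + s^-1%:C%C *: w); have Hm := H (v - s^-1%:C%C *: w).
have sym : fdot v (X *m w) = frob w by rewrite fdotC fdot_mull hX.
have sv : s^-1 * s = 1 by rewrite mulVf.
have E : fdot (v + s^-1%:C%C *: w) (X *m (v + s^-1%:C%C *: w)) -
    fdot (v - s^-1%:C%C *: w) (X *m (v - s^-1%:C%C *: w)) = 4 * s.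
  rewrite !(mulmxDr, mulmxN) -!scalemxAr !(fdotDl, fdotDr, fdotNl, fdotNr, fdotZl, fdotZr).
  rewrite sym -/(frob w) -s2; transitivity (4 * (s^-1 * s) * s); first by ring.
  by rewrite sv mulr1.
have F : frob (v + s^-1%:C%C *: w) + frob (v - s^-1%:C%C *: w) = 2 * (frob v + 1).
  rewrite frobD frobB frobZ -s2 -exprMn sv expr1n; ring.
have : 4 * s <= c * (2 * (frob v + 1)).
  rewrite -E -F mulrDr; move: Hp Hm; rewrite !ler_norml => /andP[_ Hp] /andP[Hm _].
  by apply: lerD => //; rewrite lerNl.
have : c * frob v <= c by rewrite ler_piMr.
by lra.
Qed.

End OperatorNorm.

(** * Duality with the variational parameter *)

Section Definite.
Context {R : realType} {N : nat}.
Local Notation C := R[i].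

Lemma posdefmx1 : posdefmx (1%:M : 'M[C]_N).
Proof.
split; first by apply/hermsymmxP; rewrite trmx1 map_mx1.
move=> v v0; rewrite mulmx1 mxE.
have pos i : 0 <= (v ^t*) 0 i * v i 0 by rewrite !mxE mulrC mul_conjC_ge0.
rewrite lt_def sumr_ge0// andbT; apply: contra_neq v0.
move=> /eqP; rewrite psumr_eq0// => /allP H; apply/colP => i; rewrite mxE.
by have := H i (mem_index_enum i); rewrite /= !mxE mulrC mul_conjC_eq0 => /eqP.
Qed.

Lemma negdefmxP (Z : 'M[C]_N) : posdefmx Z <-> negdefmx (- Z).
Proof.
split=> -[hZ H]; split.
- by apply/hermsymmxP; rewrite linearN /= map_mxN (hermsymmxP _ hZ).
- by move=> v v0; rewrite mulmxN mulNmx mxE oppr_lt0; exact: H.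
- by move/hermsymmxP: hZ; rewrite linearN /= map_mxN => /oppr_inj/hermsymmxP.
- by move=> v /H; rewrite mulmxN mulNmx mxE oppr_lt0.
Qed.

Lemma invmx_opp (Z : 'M[C]_N) : invmx (- Z) = - invmx Z.
Proof.
rewrite -scaleN1r -[RHS]scaleN1r.
have [uZ|nZ] := boolP (Z \in unitmx); last first.
  by rewrite /invmx unitmxZ ?rpredN1// (negbTE nZ).
by rewrite invmxZ ?unitmxZ ?rpredN1// invrN1.
Qed.

End Definite.

Section Duality.
Context {R : realType} {n N M : nat}.
Local Notation C := R[i].
Variables (A0 : 'M[C]_N) (A : 'I_n -> 'M[C]_N).
Hypothesis A0_herm : A0 \is hermsymmx.
Hypothesis A_herm : forall k, A k \is hermsymmx.
Variables (X : 'M[C]_(N, M)) (S : 'M[C]_N) (Theta : 'I_n -> 'M[C]_(N, M)) (tau : R).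
Hypothesis X1 : frob X = 1.
Hypothesis SX : S ^t* *m S = X *m X ^t*.
Hypothesis tau1 : 1 <= tau.
Hypothesis Theta_le : forall V : 'I_n -> 'M[C]_N,
  frob (\sum_k V k *m Theta k) <= tau ^+ 2 * \sum_k frob (V k).

Lemma frob_square_root p (B : 'M[C]_(N, p)) : frob (S *m B) = frob (X ^t* *m B).
Proof. by rewrite /frob !fdot_mull adjK !mulmxA SX. Qed.

Let Ah k : (A k) ^t* = A k. Proof. exact/hermsymmxP. Qed.

Let sigma := Num.sqrt (opnorm (\sum_k A k *m A k)).

(** Put Y = sum_k A_k S^* Theta_k, so that the left side is 2 <Y, X>, and split Y into Y / tau and
    (1 - 1 / tau) Y. The first part is paired through Z = E^* E and Z^{-1} = F F^*, where 1 / tau^2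
    cancels the contraction factor; the second costs at most 2 (1 - 1 / tau) tau sigma. *)
Lemma quadratic_duality (Z : 'M[C]_N) : posdefmx Z ->
  2 * \sum_k fdot (Theta k) (S *m A k *m X) <=
  fdot X (Z *m X) + fdot X ((\sum_k A k *m invmx Z *m A k) *m X) + 2 * (tau - 1) * sigma.
Proof.
move=> /posdef_factor[E [F [FE EZ FZ]]].
pose Y := \sum_k A k *m S ^t* *m Theta k.
have YX : fdot Y X = \sum_k fdot (Theta k) (S *m A k *m X).
  rewrite /Y fdot_suml; apply: eq_bigr => k _.
  by rewrite fdot_mull adjM adjK Ah.
rewrite -YX.
(* The contraction bound for V_k = B^* A_k S^*; in the norm S gives way to X^* because S^* S = X
   X^*. It is used with B = F and with B = 1. *)
have VB (B : 'M[C]_N) : frob (B ^t* *m Y) <=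
    tau ^+ 2 * \sum_k fdot X (A k *m (B *m B ^t*) *m A k *m X).
  have := Theta_le (fun k => B ^t* *m (A k *m S ^t*)).
  rewrite /Y mulmx_sumr; under eq_bigr do rewrite -mulmxA.
  under [X in frob X]eq_bigr do rewrite mulmxA.
  move=> /le_trans; apply.
  rewrite le_eqVlt; apply/orP; left; apply/eqP; congr (_ * _); apply: eq_bigr => k _.
  have -> : B ^t* *m (A k *m S ^t*) = (S *m (A k *m B)) ^t* by rewrite !adjM Ah mulmxA.
  by rewrite frob_adj frob_square_root -frob_adj adjM adjK /frob fdot_mull adjK adjM Ah !mulmxA.
have tp : 0 < tau by rewrite (lt_le_trans _ tau1).
have H1 : 2 * fdot (tau^-1%:C%C *: Y) X <=
    fdot X (Z *m X) + fdot X ((\sum_k A k *m invmx Z *m A k) *m X).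
  have -> : fdot (tau^-1%:C%C *: Y) X = fdot (tau^-1%:C%C *: (F ^t* *m Y)) (E *m X).
    by rewrite !fdotZl fdot_mull adjK mulmxA FE mul1mx.
  rewrite (le_trans (fdot_le _ _))// addrC; apply: lerD.
    by rewrite -EZ -mulmxA [leRHS]fdotC fdot_mull adjK.
  rewrite frobZ exprVn ler_pdivrMl ?exprn_gt0//.
  by rewrite mulmx_suml fdot_sumr FZ; exact: VB.
have Y2 : frob Y <= tau ^+ 2 * sigma ^+ 2.
  have := VB 1%:M; rewrite trmx1 map_mx1 !mul1mx => /le_trans; apply.
  rewrite ler_wpM2l ?sqr_ge0//.
  under eq_bigr do rewrite mulmx1.
  rewrite -fdot_sumr -mulmx_suml sqr_sqrtr ?opnorm_ge0//.
  by rewrite (le_trans (fdot_opnorm_mx _ _))// X1 mulr1.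
have H2 : fdot Y X <= tau * sigma.
  rewrite (le_trans (fdot_CS _ _))// X1 sqrtr1 mulr1.
  rewrite -[leRHS]ger0_norm ?mulr_ge0 ?sqrtr_ge0 ?(ltW tp)// -sqrtr_sqr exprMn.
  by rewrite ler_sqrt// mulr_ge0 ?sqr_ge0.
have -> : 2 * fdot Y X = 2 * fdot (tau^-1%:C%C *: Y) X + 2 * (1 - tau^-1) * fdot Y X.
  by rewrite fdotZl; ring.
apply: lerD => //.
have t1 : 0 <= 1 - tau^-1 by rewrite subr_ge0 invf_le1.
have -> : 2 * (tau - 1) * sigma = 2 * (1 - tau^-1) * (tau * sigma).
  by field; rewrite gt_eqF.
by rewrite ler_wpM2l// mulr_ge0.
Qed.

Let rho_map_herm (Z : 'M[C]_N) : Z \is hermsymmx -> rho_map A0 A Z \is hermsymmx.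
Proof.
move=> hZ; apply/hermsymmxP; rewrite /rho_map !adjD; congr (_ + _ + _).
- exact/hermsymmxP.
- exact/hermsymmxP.
rewrite linear_sum /= map_mx_sum; apply: eq_bigr => k _.
by rewrite !adjM Ah mulmxA trmx_inv map_invmx (hermsymmxP _ hZ).
Qed.

Let sum_quadratic (Z : 'M[C]_N) : fdot X (rho_map A0 A Z *m X) =
  fdot X (A0 *m X) + (fdot X (Z *m X) + fdot X ((\sum_k A k *m invmx Z *m A k) *m X)).
Proof. by rewrite /rho_map !mulmxDl !fdotDr addrA. Qed.

Lemma rho_plus_ge :
  fdot X (A0 *m X) + 2 * \sum_k fdot (Theta k) (S *m A k *m X) <=
  rho_plus A0 A + 2 * (tau - 1) * sigma.
Proof.
rewrite -lerBlDr; apply: lb_le_inf.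
  by exists (lambda_max (rho_map A0 A 1%:M)), 1%:M; first exact: posdefmx1.
move=> _ [Z /= Zpd <-].
have := lambda_max_ge X (rho_map_herm (proj1 Zpd)); rewrite X1 !mulr1 => /andP[_].
rewrite sum_quadratic => H; rewrite lerBlDr (le_trans (lerD (lexx _) (quadratic_duality Zpd)))//.
by rewrite addrA lerD2r.
Qed.

Lemma rho_minus_le :
  - fdot X (A0 *m X) + 2 * \sum_k fdot (Theta k) (S *m A k *m X) <=
  - rho_minus A0 A + 2 * (tau - 1) * sigma.
Proof.
rewrite -lerBlDr lerNr; apply: ge_sup.
  by exists (lambda_min (rho_map A0 A (- 1%:M))), (- 1%:M); first exact/negdefmxP/posdefmx1.
move=> _ [Z /= Znd <-].
have Zpd : posdefmx (- Z) by apply/negdefmxP; rewrite opprK.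
have := lambda_max_ge X (rho_map_herm (proj1 Znd)); rewrite X1 !mulr1 => /andP[+ _].
rewrite sum_quadratic lerNr => H; have := quadratic_duality Zpd.
have -> : \sum_k A k *m invmx (- Z) *m A k = - \sum_k A k *m invmx Z *m A k.
  by rewrite -sumrN; apply: eq_bigr => k _; rewrite invmx_opp mulmxN mulNmx.
rewrite !mulNmx !fdotNr; lra.
Qed.

End Duality.

(** * Comparison of the two processes *)

Lemma sum_pair (V : nmodType) (I J : finType) (F : I * J -> V) :
  \sum_q F q = \sum_i \sum_j F (i, j).
Proof. by rewrite pair_bigA; apply: eq_bigr => -[]. Qed.

Section HermitianCoordinates.
Context {R : realType} {m : nat}.
Local Notation C := R[i].
Local Notation Re := complex.Re.
Local Notation Im := complex.Im.

Definition herm_weight (ij : 'I_m * 'I_m) : R := if ij.1 == ij.2 then 1 else 2.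

Lemma fdot_herm_coord (B G : 'M[C]_m) : B \is hermsymmx -> G \is hermsymmx ->
  fdot B G = \sum_ij herm_weight ij * herm_coord B ij * herm_coord G ij.
Proof.
move=> /hermsymmxP hB /hermsymmxP hG.
have sy (U : 'M[C]_m) : U ^t* = U -> forall i j, U i j = Num.conj (U j i).
  by move=> hU i j; rewrite -{1}hU !mxE.
have double (F : 'I_m -> 'I_m -> R) :
    2 * \sum_i \sum_j F i j = \sum_i \sum_j (F i j + F j i).
  rewrite mulr_natl mulr2n; under [RHS]eq_bigr do rewrite big_split.
  by rewrite big_split /= [X in _ = _ + X]exchange_big.
apply: (@mulfI _ 2); first by rewrite pnatr_eq0.
rewrite sum_pair !double; apply: eq_bigr => i _; apply: eq_bigr => j _.
rewrite /herm_weight /herm_coord /cdot /= (sy _ hB j i) (sy _ hG j i) !Re_conjC !Im_conjC.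
have [ij|ij|/ord_inj ->] := ltngtP i j.
- have /negbTE -> : i != j by apply/eqP => E; rewrite E ltnn in ij.
  have /negbTE -> : j != i by apply/eqP => E; rewrite E ltnn in ij.
  by ring.
- have /negbTE -> : i != j by apply/eqP => E; rewrite E ltnn in ij.
  have /negbTE -> : j != i by apply/eqP => E; rewrite E ltnn in ij.
  by rewrite mulrNN; ring.
have im0 (U : 'M[C]_m) : U ^t* = U -> Im (U j j) = 0.
  by move=> /sy/(_ j j)/(congr1 (@complex.Im R)); rewrite Im_conjC; lra.
by rewrite eqxx !im0//; ring.
Qed.

Lemma herm_coordB (B B' : 'M[C]_m) ij :
  herm_coord (B - B') ij = herm_coord B ij - herm_coord B' ij.
Proof.
rewrite /herm_coord !mxE; case: ifP => _.
  by case: (B _ _) => ? ?; case: (B' _ _).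
by case: (B _ _) => ? ?; case: (B' _ _).
Qed.

Definition GUE_sd (ij : 'I_m * 'I_m) : R := if ij.1 == ij.2 then 1 else Num.sqrt (2^-1).

Lemma GUE_sd_gt0 ij : 0 < GUE_sd ij.
Proof. by rewrite /GUE_sd; case: ifP => _; rewrite ?ltr01 ?sqrtr_gt0 ?invr_gt0. Qed.

(** Off the diagonal, weight 2 and variance 1/2 combine to 2^2 / 2 = 2, the multiplicity of a
    conjugate pair: GUE is the standard Gaussian on Hermitian matrices for [fdot], and <B, G> has
    variance [frob B]. *)
Lemma frob_herm_coord (B : 'M[C]_m) : B \is hermsymmx ->
  frob B = \sum_ij (GUE_sd ij * (herm_weight ij * herm_coord B ij)) ^+ 2.
Proof.
move=> hB; rewrite /frob fdot_herm_coord//; apply: eq_bigr => ij _.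
rewrite /GUE_sd /herm_weight; case: ifP => _; first by ring.
by rewrite exprMn sqr_sqrtr ?invr_ge0//; field.
Qed.

End HermitianCoordinates.

Section Processes.
Context {R : realType} {n N M : nat} {I0 : finType}.
Local Notation C := R[i].
Local Notation Re := complex.Re.
Local Notation Im := complex.Im.
Variables (A : 'I_n -> 'M[C]_N) (X : I0 -> 'M[C]_(N, M)) (S : I0 -> 'M[C]_N).
Hypothesis A_psd : forall k, possemidefmx (A k).
Hypothesis SX : forall p, (S p) ^t* *m S p = X p *m (X p) ^t*.
Local Notation I := (I0 * bool)%type.
Local Notation K := (bool * bool * ('I_n * 'I_N))%type.

Definition sg (s : bool) : R := if s then 1 else -1.

(** The tensor product of A_k and G_k acts on the matrix X of a vector as A_k X G_k^T, so the
    quadratic form pairs G_k with the transpose of X^* A_k X. The sign makes a maximum over indices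
    into a maximum of absolute values. *)
Definition compression (i : I) (k : 'I_n) : 'M[C]_M :=
  (sg i.2)%:C%C *: ((X i.1) ^t* *m A k *m X i.1)^T.

Definition sketch (p : I0) (k : 'I_n) : 'M[C]_(N, M) := S p *m A k *m X p.

Definition GUE_coef (i : I) (q : 'I_n * ('I_M * 'I_M)) : R :=
  (Num.sqrt M%:R)^-1 *
  (GUE_sd q.2 * (herm_weight q.2 * herm_coord (compression i q.1) q.2)).

(* A column [(s, r, (k, l))] indexes the family attached to the sign [s], the
   real or imaginary part [r], and the entries in row [l] of the [k]-th block. *)
Definition sketch_coef (i : I) (q : 'I_M * K) : R :=
  if i.2 == q.2.1.1 then
    Num.sqrt (2 / M%:R) *
    (if q.2.1.2 then Re (sketch i.1 q.2.2.1 q.2.2.2 q.1)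
     else Im (sketch i.1 q.2.2.1 q.2.2.2 q.1))
  else 0.

Lemma compression_herm (i : I) k : compression i k \is hermsymmx.
Proof.
set B := X i.1 ^t* *m A k *m X i.1.
have hB : B ^t* = B by rewrite !adjM adjK (hermsymmxP _ (proj1 (A_psd k))) mulmxA.
have /CrealP hs : (sg i.2)%:C%C \is @Num.real C by rewrite complex_real.
apply/hermsymmxP/matrixP => a b; rewrite /compression -/B; clearbody B; rewrite !mxE rmorphM.
by congr (_ * _); [exact: hs | rewrite -[in RHS]hB !mxE].
Qed.

Lemma GUE_coef_increment (i j : I) :
  \sum_q (GUE_coef i q - GUE_coef j q) ^+ 2 =
  M%:R^-1 * \sum_k frob (compression i k - compression j k).
Proof.
rewrite sum_pair mulr_sumr; apply: eq_bigr => k _.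
rewrite frob_herm_coord; last first.
  by apply/hermsymmxP; rewrite adjD linearN /= map_mxN !(hermsymmxP _ (compression_herm _ _)).
rewrite mulr_sumr; apply: eq_bigr => ij _.
rewrite herm_coordB /GUE_coef /= -mulrBr -mulrBr -mulrBr exprMn exprVn sqr_sqrtr//.
Qed.

Lemma sum_sketch_square (F : K -> 'I_M -> R) :
  \sum_(q : 'I_M * K) F q.2 q.1 =
  \sum_s \sum_k \sum_l \sum_m (F (s, true, (k, l)) m + F (s, false, (k, l)) m).
Proof.
rewrite sum_pair exchange_big sum_pair sum_pair /=; apply: eq_bigr => s _.
rewrite big_bool /= !sum_pair -big_split; apply: eq_bigr => k _.
rewrite -big_split; apply: eq_bigr => l _.
by rewrite -big_split.
Qed.

Lemma sketch_coef_increment (i j : I) :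
  \sum_q (sketch_coef i q - sketch_coef j q) ^+ 2 = 2 / M%:R * \sum_k
    (if i.2 == j.2 then frob (sketch i.1 k - sketch j.1 k)
     else frob (sketch i.1 k) + frob (sketch j.1 k)).
Proof.
have c2 : Num.sqrt (2 / M%:R) ^+ 2 = 2 / M%:R :> R by rewrite sqr_sqrtr// divr_ge0.
set c := Num.sqrt _ in c2.
pose D s k : 'M[C]_(N, M) := (if i.2 == s then sketch i.1 k else 0) -
  (if j.2 == s then sketch j.1 k else 0).
have -> : \sum_q (sketch_coef i q - sketch_coef j q) ^+ 2 =
    2 / M%:R * \sum_s \sum_k frob (D s k).
  rewrite (sum_sketch_square (fun q m => (sketch_coef i (m, q) - sketch_coef j (m, q)) ^+ 2)).
  rewrite mulr_sumr; apply: eq_bigr => s _; rewrite mulr_sumr; apply: eq_bigr => k _.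
  rewrite frobE mulr_sumr; apply: eq_bigr => l _; rewrite mulr_sumr; apply: eq_bigr => m _.
  rewrite /sketch_coef /= -/c -c2 /D; move: (sketch i.1 k) (sketch j.1 k) => U V.
  by case: (i.2 == s); case: (j.2 == s); rewrite !mxE; case: (U l m) => ? ?;
    case: (V l m) => ? ? /=; ring.
congr (_ * _); rewrite exchange_big; apply: eq_bigr => k _.
rewrite /D big_bool; case: i.2; case: j.2 => /=.
all: rewrite ?subr0 ?sub0r ?frobN.
all: by rewrite /frob ?fdot0l ?addr0 ?add0r // addrC.
Qed.

Lemma process_increments (i j : I) :
  \sum_q (GUE_coef i q - GUE_coef j q) ^+ 2 <=
  \sum_q (sketch_coef i q - sketch_coef j q) ^+ 2.
Proof.
rewrite GUE_coef_increment sketch_coef_increment [2 / _]mulrC -mulrA ler_wpM2l ?invr_ge0//.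
rewrite mulr_sumr; apply: ler_sum => k _.
have [E EA] := psd_factor (A_psd k).
have LY p : (S p *m E ^t*) ^t* *m (S p *m E ^t*) = (E *m X p) *m (E *m X p) ^t*.
  by rewrite !adjM adjK -!mulmxA [S p ^t* *m _]mulmxA SX !mulmxA.
have YY p : (E *m X p) ^t* *m (E *m X p) = (X p) ^t* *m A k *m X p.
  by rewrite adjM -EA !mulmxA.
have fE p : sketch p k = (S p *m E ^t*) *m (E *m X p).
  by rewrite /sketch -EA !mulmxA.
have trE (B B' : 'M[C]_M) s s' : frob ((sg s)%:C%C *: B^T - (sg s')%:C%C *: B'^T) =
    if s == s' then frob (B - B') else frob (B + B').
  rewrite -!linearZ -linearB /=.
  have -> : forall U : 'M[C]_M, frob U^T = frob U.
    by move=> U; rewrite !frobE exchange_big; apply: eq_bigr => a _; apply: eq_bigr => b _; rewrite mxE.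
  case: s; case: s' => /=; rewrite ?scale1r//.
  - by rewrite rmorphN1 scaleN1r opprK.
  - by rewrite rmorphN1 scaleN1r -opprD frobN.
  - by rewrite rmorphN1 !scaleN1r -opprD frobN.
rewrite /compression trE -!YY !fE; case: ifP => _.
  exact: increment_le.
exact: increment_add_le.
Qed.

End Processes.

(** * Ginibre blocks as one linear map *)

Section GinibreSketch.
Context {R : realType} {n N M : nat}.
Local Notation C := R[i].
Local Notation Re := complex.Re.
Local Notation Im := complex.Im.
Local Notation K := (bool * bool * ('I_n * 'I_N))%type.
Hypothesis M_gt0 : (0 < M)%N.

(** The normalisation includes the division by sqrt M: for standard W, the real and imaginary parts
    of an entry each have variance 1 / (2 M). *)
Definition ginibre (W : {ffun 'I_M * K -> R}) (s : bool) (k : 'I_n) : 'M[C]_(N, M) :=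
  \matrix_(l, m) ((Num.sqrt (2 * M%:R))^-1%:C%C *
    (W (m, (s, true, (k, l))) +i* W (m, (s, false, (k, l))))%C).

Let sqrt2M : Num.sqrt (2 / M%:R) = 2 * (Num.sqrt (2 * M%:R))^-1 :> R.
Proof.
have M0 : 0 < M%:R :> R by rewrite ltr0n.
apply: (@pexpIrn _ 2) => //; rewrite ?nnegrE ?mulr_ge0 ?invr_ge0 ?sqrtr_ge0//.
rewrite exprMn exprVn !sqr_sqrtr ?divr_ge0 ?mulr_ge0 ?ler0n//.
by field; rewrite gt_eqF.
Qed.

Lemma lin_process_sketch_coef (I0 : finType) (A : 'I_n -> 'M[C]_N)
    (X : I0 -> 'M[C]_(N, M)) (S : I0 -> 'M[C]_N) (W : {ffun 'I_M * K -> R}) p s :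
  lin_process (sketch_coef A X S) W (p, s) =
  2 * \sum_k fdot (ginibre W s k) (S p *m A k *m X p).
Proof.
rewrite ffunE.
rewrite (eq_bigr (fun q => sketch_coef A X S (p, s) (q.1, q.2) * W (q.1, q.2))); last by case.
rewrite (sum_sketch_square (fun q m => sketch_coef A X S (p, s) (m, q) * W (m, q))).
rewrite (bigD1 s)//= [X in _ + X]big1 ?addr0; last first.
  move=> s' /negbTE s's; do 3! (rewrite big1 => // ? _).
  by rewrite /sketch_coef /= eq_sym s's !mul0r addr0.
rewrite mulr_sumr; apply: eq_bigr => k _; rewrite /fdot mulr_sumr; apply: eq_bigr => l _.
rewrite mulr_sumr; apply: eq_bigr => m _.
rewrite /sketch_coef /sketch /= eqxx sqrt2M; move: (S p *m A k *m X p) => U.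
by rewrite mxE /cdot Re_mul Im_mul /=; ring.
Qed.

(** Row a of the blocks V is encoded by two real vectors [vr a] and [vi a], supported on the family
    s, which W sends to multiples of the real and imaginary parts of row a of the sum. Both have the
    norm of that row, and their factors 1 / (2 M) add up to 1 / M. *)
Lemma ginibre_contraction (W : {ffun 'I_M * K -> R}) (tau : R) :
  (forall v : K -> R, \sum_m (\sum_q W (m, q) * v q) ^+ 2 <= tau ^+ 2 * \sum_q v q ^+ 2) ->
  forall s (V : 'I_n -> 'M[C]_N),
  frob (\sum_k V k *m ginibre W s k) <= (tau / Num.sqrt M%:R) ^+ 2 * \sum_k frob (V k).
Proof.
move=> H s V.
have M0 : 0 < M%:R :> R by rewrite ltr0n.
pose vr a (q : K) : R := if q.1.1 == s then
  (if q.1.2 then Re (V q.2.1 a q.2.2) else - Im (V q.2.1 a q.2.2)) else 0.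
pose vi a (q : K) : R := if q.1.1 == s then
  (if q.1.2 then Im (V q.2.1 a q.2.2) else Re (V q.2.1 a q.2.2)) else 0.
have sumK (F : K -> R) : (forall q, q.1.1 != s -> F q = 0) ->
    \sum_q F q = \sum_k \sum_l (F (s, true, (k, l)) + F (s, false, (k, l))).
  move=> F0; rewrite !sum_pair (bigD1 s)//= [X in _ + X]big1 ?addr0; last first.
    by move=> s' s's; rewrite !big1// => r _; rewrite big1// => kl _; exact: F0.
  rewrite big_bool /= !sum_pair -big_split; apply: eq_bigr => k _.
  by rewrite -big_split.
set c := (Num.sqrt (2 * M%:R))^-1 : R.
have c2 : c ^+ 2 = (2 * M%:R)^-1 by rewrite exprVn sqr_sqrtr// mulr_ge0.
have ent a m : Re ((\sum_k V k *m ginibre W s k) a m) ^+ 2 +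
    Im ((\sum_k V k *m ginibre W s k) a m) ^+ 2 =
    c ^+ 2 * ((\sum_q W (m, q) * vr a q) ^+ 2 + (\sum_q W (m, q) * vi a q) ^+ 2).
  rewrite summxE Re_sum Im_sum.
  have -> : \sum_k Re ((V k *m ginibre W s k) a m) = c * \sum_q W (m, q) * vr a q.
    rewrite sumK; last by move=> q /negbTE qs; rewrite /vr qs mulr0.
    rewrite mulr_sumr; apply: eq_bigr => k _; rewrite mxE Re_sum mulr_sumr.
    apply: eq_bigr => l _; rewrite /vr /= eqxx /ginibre mxE !Re_mul !Im_mul /= -/c.
    by ring.
  have -> : \sum_k Im ((V k *m ginibre W s k) a m) = c * \sum_q W (m, q) * vi a q.
    rewrite sumK; last by move=> q /negbTE qs; rewrite /vi qs mulr0.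
    rewrite mulr_sumr; apply: eq_bigr => k _; rewrite mxE Im_sum mulr_sumr.
    apply: eq_bigr => l _; rewrite /vi /= eqxx /ginibre mxE !Im_mul !Re_mul /= -/c.
    by ring.
  by rewrite !exprMn mulrDr.
rewrite frobE; under eq_bigr => a _ do under eq_bigr => m _ do rewrite ent.
have nv a : \sum_q vr a q ^+ 2 = \sum_k \sum_l (Re (V k a l) ^+ 2 + Im (V k a l) ^+ 2).
  rewrite sumK; last by move=> q /negbTE qs; rewrite /vr qs expr0n.
  by apply: eq_bigr => k _; apply: eq_bigr => l _; rewrite /vr /= eqxx sqrrN.
have ni a : \sum_q vi a q ^+ 2 = \sum_k \sum_l (Re (V k a l) ^+ 2 + Im (V k a l) ^+ 2).
  rewrite sumK; last by move=> q /negbTE qs; rewrite /vi qs expr0n.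
  by apply: eq_bigr => k _; apply: eq_bigr => l _; rewrite /vi /= eqxx addrC.
have -> : \sum_k frob (V k) = \sum_a \sum_k \sum_l (Re (V k a l) ^+ 2 + Im (V k a l) ^+ 2).
  by rewrite [RHS]exchange_big; apply: eq_bigr => k _; rewrite frobE.
rewrite mulr_sumr; apply: ler_sum => a _.
rewrite -mulr_sumr big_split /=.
have := H (vr a); have := H (vi a); rewrite nv ni; set x := \sum_k _.
move=> H1 H2; rewrite expr_div_n sqr_sqrtr// c2.
have -> : tau ^+ 2 / M%:R * x = (2 * M%:R)^-1 * (tau ^+ 2 * x + tau ^+ 2 * x).
  by field; rewrite gt_eqF.
by rewrite ler_wpM2l ?invr_ge0 ?mulr_ge0//; exact: lerD.
Qed.

End GinibreSketch.

(** * The mean of the GUE process *)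

Section Mean.
Context {R : realType} {n N M : nat} {I0 : finType}.
Local Notation C := R[i].
Local Notation K := (bool * bool * ('I_n * 'I_N))%type.
Hypothesis M_gt0 : (0 < M)%N.
Hypothesis nN_gt0 : (0 < n * N)%N.
Variables (A0 : 'M[C]_N) (A : 'I_n -> 'M[C]_N) (X : I0 -> 'M[C]_(N, M)).
Hypothesis A0_herm : A0 \is hermsymmx.
Hypothesis A_psd : forall k, possemidefmx (A k).
Hypothesis X1 : forall p, frob (X p) = 1.
Variable p0 : I0.

Definition mean_process : {ffun I0 * bool -> R} :=
  [ffun i => sg i.2 * fdot (X i.1) (A0 *m X i.1)].

Let sigma := Num.sqrt (opnorm (\sum_k A k *m A k)).

Lemma gram_root : exists S : I0 -> 'M[C]_N, forall p, (S p) ^t* *m S p = X p *m (X p) ^t*.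
Proof.
suff H p : exists S : 'M[C]_N, S ^t* *m S = X p *m (X p) ^t*.
  by exists (fun p => sval (cid (H p))) => p; exact: svalP (cid (H p)).
apply: psd_factor; split; first by apply/hermsymmxP; rewrite adjM adjK.
move=> v; rewrite mulmxA -mulmxA -[X p]adjK -adjM adjK mxE.
by apply: sumr_ge0 => i _; rewrite !mxE mulrC mul_conjC_ge0.
Qed.

Lemma GUE_mean_le :
  gmeans (std_basis ('I_n * ('I_M * 'I_M))%type)
    (fun W => fmax (p0, true) (mean_process + lin_process (GUE_coef A X) W)) 0 <=
  rho_star A0 A + 9 * Num.sqrt ((n * N)%:R / M%:R) * sigma.
Proof.
have M0 : 0 < M%:R :> R by rewrite ltr0n.
have s0 : 0 <= sigma by exact: sqrtr_ge0.
have [S SX] := gram_root.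
have A_herm k : A k \is hermsymmx by have [] := A_psd k.
apply: le_trans (sudakov_fernique_lin (p0, true) mean_process (process_increments A_psd SX)) _.
have [|tau [ltau tau_ge tau_op tau_mean]] :=
  @chevet R 'I_M K (2^-1) ltac:(by rewrite invr_gt0) _; first by rewrite card_ord.
rewrite card_ord in tau_ge tau_mean.
have sM : 0 < Num.sqrt M%:R :> R by rewrite sqrtr_gt0.
pose a : R := 2 * sigma / Num.sqrt M%:R.
(* The right side is rho_star + 2 (tau / sqrt M - 1) sigma, arranged as an affine function of [tau]
   so that averaging needs only the mean of [tau]. *)
have pt W : fmax (p0, true) (mean_process + lin_process (sketch_coef A X S) W) <=
    (rho_star A0 A - 2 * sigma) + a * tau W.
  apply: fmax_le => -[p s]; rewrite !ffunE.
  have := lin_process_sketch_coef M_gt0 A X S W p s; rewrite ffunE => -> /=.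
  have t1 : 1 <= tau W / Num.sqrt M%:R by rewrite ler_pdivlMr// mul1r.
  have op V := ginibre_contraction M_gt0 (tau_op W) s V.
  have aE : a * tau W = 2 * (tau W / Num.sqrt M%:R) * sigma by rewrite /a; ring.
  have Hp := rho_plus_ge A0_herm A_herm (X1 p) (SX p) t1 op.
  have Hm := rho_minus_le A0_herm A_herm (X1 p) (SX p) t1 op.
  have Rp : rho_plus A0 A <= rho_star A0 A by rewrite /rho_star le_max lexx.
  have Rm : - rho_minus A0 A <= rho_star A0 A by rewrite /rho_star le_max lexx orbT.
  rewrite -/sigma in Hp Hm; rewrite aE /sg.
  by case: s op Hp Hm => op Hp Hm; lra.
have lZ : lip (fun W => fmax (p0, true) (mean_process + lin_process (sketch_coef A X S) W)).
  exact/lip_lin_process/fmax_lip.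
apply: (@le_trans _ _ (gmeans (std_basis ('I_M * K)%type)
  (fun W => (rho_star A0 A - 2 * sigma) + a * tau W) 0)).
  by apply: gmeans_le => //; apply: lipD; [exact: lip_cst|exact: lipZ].
rewrite gmeansDZ//; last exact: lip_cst.
rewrite gmeans_cst.
have a0 : 0 <= a by rewrite divr_ge0 ?mulr_ge0.
apply: (@le_trans _ _ (rho_star A0 A - 2 * sigma + a *
    (Num.sqrt M%:R + 2 + Num.sqrt #|{: K}|%:R + 2^-1))).
  by rewrite lerD2l ler_wpM2l.
have -> : #|{: K}| = (4 * (n * N))%N by rewrite !card_prod card_bool !card_ord.
have -> : Num.sqrt (4 * (n * N))%:R = 2 * Num.sqrt (n * N)%:R :> R.
  rewrite natrM sqrtrM//; congr (_ * _).
  have -> : 4 = 2 ^+ 2 :> R by ring.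
  by rewrite sqrtr_sqr ger0_norm.
rewrite sqrtrM ?ler0n// sqrtrV ?ler0n//.
set t := Num.sqrt (n * N)%:R; set r := Num.sqrt M%:R.
(* [K] has 4 n N elements and the net error is 1/2, so in units of sigma / sqrt M the excess is 2 (2
   + 2 t + 1/2) = 4 t + 5, and t >= 1 bounds it by 9 t. *)
have t1 : 1 <= t by rewrite /t -[leLHS]sqrtr1 ler_sqrt// ler1n.
rewrite -subr_ge0.
have -> : rho_star A0 A + 9 * (t * r^-1) * sigma -
    (rho_star A0 A - 2 * sigma + a * (r + 2 + 2 * t + 2^-1)) =
    5 * (t - 1) * (sigma * r^-1).
  by rewrite /a -/r; field; rewrite gt_eqF.
by rewrite !mulr_ge0 ?subr_ge0 ?invr_ge0 ?sqrtr_ge0.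
Qed.

End Mean.

(** * Nets of the complex unit sphere *)

Section OpnormNet.
Context {R : realType} {m : nat}.
Local Notation C := R[i].
Local Notation Re := complex.Re.
Local Notation Im := complex.Im.

Let vec (x : {ffun 'I_m * bool -> R}) : 'cV[C]_m := \col_i (x (i, true) +i* x (i, false))%C.

Let vecE x : frob (vec x) = \sum_i (x (i, true) ^+ 2 + x (i, false) ^+ 2).
Proof. by rewrite frobE; apply: eq_bigr => i _; rewrite big_ord1 mxE. Qed.

Let vec_surj v : exists x, vec x = v.
Proof.
exists [ffun ib => if ib.2 then Re (v ib.1 0) else Im (v ib.1 0)].
by apply/colP => i; rewrite mxE !ffunE /=; case: (v i 0).
Qed.

(** For a net point u near the unit vector v, the form at v differs from that at u by <v - u, H v> +
    <u, H (v - u)>, and each term is at most e times the norm of H. A nonempty net provides the base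
    index of [fmax]. *)
Lemma opnorm_net (e : R) : 0 < e -> (0 < m)%N -> exists s : seq 'cV[C]_m,
  [/\ (0 < size s)%N, forall v, v \in s -> frob v = 1 &
  forall (H : 'M[C]_m) (c : R), H \is hermsymmx -> 0 <= c ->
    (forall v, v \in s -> `|fdot v (H *m v)| <= c) -> opnorm H <= c + 2 * e * opnorm H].
Proof.
move=> e0 m0; have mR : 1 <= m%:R :> R by rewrite ler1n.
(* There are m complex entries with two coordinates each, and 2 m (e / (2 m))^2 = e^2 / (2 m) <=
   e^2. *)
have d0 : 0 < e / (2 * m%:R) by rewrite divr_gt0// mulr_gt0// ltr0n.
have [|s [s1 sd]] := @finite_net R ('I_m * bool)%type [set x | frob (vec x) = 1] 1 _ d0.
  move=> x /= x1 [i b]; rewrite -sqrtr_sqr -sqrtr1 ler_sqrt// -x1 vecE (bigD1 i)//=.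
  have := sqr_ge0 (x (i, true)); have := sqr_ge0 (x (i, false)).
  have : 0 <= \sum_(j < m | j != i) (x (j, true) ^+ 2 + x (j, false) ^+ 2).
    by apply: sumr_ge0 => j _; rewrite addr_ge0 ?sqr_ge0.
  by case: b; lra.
have net v : frob v = 1 -> exists2 u, u \in [seq vec x | x <- s] & Num.sqrt (frob (v - u)) <= e.
  have [x <- x1] := vec_surj v; have [y ys xy] := sd x x1.
  exists (vec y); first exact: map_f.
  have -> : vec x - vec y = vec (x - y).
    by apply/colP => i; rewrite !mxE !ffunE.
  rewrite vecE -[leRHS]ger0_norm ?(ltW e0)// -sqrtr_sqr ler_sqrt ?sqr_ge0//.
  apply: (@le_trans _ _ (\sum_(i < m) 2 * (e / (2 * m%:R)) ^+ 2)).
    apply: ler_sum => i _; rewrite !ffunE.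
    have sq b : (x (i, b) - y (i, b)) ^+ 2 <= (e / (2 * m%:R)) ^+ 2.
      rewrite -[leLHS]real_normK ?num_real//.
      by rewrite ler_sqr ?nnegrE ?normr_ge0 ?(ltW d0).
    by have := sq true; have := sq false; lra.
  rewrite sumr_const card_ord -[leLHS]mulr_natl.
  have -> : m%:R * (2 * (e / (2 * m%:R)) ^+ 2) = e ^+ 2 * (2 * m%:R)^-1.
    by field; rewrite gt_eqF// (lt_le_trans _ mR).
  by rewrite ler_piMr ?sqr_ge0// invf_le1 ?mulr_gt0 ?ltr0n//; lra.
exists [seq vec x | x <- s]; split.
- have [|u us _] := net (delta_mx (Ordinal m0) 0).
    rewrite frobE (bigD1 (Ordinal m0))//= big_ord1 mxE !eqxx big1 ?addr0//=.
      by rewrite expr1n expr0n addr0.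
    by move=> i /negbTE i0; rewrite big_ord1 mxE i0 /= expr0n addr0.
  by case: [seq _ | _ <- _] us.
- by move=> _ /mapP[x xs ->]; exact: s1.
move=> H c hH c0 Hc; have o0 := opnorm_ge0 H.
have unit (v : 'cV[C]_m) : frob v = 1 -> `|fdot v (H *m v)| <= c + 2 * e * opnorm H.
  move=> v1; have [u us uv] := net v v1.
  have u1 : frob u = 1 by move/mapP: us => [x xs ->]; exact: s1.
  have B (p q : 'cV[C]_m) (a b : R) : Num.sqrt (frob p) <= a -> Num.sqrt (frob q) <= b ->
      `|fdot p (H *m q)| <= opnorm H * (a * b).
    move=> pa qb.
    have M : opnorm H * Num.sqrt (frob p) * Num.sqrt (frob q) <= opnorm H * (a * b).
      by rewrite -mulrA ler_wpM2l// ler_pM.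
    rewrite ler_norml; apply/andP; split; last exact: le_trans (fdot_opnorm _ _ _) M.
    rewrite lerNl -fdotNl (le_trans (fdot_opnorm _ _ _))//.
    by rewrite frobN.
  have -> : fdot v (H *m v) =
      fdot u (H *m u) + fdot (v - u) (H *m v) + fdot u (H *m (v - u)).
    rewrite mulmxBr fdotDl fdotDr fdotNl fdotNr; ring.
  have b1 q := @B _ q e 1 uv.
  have := b1 v; rewrite v1 sqrtr1 mulr1 => /(_ (lexx _)) {}b1.
  have := B u (v - u) 1 e; rewrite u1 sqrtr1 mul1r => /(_ (lexx _) uv) b2.
  rewrite (le_trans (ler_normD _ _))//.
  have := ler_normD (fdot u (H *m u)) (fdot (v - u) (H *m v)).
  have := Hc _ us; lra.
apply: opnorm_herm_le => //; first by rewrite addr_ge0// !mulr_ge0// ltW.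
move=> v; have [v0|v0] := eqVneq (frob v) 0.
  by rewrite (frob_eq0 v0) /frob !fdot0l normr0 mulr0.
have vp : 0 < frob v by rewrite lt_def v0 frob_ge0.
have := unit ((Num.sqrt (frob v))^-1%:C%C *: v).
rewrite frobZ exprVn sqr_sqrtr ?frob_ge0// mulVf// => /(_ erefl).
rewrite -scalemxAr fdotZl fdotZr mulrA -expr2 exprVn sqr_sqrtr ?frob_ge0//.
rewrite normrM ger0_norm ?invr_ge0 ?frob_ge0//.
by rewrite ler_pdivrMl// mulrC.
Qed.

End OpnormNet.

(** * Vectors of the tensor product as matrices *)

Section TensorForm.
Context {R : realType} {N M : nat}.
Local Notation C := R[i].

Definition unvec (v : 'cV[C]_(N * M)) : 'M[C]_(N, M) :=
  \matrix_(a, b) v (mxtens_index (a, b)) 0.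

Let sum_tens (V : nmodType) (F : 'I_(N * M) -> V) :
  \sum_i F i = \sum_a \sum_b F (mxtens_index (a, b)).
Proof.
rewrite (reindex (@mxtens_index N M))/=; last first.
  by apply: onW_bij; exists (@mxtens_unindex N M); [exact: mxtens_indexK|exact: mxtens_unindexK].
exact: sum_pair.
Qed.

Lemma fdot_unvec (u v : 'cV[C]_(N * M)) : fdot (unvec u) (unvec v) = fdot u v.
Proof.
rewrite {2}/fdot sum_tens; apply: eq_bigr => a _; apply: eq_bigr => b _.
by rewrite big_ord1 !mxE.
Qed.

Lemma unvec_tensmx (A : 'M[C]_N) (B : 'M[C]_M) v :
  unvec (tensmx A B *m v) = A *m unvec v *m B^T.
Proof.
apply/matrixP => a b; rewrite !mxE sum_tens exchange_big; apply: eq_bigr => d _.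
rewrite !mxE mulr_suml; apply: eq_bigr => c _.
by rewrite tensmxE !mxE mulrAC.
Qed.

Lemma fdot_tensmx (A : 'M[C]_N) (B : 'M[C]_M) v : A \is hermsymmx ->
  fdot v (tensmx A B *m v) = fdot ((unvec v ^t* *m A *m unvec v)^T) B.
Proof.
move=> /hermsymmxP hA; rewrite -fdot_unvec unvec_tensmx.
have -> : fdot ((unvec v ^t* *m A *m unvec v)^T) B = fdot (unvec v ^t* *m A *m unvec v) B^T.
  by rewrite /fdot exchange_big; apply: eq_bigr => i _; apply: eq_bigr => j _; rewrite !mxE.
by rewrite -[in RHS]mulmxA [RHS]fdot_mull adjK [RHS]fdot_mull hA mulmxA.
Qed.

Lemma tensmx_herm (A : 'M[C]_N) (B : 'M[C]_M) : A \is hermsymmx -> B \is hermsymmx ->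
  tensmx A B \is hermsymmx.
Proof.
move=> /hermsymmxP hA /hermsymmxP hB; apply/hermsymmxP.
by rewrite trmx_tens map_mxT hA hB.
Qed.

Lemma H_mx_herm n (A0 : 'M[C]_N) (A : 'I_n -> 'M[C]_N) (G : 'I_n -> 'M[C]_M) :
  A0 \is hermsymmx -> (forall k, A k \is hermsymmx) -> (forall k, G k \is hermsymmx) ->
  H_mx A0 A G \is hermsymmx.
Proof.
move=> h0 hA hG; apply/hermsymmxP; rewrite /H_mx adjD.
congr (_ + _).
  by apply/hermsymmxP/tensmx_herm => //; apply/hermsymmxP; rewrite trmx1 map_mx1.
rewrite linearZ /= map_mxZ; congr (_ *: _).
  by apply/CrealP; rewrite complex_real.
rewrite linear_sum /= map_mx_sum; apply: eq_bigr => k _.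
exact/hermsymmxP/tensmx_herm.
Qed.

Lemma fdot_H_mx n (A0 : 'M[C]_N) (A : 'I_n -> 'M[C]_N) (G : 'I_n -> 'M[C]_M) v :
  A0 \is hermsymmx -> (forall k, A k \is hermsymmx) ->
  fdot v (H_mx A0 A G *m v) = fdot (unvec v) (A0 *m unvec v) +
    (Num.sqrt M%:R)^-1 * \sum_k fdot ((unvec v ^t* *m A k *m unvec v)^T) (G k).
Proof.
move=> h0 hA; rewrite /H_mx mulmxDl fdotDr -scalemxAl fdotZr mulmx_suml fdot_sumr.
congr (_ + _ * _); first by rewrite -fdot_unvec unvec_tensmx trmx1 mulmx1.
by apply: eq_bigr => k _; rewrite fdot_tensmx.
Qed.

End TensorForm.

(** * Independent GUE matrices *)

Section JointLaw.
Context {R : realType} {d : measure_display} {T : measurableType d}.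
Variables (P : probability T R) (n M : nat) (G : 'I_n -> T -> 'M[R[i]]_M).
Hypothesis G_GUE : forall k, is_GUE P (G k).
Hypothesis G_indep : mutually_independent P (fun k => sigma_mx (G k)).
Local Notation J := ('I_n * ('I_M * 'I_M))%type.

(** Two levels of independence are merged: [G_indep] separates the matrices, a box in the
    coordinates of one of them being an event of its [sigma_mx], and [is_GUE] separates the
    coordinates within each. *)
Lemma GUE_joint_law (B : J -> set R) : (forall j, measurable (B j)) ->
  P [set w | forall j, B j (herm_coord (G j.1 w) j.2)] =
  (\prod_j normal_prob 0 (GUE_sd j.2) (B j))%E.
Proof.
move=> mB; pose F k ij := (fun w => herm_coord (G k w) ij) @^-1` B (k, ij).
pose E k := \bigcap_(ij in [set` (finset.setT : {set 'I_M * 'I_M})]) F k ij.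
have -> : [set w | forall j, B j (herm_coord (G j.1 w) j.2)] =
    \bigcap_(k in [set` (finset.setT : {set 'I_n})]) E k.
  apply/seteqP; split => [w /= H k _ ij _|w /= H [k ij]]; first exact: (H (k, ij)).
  by apply: (H k _ ij); rewrite /= finset.in_setT.
rewrite G_indep; last first.
  move=> k _; rewrite /sigma_mx /E.
  apply: (@fin_bigcap_measurable _ (g_sigma_algebraType (\bigcup_(ij in [set: 'I_M * 'I_M])
        (sigma_rv (fun w => complex.Re (G k w ij.1 ij.2)) `|`
         sigma_rv (fun w => complex.Im (G k w ij.1 ij.2)))))) => //.
  move=> ij _; apply: sub_sigma_algebra; rewrite /F /herm_coord.
  have [ijle|ijgt] := leqP ij.1 ij.2.
    by exists ij => //; left; exists (B (k, ij)).
  (* A position below the diagonal stores the imaginary part of the transposed entry, hence the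
     swap. *)
  by exists (ij.2, ij.1) => //; right; exists (B (k, ij)).
transitivity (\prod_(k < n) \prod_ij normal_prob 0 (GUE_sd ij) (B (k, ij)))%E.
  apply: eq_big => [k|k _]; first by rewrite finset.in_setT.
  have [_ _ ind law] := G_GUE k.
  have indE := ind finset.setT (F k).
  rewrite /E {}indE; last by move=> ij _; exists (B (k, ij)).
  by apply: eq_big => [ij|ij _]; [rewrite finset.in_setT|rewrite /F law].
by rewrite pair_bigA; apply: eq_bigr => -[].
Qed.

Lemma GUE_measurable j : measurable_fun setT (fun w => herm_coord (G j.1 w) j.2).
Proof. by have [_ + _ _] := G_GUE j.1; exact. Qed.

End JointLaw.

Section IntegralMonotone.
Context {R : realType} {d : measure_display} {T : measurableType d}.
Variable P : probability T R.

(* [ge0_le_integral] without measurability: the integral of a nonnegative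
   function is defined as a supremum over simple functions below it. *)
Lemma ge0_le_integral_nonmeas (f g : T -> \bar R) :
  (forall t, 0 <= f t)%E -> (forall t, f t <= g t)%E ->
  (\int[P]_t f t <= \int[P]_t g t)%E.
Proof.
move=> f0 fg; have g0 t : (0 <= g t)%E by rewrite (le_trans (f0 t)).
rewrite !ge0_integralTE//; apply: ereal_sup_le => _ [h /= hf <-]; exists h => // x.
exact: le_trans (hf x) (fg x).
Qed.

End IntegralMonotone.

Section GaussianForm.
Context {R : realType} {n N M : nat}.
Local Notation C := R[i].
Variables (A0 : 'M[C]_N) (A : 'I_n -> 'M[C]_N).
Hypothesis A0_herm : A0 \is hermsymmx.
Hypothesis A_psd : forall k, possemidefmx (A k).

Let A_herm k : A k \is hermsymmx. Proof. by have [] := A_psd k. Qed.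

(** [GUE_coef] without the factor [GUE_sd], which [gaussian_law] restores: here the coordinates of G
    are not standardised. *)
Definition GUE_direction (I0 : finType) (X : I0 -> 'M[C]_(N, M))
    (j : 'I_n * ('I_M * 'I_M)) : {ffun I0 * bool -> R} :=
  [ffun i => (Num.sqrt M%:R)^-1 * (herm_weight j.2 * herm_coord (compression A X i j.1) j.2)].

Lemma GUE_direction_process (I0 : finType) (v : I0 -> 'cV[C]_(N * M))
    (G : 'I_n -> 'M[C]_M) p s : (forall k, G k \is hermsymmx) ->
  (mean_process A0 (fun p => unvec (v p)) +
   \sum_j herm_coord (G j.1) j.2 *: GUE_direction (fun p => unvec (v p)) j) (p, s) =
  sg s * fdot (v p) (H_mx A0 A G *m v p).
Proof.
move=> hG; rewrite fdot_H_mx// mulrDr !ffunE /=; congr (_ + _).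
rewrite sum_ffunE sum_pair mulrCA mulr_sumr mulr_sumr; apply: eq_bigr => k _.
have -> : sg s * fdot ((unvec (v p) ^t* *m A k *m unvec (v p))^T) (G k) =
    fdot (compression A (fun p => unvec (v p)) (p, s) k) (G k).
  by rewrite /compression /= fdotZl.
rewrite fdot_herm_coord//; last exact: compression_herm.
rewrite mulr_sumr; apply: eq_bigr => ij _.
by rewrite !ffunE /GRing.scale /=; ring.
Qed.

End GaussianForm.

Section Expectation.
Context {R : realType} {d : measure_display} {T : measurableType d}.
Variables (P : probability T R) (n N M : nat).
Local Notation C := R[i].
Hypothesis n_gt0 : (0 < n)%N.
Hypothesis N_gt0 : (0 < N)%N.
Hypothesis M_gt0 : (0 < M)%N.
Variables (A0 : 'M[C]_N) (A : 'I_n -> 'M[C]_N) (G : 'I_n -> T -> 'M[C]_M).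
Hypothesis A0_herm : A0 \is hermsymmx.
Hypothesis A_psd : forall k, possemidefmx (A k).
Hypothesis G_GUE : forall k, is_GUE P (G k).
Hypothesis G_indep : mutually_independent P (fun k => sigma_mx (G k)).

(** With both signs among the indices, the Lipschitz maximum f dominates every |<v, H v>| on the
    net. Solving the net inequality for the norm yields the factor 1 / (1 - 2 e), and f has the law
    handled by [GUE_mean_le]. *)
Lemma opnorm_expectation_net (e : R) : 0 < e -> 0 < 1 - 2 * e ->
  ('E_P [fun w => opnorm (H_mx A0 A (fun k => G k w))] <=
   ((1 - 2 * e)^-1 * (rho_star A0 A + 9 * Num.sqrt ((n * N)%:R / M%:R) *
    Num.sqrt (opnorm (\sum_(k < n) A k *m A k))))%:E)%E.
Proof.
move=> e0 e1.
have A_herm k : A k \is hermsymmx by have [] := A_psd k.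
have hG w k : G k w \is hermsymmx by have [+ _ _ _] := G_GUE k; exact.
have [|s [s0 s1 net]] := @opnorm_net R (N * M) e e0; first by rewrite muln_gt0 N_gt0.
pose v (p : 'I_(size s)) := s`_p.
have v1 p : frob (unvec (v p)) = 1 by rewrite /frob fdot_unvec; apply: s1; rewrite mem_nth.
pose p0 := Ordinal s0.
pose m := mean_process A0 (fun p => unvec (v p)).
pose u := GUE_direction A (fun p => unvec (v p)).
pose Y w := m + \sum_j herm_coord (G j.1 w) j.2 *: u j.
have YE w p b : Y w (p, b) = sg b * fdot (v p) (H_mx A0 A (fun k => G k w) *m v p).
  exact: GUE_direction_process.
pose f w := fmax (p0, true) (Y w).
have fv w p : `|fdot (v p) (H_mx A0 A (fun k => G k w) *m v p)| <= f w.
  have := fmax_ge (p0, true) (Y w) (p, true); have := fmax_ge (p0, true) (Y w) (p, false).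
  rewrite !YE /sg mul1r mulN1r -/(f w) => H1 H2.
  by rewrite ler_norml H2 lerNl H1.
have f0 w : 0 <= f w by rewrite (le_trans _ (fv w p0)).
have Hf w : opnorm (H_mx A0 A (fun k => G k w)) <= (1 - 2 * e)^-1 * f w.
  rewrite ler_pdivlMl// mulrBl mul1r lerBlDr; apply: net => //.
    exact: H_mx_herm.
  by move=> x /(nthP 0)[i si <-]; exact: (fv w (Ordinal si)).
have c0 : 0 < (1 - 2 * e)^-1 by rewrite invr_gt0.
have law := GUE_joint_law G_GUE G_indep.
have sd0 (j : 'I_n * ('I_M * 'I_M)) : 0 < GUE_sd (R := R) j.2 by exact: GUE_sd_gt0.
have lf := fmax_lip (R := R) (p0, true).
have fI : P.-integrable setT (EFin \o f).
  exact: (integrable_gaussian_law u sd0 (GUE_measurable G_GUE) law m lf).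
have fE : \int[P]_w f w <= rho_star A0 A + 9 * Num.sqrt ((n * N)%:R / M%:R) *
    Num.sqrt (opnorm (\sum_(k < n) A k *m A k)).
  rewrite (gaussian_law u sd0 (GUE_measurable G_GUE) law m lf).
  have nN : (0 < n * N)%N by rewrite muln_gt0 n_gt0.
  apply: le_trans (GUE_mean_le M_gt0 nN A0_herm A_psd v1 p0).
  rewrite (gmeans_lin_process (GUE_coef A (fun p => unvec (v p))) (fmax (p0, true)) m).
  rewrite le_eqVlt; apply/orP; left; apply/eqP; congr (gmeans _ _ _).
  apply: eq_map => j; apply/ffunP => i; rewrite !ffunE /GUE_coef /GRing.scale /=.
  by rewrite mulrCA.
rewrite unlock.
apply: (@le_trans _ _ (\int[P]_w ((1 - 2 * e)^-1 * f w)%:E)%E).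
  apply: ge0_le_integral_nonmeas => w; rewrite lee_fin; first exact: opnorm_ge0.
  exact: Hf.
under eq_integral do rewrite EFinM.
rewrite integralZl// EFinM lee_pmul2l// -[X in (X <= _)%E]fineK.
  by rewrite lee_fin.
exact: integrable_fin_num.
Qed.

End Expectation.

Theorem theorem7p2 (R : realType) (d : measure_display) (T : measurableType d)
    (P : probability T R) (n N M : nat)
    (n_ge1 : (1 <= n)%N) (N_ge1 : (1 <= N)%N) (M_ge1 : (1 <= M)%N)
    (N_le_M : (N <= M)%N)
    (A0 : 'M[R[i]]_N) (A : 'I_n -> 'M[R[i]]_N)
    (A0_herm : A0 \is hermsymmx)
    (A_psd : forall k, possemidefmx (A k))
    (G : 'I_n -> T -> 'M[R[i]]_M)
    (G_GUE : forall k, is_GUE P (G k))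
    (G_indep : mutually_independent P (fun k => sigma_mx (G k))) :
  ('E_P [fun w => opnorm (H_mx A0 A (fun k => G k w))] <=
   (rho_star A0 A +
    9 * Num.sqrt ((n * N)%:R / M%:R) *
    Num.sqrt (opnorm (\sum_(k < n) A k *m A k)))%:E)%E.
Proof.
have key := opnorm_expectation_net n_ge1 N_ge1 M_ge1 A0_herm A_psd G_GUE G_indep.
have E0 : (0 <= 'E_P [fun w => opnorm (H_mx A0 A (fun k => G k w))])%E.
  by apply: expectation_ge0 => w; exact: opnorm_ge0.
move: key E0; set x := expectation _ _; set b := (_ + _) => key E0.
(* At mesh 1/4 the factor is 2, and a nonnegative expectation below 2 b forces b >= 0. *)
have b0 : 0 <= b.
  have := le_trans E0 (key (1 / 4) ltac:(lra) ltac:(lra)); rewrite lee_fin pmulr_rge0 ?invr_gt0 //; lra.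
apply/lee_addgt0Pr => e e0; rewrite -EFinD; move: (e : R) e0 => {}e e0.
clearbody b; have d0 : 0 < b + 1 + e by lra.
(* This mesh turns the factor into (b + 1 + e) / (b + 1), whose product with b is b + e - e / (b +
   1), at most b + e. *)
have dE : 1 - 2 * (e / (2 * (b + 1 + e))) = (b + 1) / (b + 1 + e).
  by field; rewrite gt_eqF.
have b1 : 0 < b + 1 by rewrite ltr_wpDl.
have := key (e / (2 * (b + 1 + e))); rewrite dE => H; apply: (le_trans (H _ _)).
- by rewrite divr_gt0// mulr_gt0.
- by rewrite divr_gt0//; lra.
rewrite lee_fin invf_div.
have -> : (b + 1 + e) / (b + 1) * b = b + e - e / (b + 1).
  by field; rewrite gt_eqF.
by rewrite gerBl divr_ge0//; lra.
Qed.
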